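(* Let $\Omega\subset\mathbb{R}^k$ be a connected open set and let $(O_n)_{n\ge 1}$ be an admissible sequence of open subsets of $\Omega$. Then the map $$i:\mathcal{G}_a(\Omega)\to\mathcal{G}(\Omega),\qquad f(z,\zeta)\mapsto f(x,\xi)+\mathcal{N}(\Omega),$$ obtained by restricting $f$ to the real variables $(x,\xi)$, $x\in\Omega$, $\xi>0$ small, modulo $\mathcal{N}(\Omega)$, is injective.
   Context: Notation: $z=x+iy\in\mathbb{C}^k$ with $x\in\Omega$, $y\in\mathbb{R}^k$; $\zeta=\xi+i\eta\in\mathbb{C}$ with $\xi,\eta\in\mathbb{R}$; $\arg$ is the principal argument. Admissible sequence: nonvoid open sets $O_n\subset\Omega$ ($n\ge1$) with $O_{n+1}\subset O_n$ and $d(O_{n+1},\Omega\setminus O_n)>0$ for all $n$ ($d$ is the distance between sets). Set $$A_n=\{(z,\zeta)\in\mathbb{C}^k\times\mathbb{C}: x\in\Omega,\ x\notin O_{n+1},\ |\arg\zeta|<\tfrac1n,\ 0<|\zeta|<\tfrac1n,\ |y_i|<\tfrac1n|\zeta|,\ 1\le i\le k\},$$ $$B_n=\{(z,\zeta)\in\mathbb{C}^k\times\mathbb{C}: x\in O_n,\ 0<|\zeta|<\tfrac1n,\ |y_i|<\tfrac1n,\ 1\le i\le k\},$$ and $V_n=A_n\cup B_n$. The $V_n$ are connected open sets, decreasing in $n$. For a continuous $\phi:\Omega\to\mathbb{R}_+^*=(0,\infty)$, $H_{n,\phi}$ is the Banach space of holomorphic $f:V_n\to\mathbb{C}$ for which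 there is a constant $c>0$ with $|f(z,\zeta)|\le c\,\phi(x)/|\zeta|^n$ on $V_n$, with norm $\|f\|_{n,\phi}=\sup_{(z,\zeta)\in V_n}|\zeta|^n|f(z,\zeta)|/\phi(x)$. If $n'\ge n$ and $\psi\ge\phi$, then $f\mapsto f|_{V_{n'}}$ is an injective map $H_{n,\phi}\to H_{n',\psi}$. $\mathcal{G}_a(\Omega)$ is the algebraic inductive limit (union, under these identifications) of all the $H_{n,\phi}$; it is an algebra under pointwise product. $\mathcal{E}(\Omega)$ is the algebra of $\mathcal{C}^\infty$ functions $f:\Omega\times]0,1]\to\mathbb{C}$ such that for every multi-index $\alpha$ and every compact $K\subset\Omega$ there exist $N$ and a constant $c$ with $\sup_{x\in K}|\partial_x^\alpha f(x,\xi)|\le c\,\xi^{-N}$ for all $\xi>0$ small enough. $\mathcal{N}(\Omega)$ is the ideal of $f\in\mathcal{E}(\Omega)$ such that for every $\alpha$, every compact $K\subset\Omega$ and every $q\in\mathbb{N}$ there is $c>0$ with $\sup_{x\in K}|\partial_x^\alpha f(x,\xi)|\le c\,\xi^q$ for all $\xi>0$ small enough. $\mathcal{G}(\Omega)=\mathcal{E}(\Omega)/\mathcal{N}(\Omega)$. For $f\in H_{n,\phi}$ the function $(x,\xi)\mapsto f(x,\xi)$ is defined for $x\in\Omega$, $0<\xi<1/n$; it defines a class in $\mathcal{G}(\Omega)$ since only small $\xi$ matter (modify/extend it smoothly for $\xi$ away from $0$; the class does not depend on this). *)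

(* Defs.v *)
From HB Require Import structures.
From mathcomp Require Import all_boot all_order all_algebra.
From mathcomp Require Import complex.
From mathcomp Require Import all_classical all_reals all_analysis.

Set Implicit Arguments.
Unset Strict Implicit.
Unset Printing Implicit Defensive.

Import Order.TTheory GRing.Theory Num.Theory.
Import numFieldNormedType.Exports.

Local Open Scope classical_set_scope.
Local Open Scope ring_scope.
Local Open Scope complex_scope.

(* [R[i]] as a normed module over itself, so that [differentiable] below is
   differentiability over the complex field. *)
HB.instance Definition _ (R : rcfType) := GRing.ComAlgebra.copy R[i] R[i]^o.
HB.instance Definition _ (R : rcfType) := Vector.copy R[i] R[i]^o.
HB.instance Definition _ (R : rcfType) := NormedModule.copy R[i] R[i]^o.

(* Real-valued modulus; the library norm [`|z|] of [R[i]] is [(normc z)%:C]. *)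
Notation normc := ComplexField.Normc.normc.

(* Principal argument, in ]-pi, pi]; the value at [0] is irrelevant. *)
Definition carg (R : realType) (z : R[i]) : R :=
  if 0 <= complex.Im z then acos (complex.Re z / normc z)
  else - acos (complex.Re z / normc z).

Lemma cargP (R : realType) (z : R[i]) : z != 0 ->
  (- pi < carg z <= pi) /\
  z = (normc z * cos (carg z)) +i* (normc z * sin (carg z)).
Proof.
case: z => a b z0; rewrite /carg /=.
set r := Num.sqrt _.
have s0 : 0 < a ^+ 2 + b ^+ 2.
  rewrite lt_neqAle addr_ge0 ?sqr_ge0// andbT eq_sym paddr_eq0 ?sqr_ge0//.
  by rewrite !sqrf_eq0; apply: contraNN z0 => /andP[/eqP -> /eqP ->].
have r0 : 0 < r by rewrite sqrtr_gt0.
have rn0 : r != 0 by rewrite gt_eqF.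
have r2 : r ^+ 2 = a ^+ 2 + b ^+ 2 by rewrite sqr_sqrtr// ltW.
have ar : `|a| <= r.
  by rewrite -sqrtr_sqr ler_wsqrtr// lerDl sqr_ge0.
have ar1 : -1 <= a / r <= 1.
  by rewrite -ler_norml normrM normfV (gtr0_norm r0) ler_pdivrMr// mul1r.
have sa : Num.sqrt (1 - (a / r) ^+ 2) = `|b| / r.
  have -> : 1 - (a / r) ^+ 2 = (b / r) ^+ 2.
    rewrite !expr_div_n -[1](@divff _ (r ^+ 2)) ?sqrf_eq0//.
    by rewrite -mulrBl {1}r2 addrAC subrr add0r.
  by rewrite sqrtr_sqr normrM normfV (gtr0_norm r0).
have rK x : r * (x / r) = x by rewrite mulrC divfK.
case: (leP 0 b) => b0.
  split; last by rewrite acosK// sin_acos// sa ger0_norm// !rK.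
  by rewrite acos_lepi// andbT (lt_le_trans _ (acos_ge0 ar1))// oppr_lt0 pi_gt0.
split; last first.
  by rewrite cosN sinN acosK// sin_acos// sa ltr0_norm// mulNr opprK !rK.
rewrite ltrN2 (le_trans (_ : _ <= 0)) ?pi_ge0 ?oppr_le0 ?acos_ge0// andbT.
rewrite lt_neqAle acos_lepi// andbT.
apply/eqP => /(congr1 sin); rewrite sinpi sin_acos// sa => /eqP.
by rewrite mulf_eq0 invr_eq0 (negbTE rn0) orbF normr_eq0 lt_eqF.
Qed.

Section domains.
Variables (R : realType) (k : nat).

Definition ReV (z : 'rV[R[i]]_k) : 'rV[R]_k := map_mx (@complex.Re R) z.
Definition ImV (z : 'rV[R[i]]_k) : 'rV[R]_k := map_mx (@complex.Im R) z.

(* The distance is [+oo] when one of the sets is empty. The norm of ['rV[R]_k]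
   is the sup norm; positivity of the distance does not depend on the norm. *)
Definition set_dist (A B : set 'rV[R]_k) : \bar R :=
  ereal_inf [set `|x - y|%:E | x in A & y in B].

Variables (Om : set 'rV[R]_k) (O : nat -> set 'rV[R]_k).

(* The sequence is indexed by n >= 1; [O 0] plays no role. *)
Definition admissible : Prop := forall n, (0 < n)%N ->
  [/\ open (O n), O n !=set0, O n `<=` Om, O n.+1 `<=` O n &
      (0 < set_dist (O n.+1) (Om `\` O n))%E].

Definition A_set (n : nat) : set ('rV[R[i]]_k * R[i]) :=
  [set p | [/\ Om (ReV p.1), ~ O n.+1 (ReV p.1),
               `|carg p.2| < n%:R^-1,
               0 < normc p.2 < n%:R^-1 &
               forall i, `|ImV p.1 0 i| < n%:R^-1 * normc p.2]].

Definition B_set (n : nat) : set ('rV[R[i]]_k * R[i]) :=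
  [set p | [/\ O n (ReV p.1),
               0 < normc p.2 < n%:R^-1 &
               forall i, `|ImV p.1 0 i| < n%:R^-1]].

Definition V_set (n : nat) := A_set n `|` B_set n.

End domains.

Section analytic_generalized_functions.
Variables (R : realType) (k : nat).
Variables (Om : set 'rV[R]_k) (O : nat -> set 'rV[R]_k).

Definition weight (phi : 'rV[R]_k -> R) : Prop :=
  {within Om, continuous phi} /\ forall x, Om x -> 0 < phi x.

Definition holomorphic_on (W : set ('rV[R[i]]_k * R[i]))
    (f : 'rV[R[i]]_k * R[i] -> R[i]) : Prop :=
  forall p, W p -> differentiable f p.

(* A function on [V_set Om O n] is a total function whose values outside
   [V_set Om O n] are disregarded. *)
Definition Hspace (n : nat) (phi : 'rV[R]_k -> R) :
    set ('rV[R[i]]_k * R[i] -> R[i]) :=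
  [set f | holomorphic_on (V_set Om O n) f /\
     exists2 c : R, 0 < c & forall p, V_set Om O n p ->
       normc (f p) <= c * phi (ReV p.1) / normc p.2 ^+ n].

(* [MkHelt n phi f] stands for [f] seen as an element of [Hspace n phi]. *)
Record Helt := MkHelt {
  Hidx : nat;
  Hweight : 'rV[R]_k -> R;
  Hfun : 'rV[R[i]]_k * R[i] -> R[i] }.

Definition Hunion : set Helt :=
  [set t | [/\ (0 < Hidx t)%N, weight (Hweight t) &
               Hspace (Hidx t) (Hweight t) (Hfun t)]].

(* Two elements are identified when they have the same image in a common
   [Hspace m psi]. *)
Definition Hsim (s t : Helt) : Prop :=
  exists (m : nat) (psi : 'rV[R]_k -> R),
    [/\ (Hidx s <= m)%N /\ (Hidx t <= m)%N, weight psi,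
        (forall x, Om x -> Hweight s x <= psi x),
        (forall x, Om x -> Hweight t x <= psi x) &
        (forall p, V_set Om O m p -> Hfun s p = Hfun t p)].

Definition Hclass (s : Helt) : set Helt := [set t | Hunion t /\ Hsim s t].

(* Quotients are sets of equivalence classes. *)
Definition Ga : set (set Helt) := Hclass @` Hunion.

End analytic_generalized_functions.

Section colombeau.
Variables (R : realType) (k : nat).
Local Notation X := ('rV[R]_k * R)%type.

Definition basis_vec (o : option 'I_k) : X :=
  if o is Some i then (delta_mx 0 i, 0) else (0, 1).

Fixpoint Cn_on (m : nat) (W : set X) (g : X -> R) : Prop :=
  (forall p, W p -> {for p, continuous g}) /\
  (if m is m'.+1 then forall o,
     (forall p, W p -> derivable g p (basis_vec o)) /\
     Cn_on m' W (fun p => 'D_(basis_vec o) g p)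
   else True).

Variable Om : set 'rV[R]_k.

(* The interval ]0, 1] is not open: smooth means locally extendable to a
   smooth function across xi = 1. *)
Definition smooth_real (g : X -> R) : Prop :=
  exists (W : set X) (h : X -> R),
    [/\ open W, Om `*` `]0, 1] `<=` W, (forall m, Cn_on m W h) &
        (forall p, (Om `*` `]0, 1]) p -> g p = h p)].

Definition smooth (F : X -> R[i]) : Prop :=
  smooth_real (fun p => complex.Re (F p)) /\
  smooth_real (fun p => complex.Im (F p)).

Definition mderive (a : 'I_k -> nat) (u : 'rV[R]_k -> R) : 'rV[R]_k -> R :=
  foldr (fun i => iter (a i) (fun v x => 'D_(delta_mx 0 i) v x))
    u (enum 'I_k).

Definition xderive (a : 'I_k -> nat) (F : X -> R[i]) (x : 'rV[R]_k) (xi : R) :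
    R[i] :=
  mderive a (fun y => complex.Re (F (y, xi))) x +i*
  mderive a (fun y => complex.Im (F (y, xi))) x.

(* Functions on Om x ]0, 1] are total functions with junk values elsewhere;
   membership in [Emod] and [Nnull] only depends on the values there. *)
Definition Emod : set (X -> R[i]) :=
  [set F | smooth F /\
     forall (a : 'I_k -> nat) (K : set 'rV[R]_k), compact K -> K `<=` Om ->
       exists (N : nat) (c : R), \forall xi \near 0^'+,
         forall x, K x -> normc (xderive a F x xi) <= c * xi ^- N].

Definition Nnull : set (X -> R[i]) :=
  [set F | Emod F /\
     forall (a : 'I_k -> nat) (K : set 'rV[R]_k) (q : nat),
       compact K -> K `<=` Om ->
       exists2 c : R, 0 < c & \forall xi \near 0^'+,
         forall x, K x -> normc (xderive a F x xi) <= c * xi ^+ q].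

Definition coset (F : X -> R[i]) : set (X -> R[i]) :=
  [set H | Emod H /\ Nnull (H \- F)].

Definition Gcol : set (set (X -> R[i])) := coset @` Emod.

Definition real_restriction (f : 'rV[R[i]]_k * R[i] -> R[i]) (p : X) : R[i] :=
  f (map_mx (real_complex R) p.1, p.2%:C).

(* [f] is only defined for small xi > 0; its class is that of any [F] in
   [Emod] that coincides with it there, uniformly in x. *)
Definition represents (F : X -> R[i]) (f : 'rV[R[i]]_k * R[i] -> R[i]) : Prop :=
  \forall xi \near 0^'+, forall x, Om x -> F (x, xi) = real_restriction f (x, xi).

(* The class is written as the union of the cosets obtained from all choices
   of a representative [t] and of [F]; it is an element of [Gcol] exactly when
   some choice exists and all choices give the same coset. *)
Definition imap (u : set (Helt R k)) : set (X -> R[i]) :=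
  [set H | exists t F,
     [/\ u t, Emod F, represents F (Hfun t) & coset F H]].

End colombeau.

(* Main.v *)
(* A class in the kernel is a difference [f] of two elements of the inductive
   limit that is O(xi ^ q) for every [q] at every real point [x]. If [x] lies
   in [O m], then [f (x, .)] lives on a punctured disc and has a pole of finite
   order at [0], so it vanishes; the identity theorem propagates this over the
   connected domain [V_set Om O m]. Conversely the real restriction of [f] is
   moderate by Cauchy's estimates on polydiscs of radius proportional to [xi].

   The complex analysis rests on a single estimate, |g'(a)| <= 4 sup|g| / r on
   a disc of radius [r]. It follows from Goursat's bisection argument in
   logarithmic coordinates around [a], with antiderivatives on segments instead
   of contour integrals. Applied to difference quotients, it shows that
   derivatives of holomorphic functions are holomorphic. *)

From Pilot Require Import Defs.
From mathcomp Require Import all_boot all_order all_algebra.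
From mathcomp Require Import complex.
From mathcomp Require Import all_classical all_reals all_analysis.
From mathcomp Require Import ring lra.

Set Implicit Arguments.
Unset Strict Implicit.
Unset Printing Implicit Defensive.

Import Order.TTheory GRing.Theory Num.Theory.
Import numFieldNormedType.Exports.
(* Imported again because Num.Theory has lemmas named ReV and ImV. *)
Import Pilot.Defs.

Local Open Scope classical_set_scope.
Local Open Scope ring_scope.
Local Open Scope complex_scope.

(** * Goursat's lemma for closed forms *)

(** The shape of [V_set Om O n] dictates the two halves. Over [O n] the slice in [zeta] is a full
    punctured disc, and only there can a one-variable function be continued across [0]; elsewhere
    over [Om] the slice is a sector, and the imaginary parts of [z] are bounded by [|zeta| / n].
    Vanishing is therefore established over [O n], and what travels to the other points is vanishing
    on a neighbourhood, a property that is both open and closed. For the same reason a derivative at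
    height [xi] has only a disc of radius proportional to [xi] at its disposal: it costs one factor
    [1 / xi], which moderateness absorbs.

    Vanishing of a flat one-variable function is obtained without power series, by dividing by [z]
    indefinitely while controlling the bound. Several variables are always reduced to complex lines.
    Nullity enters through its order-zero estimates at single points, whereas estimates of all
    orders are needed to see that restrictions define elements of [Gcol] at all. *)

Lemma MVT_bound (R : realType) (f df : R -> R) (a b c : R) : a <= b ->
  (forall x, a <= x <= b -> is_derive x 1 f (df x)) ->
  (forall x, a <= x <= b -> `|df x| <= c) -> `|f b - f a| <= c * (b - a).
Proof.
move=> ab fd dfc.
have [||x] := @MVT_segment R f df a b ab.
- by move=> x; rewrite in_itv /= => /andP[ax xb]; apply: fd; rewrite !ltW.
- by apply: derivable_within_continuous => x; rewrite in_itv /= => /fd[].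
rewrite in_itv /= => xab ->.
by rewrite normrM (ger0_norm (_ : 0 <= b - a)) ?subr_ge0// ler_wpM2r ?subr_ge0 ?dfc.
Qed.

Section goursat.
Variable R : realType.
Implicit Types (K p q : R -> R -> R) (a b l m s t : R).

Definition mixed_diff K s t l m :=
  K (s + l) (t + m) - K (s + l) t - K s (t + m) + K s t.

Lemma nested_intervals (x : nat -> R) l :
  (forall n, x n <= x n.+1) ->
  (forall n, x n.+1 + l / 2 ^+ n.+1 <= x n + l / 2 ^+ n) -> 0 <= l ->
  exists c, forall n, x n <= c <= x n + l / 2 ^+ n.
Proof.
move=> x_incr y_decr l0.
have xh : {homo x : i j / (i <= j)%N >-> i <= j} by apply/nondecreasing_seqP.
have yh : {homo (fun n => x n + l / 2 ^+ n) : i j / (i <= j)%N >-> j <= i}.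
  exact/nonincreasing_seqP.
have l_ge0 n : 0 <= l / 2 ^+ n by rewrite divr_ge0// exprn_ge0.
have xy i j : x i <= x j + l / 2 ^+ j.
  have [ij|/ltnW ji] := leqP i j.
    by rewrite (le_trans (xh _ _ ij))// lerDl.
  by rewrite (le_trans _ (yh _ _ ji))// lerDl.
exists (sup (range x)) => n; apply/andP; split.
  apply: ub_le_sup; last by exists n.
  by exists (x 0%N + l / 2 ^+ 0) => _ [i _ <-].
apply: ge_sup; first by exists (x 0%N), 0%N.
by move=> _ [i _ <-].
Qed.

(* Bisection: one of the four quarters carries at least a quarter of the mixed
   difference, and the mixed difference is additive. *)
Lemma mixed_diff_eq0 K a b l m : 0 <= l -> 0 <= m ->
  (forall s t, a <= s <= a + l -> b <= t <= b + m -> forall e, 0 < e ->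
    exists2 d, 0 < d & forall x y u v, 0 <= u < d -> 0 <= v < d ->
      x <= s <= x + u -> y <= t <= y + v ->
      a <= x -> x + u <= a + l -> b <= y -> y + v <= b + m ->
      `|mixed_diff K x y u v| <= e * (u + v) ^+ 2) ->
  mixed_diff K a b l m = 0.
Proof.
move=> l0 m0 Ksmall; apply/eqP/contraT; rewrite -normr_gt0.
set eta := `|_| => eta0.
(* Halving both sides divides an error [e * (u + v) ^+ 2] by [4], so keeping a quarter of the mixed
   difference at each stage is just enough for a contradiction. *)
pose inv (p : R * R) n := [/\ a <= p.1 /\ p.1 + l / 2 ^+ n <= a + l,
  b <= p.2 /\ p.2 + m / 2 ^+ n <= b + m &
  eta / 4 ^+ n <= `|mixed_diff K p.1 p.2 (l / 2 ^+ n) (m / 2 ^+ n)|].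
(* The invariant stands after the existential, so that [choice] gives a total successor function. *)
have step (pn : (R * R) * nat) : exists p' : R * R, inv pn.1 pn.2 ->
  [/\ inv p' pn.2.+1,
    pn.1.1 <= p'.1, p'.1 + l / 2 ^+ pn.2.+1 <= pn.1.1 + l / 2 ^+ pn.2,
    pn.1.2 <= p'.2 & p'.2 + m / 2 ^+ pn.2.+1 <= pn.1.2 + m / 2 ^+ pn.2].
  case: pn => -[x y] n /=.
  have [|ninv] := pselect (inv (x, y) n); last by exists 0.
  move=> [/= [ax xl] [by_ ym] bad].
  pose u := l / 2 ^+ n.+1; pose v := m / 2 ^+ n.+1.
  have lu : l / 2 ^+ n = u + u by rewrite /u exprS invfM; field.
  have mv : m / 2 ^+ n = v + v by rewrite /v exprS invfM; field.
  have u0 : 0 <= u by rewrite divr_ge0// exprn_ge0.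
  have v0 : 0 <= v by rewrite divr_ge0// exprn_ge0.
  have e4 : eta / 4 ^+ n = 4 * (eta / 4 ^+ n.+1) by rewrite exprS invfM; field.
  have key : exists s t, [/\ s = x \/ s = x + u, t = y \/ t = y + v &
      eta / 4 ^+ n.+1 <= `|mixed_diff K s t u v|].
    apply: contrapT => nkey.
    have small s t : s = x \/ s = x + u -> t = y \/ t = y + v ->
        `|mixed_diff K s t u v| < eta / 4 ^+ n.+1.
      by move=> hs ht; rewrite ltNge; apply/negP => h; apply: nkey; exists s, t.
    have E : mixed_diff K x y (l / 2 ^+ n) (m / 2 ^+ n) =
        (mixed_diff K x y u v + mixed_diff K (x + u) y u v) +
        (mixed_diff K x (y + v) u v + mixed_diff K (x + u) (y + v) u v).
      by rewrite lu mv /mixed_diff !addrA; ring.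
    move: bad; rewrite E e4.
    have h1 := small _ _ (or_introl erefl) (or_introl erefl).
    have h2 := small _ _ (or_intror erefl) (or_introl erefl).
    have h3 := small _ _ (or_introl erefl) (or_intror erefl).
    have h4 := small _ _ (or_intror erefl) (or_intror erefl).
    have n1 := ler_normD (mixed_diff K x y u v + mixed_diff K (x + u) y u v)
        (mixed_diff K x (y + v) u v + mixed_diff K (x + u) (y + v) u v).
    have n2 := ler_normD (mixed_diff K x y u v) (mixed_diff K (x + u) y u v).
    have n3 := ler_normD (mixed_diff K x (y + v) u v)
      (mixed_diff K (x + u) (y + v) u v).
    clear - h1 h2 h3 h4 n1 n2 n3; lra.
  move: key => [s [t [hs ht bad']]]; exists (s, t) => _.
  rewrite /inv /= -/u -/v lu mv; rewrite lu in xl; rewrite mv in ym.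
  have [s1 s2] : x <= s /\ s + u <= x + (u + u) by clear - hs u0; case: hs => ->; split; lra.
  have [t1 t2] : y <= t /\ t + v <= y + (v + v) by clear - ht v0; case: ht => ->; split; lra.
  by clear - ax xl by_ ym s1 s2 t1 t2 bad'; split=> //; split=> //; split; lra.
have [f fP] := choice step.
pose sq := fix sq n := if n is n'.+1 then f (sq n', n') else (a, b).
have sq_inv n : inv (sq n) n.
  elim: n => [|n IH]; first by split => //=; rewrite ?expr0 ?divr1 ?lexx.
  by have [] := fP (sq n, n) IH.
have [X XP] : exists c, forall n, (sq n).1 <= c <= (sq n).1 + l / 2 ^+ n.
  by apply: nested_intervals => // n; have [] := fP (sq n, n) (sq_inv n).
have [Y YP] : exists c, forall n, (sq n).2 <= c <= (sq n).2 + m / 2 ^+ n.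
  by apply: nested_intervals => // n; have [] := fP (sq n, n) (sq_inv n).
have aX : a <= X <= a + l by have := XP 0%N; rewrite /= expr0 divr1.
have bY : b <= Y <= b + m by have := YP 0%N; rewrite /= expr0 divr1.
have lm0 : 0 < (l + m) ^+ 2 + 1 by rewrite ltr_pwDr// sqr_ge0.
(* With this tolerance the hypothesis bounds the mixed difference of a small enough rectangle by
   [eta / 4 ^+ n] times [(l + m) ^+ 2 / ((l + m) ^+ 2 + 1)], a factor below [1]. *)
have [d d0 dP] := Ksmall X Y aX bY _ (divr_gt0 eta0 lm0).
have [n nd] : exists n, l / 2 ^+ n < d /\ m / 2 ^+ n < d.
  have h : (fun n => 2^-1 ^+ n : R) @ \oo --> 0.
    by apply: cvg_expr; rewrite ger0_norm ?invf_lt1// ltrDl.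
  have lm1 : 0 < l + m + 1 by rewrite ltr_pwDr// addr_ge0.
  have /cvgrPdist_lt/(_ _ (divr_gt0 d0 lm1)) := h.
  move=> [n _ /(_ n (leqnn n))] /=; rewrite sub0r normrN ger0_norm; last first.
    by rewrite exprn_ge0// invr_ge0.
  rewrite ltr_pdivlMr// exprVn mulrC => h'.
  have i0 : 0 < (2 ^+ n)^-1 :> R by rewrite invr_gt0 exprn_gt0.
  by exists n; split; apply: le_lt_trans h'; rewrite ler_wpM2r ?ltW//; lra.
have [[i1 i2] [i3 i4] bad] := sq_inv n.
have p2 : 0 < 2 ^+ n :> R by rewrite exprn_gt0.
have := dP (sq n).1 (sq n).2 (l / 2 ^+ n) (m / 2 ^+ n).
have [nd1 nd2] := nd; rewrite !(divr_ge0 _ (ltW p2)) //= nd1 nd2 => /(_ isT isT (XP n) (YP n) i1 i2 i3 i4).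
move=> /(le_trans bad).
rewrite -mulrDl expr_div_n -exprM mulnC exprM.
have -> : 2 ^+ 2 = 4 :> R by ring.
rewrite mulrA ler_pM2r ?invr_gt0 ?exprn_gt0//.
rewrite -mulrA ler_pMr// mulrC ler_pdivlMr// mul1r => h.
lra.
Qed.

Lemma ler_dist_itv s x u z : x <= s -> s <= x + u -> x <= z -> z <= x + u ->
  `|z - s| <= u.
Proof. by move=> *; rewrite ler_norml; apply/andP; split; lra. Qed.

(* The integral of [p ds + q dt] along the boundary of a rectangle is the mixed
   difference of [Q - P]. *)
Lemma goursat_closed_form p q P Q a b l m : 0 <= l -> 0 <= m ->
  (forall s t, a <= s <= a + l -> b <= t <= b + m ->
    is_derive s 1 (fun x => P x t) (p s t)) ->
  (forall s t, a <= s <= a + l -> b <= t <= b + m ->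
    is_derive t 1 (fun y => Q s y) (q s t)) ->
  (forall s t, a <= s <= a + l -> b <= t <= b + m -> exists A B C : R,
    forall e, 0 < e -> exists2 d, 0 < d & forall x y,
      a <= x <= a + l -> b <= y <= b + m -> `|x - s| < d -> `|y - t| < d ->
      `|p x y - p s t - A * (x - s) - B * (y - t)| <= e * (`|x - s| + `|y - t|) /\
      `|q x y - q s t - B * (x - s) - C * (y - t)| <= e * (`|x - s| + `|y - t|)) ->
  mixed_diff (fun s t => Q s t - P s t) a b l m = 0.
Proof.
move=> l0 m0 dP dQ pq; apply: mixed_diff_eq0 => // s t hs ht e e0.
have [A [B [C /(_ (e / 2))]]] := pq s t hs ht.
rewrite divr_gt0// => /(_ isT)[d d0 dpq]; exists d => // x y u v.
move=> /andP[u0 ud] /andP[v0 vd] /andP[xs sx] /andP[yt ty] ax xl by_ ym.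
(* [P] minus a primitive of the affine part of [p] has a small derivative along a horizontal side.
   In the mixed difference the terms in [p s t] and [A] cancel between opposite sides, and those in
   [B] cancel against their counterparts in [hQ]: this is where closedness of the form enters. *)
have hP y' : y <= y' <= y + v ->
    `|P (x + u) y' - P x y' - p s t * u - A * ((x + u - s) ^+ 2 - (x - s) ^+ 2) / 2
      - B * (y' - t) * u| <= e / 2 * (u + v) * u.
  move=> /andP[h1 h2].
  pose g z := P z y' - (p s t * z + A / 2 * (z - s) ^+ 2 + B * (y' - t) * z).
  have := @MVT_bound R g (fun z => p z y' - p s t - A * (z - s) - B * (y' - t))
    x (x + u) (e / 2 * (u + v)).
  have xu : x <= x + u by rewrite lerDl.
  move=> /(_ xu).
  have -> : x + u - x = u by ring.
  rewrite /g => H.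
  apply: le_trans (H _ _); first by rewrite le_eqVlt; apply/orP; left; apply/eqP; congr `| _ |; field.
  - move=> z /andP[z1 z2].
    have zP : is_derive z 1 (fun x => P x y') (p z y').
      by apply: dP; apply/andP; split; clear - ax xl by_ ym z1 z2 h1 h2; lra.
    by clear -zP; apply: is_derive_eq; rewrite /GRing.scale /=; field.
  - move=> z /andP[z1 z2].
    have zs := ler_dist_itv xs sx z1 z2; have yt' := ler_dist_itv yt ty h1 h2.
    have za : a <= z <= a + l by clear - ax xl z1 z2; apply/andP; split; lra.
    have yb : b <= y' <= b + m by clear - by_ ym h1 h2; apply/andP; split; lra.
    have [+ _] := dpq z y' za yb (le_lt_trans zs ud) (le_lt_trans yt' vd).
    move=> /le_trans; apply; apply: ler_wpM2l; first by rewrite divr_ge0// ltW.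
    exact: lerD.
have hQ x' : x <= x' <= x + u ->
    `|Q x' (y + v) - Q x' y - q s t * v - C * ((y + v - t) ^+ 2 - (y - t) ^+ 2) / 2
      - B * (x' - s) * v| <= e / 2 * (u + v) * v.
  move=> /andP[h1 h2].
  pose g z := Q x' z - (q s t * z + C / 2 * (z - t) ^+ 2 + B * (x' - s) * z).
  have := @MVT_bound R g (fun z => q x' z - q s t - B * (x' - s) - C * (z - t))
    y (y + v) (e / 2 * (u + v)).
  have yv : y <= y + v by rewrite lerDl.
  move=> /(_ yv).
  have -> : y + v - y = v by ring.
  rewrite /g => H.
  apply: le_trans (H _ _); first by rewrite le_eqVlt; apply/orP; left; apply/eqP; congr `| _ |; field.
  - move=> z /andP[z1 z2].
    have zP : is_derive z 1 (fun y => Q x' y) (q x' z).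
      by apply: dQ; apply/andP; split; clear - ax xl by_ ym z1 z2 h1 h2; lra.
    by clear -zP; apply: is_derive_eq; rewrite /GRing.scale /=; field.
  - move=> z /andP[z1 z2].
    have zt := ler_dist_itv yt ty z1 z2; have xs' := ler_dist_itv xs sx h1 h2.
    have zb : b <= z <= b + m by clear - by_ ym z1 z2; apply/andP; split; lra.
    have xa : a <= x' <= a + l by clear - ax xl h1 h2; apply/andP; split; lra.
    have [_ +] := dpq x' z xa zb (le_lt_trans xs' ud) (le_lt_trans zt vd).
    move=> /le_trans; apply; apply: ler_wpM2l; first by rewrite divr_ge0// ltW.
    exact: lerD.
have := hP (y + v); have := hP y; have := hQ (x + u); have := hQ x.
rewrite !lexx !lerDl u0 v0 /= => /(_ isT) + /(_ isT) + /(_ isT) + /(_ isT).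
set a1 := (X in `|X|); set a2 := (X in _ -> `|X| <= _ -> _).
set a3 := (X in _ -> _ -> `|X| <= _ -> _).
set a4 := (X in _ -> _ -> _ -> `|X| <= _ -> _) => q1 q2 p1 p2.
have -> : mixed_diff (fun s t => Q s t - P s t) x y u v = (a2 - a1) + (a3 - a4).
  by rewrite /mixed_diff /a1 /a2 /a3 /a4; field.
have n1 := ler_normD (a2 - a1) (a3 - a4).
have n2 := ler_normB a2 a1; have n3 := ler_normB a3 a4.
rewrite expr2; clear - n1 n2 n3 q1 q2 p1 p2; lra.
Qed.

(** Continuity is assumed under the existential so that [choice] yields one antiderivative operator
    on all functions; equal integrands then receive equal antiderivatives. *)
Lemma exists_antiderivative (f : R -> R) a b : a < b -> exists F : R -> R,
  continuous f -> forall x, a < x < b -> is_derive x 1 F (f x).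
Proof.
move=> ab.
exists (fun x => \int[@lebesgue_measure R]_(t in [set` `[a, x]]) f t).
move=> cf x /andP[ax xb].
have fi : lebesgue_measure.-integrable `[a, b] (EFin \o f).
  apply: continuous_compact_integrable; first exact: segment_compact.
  by apply: continuous_subspaceT => ?; exact: cf.
have [h1 h2] := continuous_FTC1_closed xb fi ax (cf x).
by apply: DeriveDef; [exact: h1|rewrite -derive1E; exact: h2].
Qed.

Lemma dist_min_le (S x y : R) : `|Num.min S x - Num.min S y| <= `|x - y|.
Proof.
rewrite ler_norml; have := ler_norm (x - y); have := lerNnormlW (lexx `|x - y|).
by case: (leP S x); case: (leP S y) => *; apply/andP; split; lra.
Qed.

End goursat.
(** * Complex derivatives *)

Section complex_norm.
Variable R : realType.
Local Notation C := R[i].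
Implicit Types z w : C.

Lemma normc_ge0 z : 0 <= normc z.
Proof. by case: z => a b; exact: sqrtr_ge0. Qed.

Lemma normcM z w : normc (z * w) = normc z * normc w.
Proof. exact: ComplexField.Normc.normcM. Qed.

Lemma normcV z : normc z^-1 = (normc z)^-1.
Proof. exact: ComplexField.Normc.normcV. Qed.

Lemma normcD z w : normc (z + w) <= normc z + normc w.
Proof. exact: le_normcD. Qed.

Lemma normcB z w : normc (z - w) <= normc z + normc w.
Proof. by rewrite -(normcN w); exact: normcD. Qed.

Lemma normc0 : normc (0 : C) = 0.
Proof. exact: ComplexField.Normc.normc0. Qed.

Lemma normc1 : normc (1 : C) = 1.
Proof. exact: ComplexField.Normc.normc1. Qed.

Lemma normcX z n : normc (z ^+ n) = normc z ^+ n.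
Proof. by elim: n => [|n IH]; rewrite ?expr0 ?normc1// !exprS normcM IH. Qed.

Lemma normc_eq0 z : (normc z == 0) = (z == 0).
Proof.
apply/eqP/eqP => [|->]; last exact: normc0.
exact: ComplexField.Normc.eq0_normc.
Qed.

Lemma normc_gt0 z : (0 < normc z) = (z != 0).
Proof. by rewrite lt_neqAle normc_ge0 andbT eq_sym normc_eq0. Qed.

Lemma normc_real (x : R) : normc x%:C = `|x|.
Proof. by rewrite /= expr0n/= addr0 sqrtr_sqr. Qed.

Lemma normc_Re z : `|complex.Re z| <= normc z.
Proof.
case: z => a b /=; rewrite -sqrtr_sqr ler_wsqrtr// lerDl; exact: sqr_ge0.
Qed.

Lemma normc_Im z : `|complex.Im z| <= normc z.
Proof.
case: z => a b /=; rewrite -sqrtr_sqr ler_wsqrtr// lerDr; exact: sqr_ge0.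
Qed.

Lemma normc_leD z : normc z <= `|complex.Re z| + `|complex.Im z|.
Proof.
case: z => a b /=; rewrite -[leRHS]ger0_norm ?addr_ge0// -sqrtr_sqr.
rewrite ler_wsqrtr// sqrrD !real_normK ?num_real//.
by rewrite lerD2r lerDl mulrn_wge0// mulr_ge0.
Qed.

Lemma Re_add z w : complex.Re (z + w) = complex.Re z + complex.Re w.
Proof. by case: z w => [? ?] [? ?]. Qed.

Lemma Re_sub z w : complex.Re (z - w) = complex.Re z - complex.Re w.
Proof. by case: z w => [? ?] [? ?]. Qed.

Lemma Im_add z w : complex.Im (z + w) = complex.Im z + complex.Im w.
Proof. by case: z w => [? ?] [? ?]. Qed.

Lemma Im_sub z w : complex.Im (z - w) = complex.Im z - complex.Im w.
Proof. by case: z w => [? ?] [? ?]. Qed.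

Lemma Re_mul_real z (x : R) : complex.Re (z * x%:C) = complex.Re z * x.
Proof. by case: z => a b /=; rewrite mulr0 subr0. Qed.

Lemma Im_mul_real z (x : R) : complex.Im (z * x%:C) = complex.Im z * x.
Proof. by case: z => a b /=; rewrite mulr0 add0r. Qed.

Lemma mulc_conj z : z^* * z = (normc z ^+ 2)%:C.
Proof.
case: z => a b; apply/eqP; rewrite eq_complex /= sqr_sqrtr ?addr_ge0 ?sqr_ge0//.
by apply/andP; split; apply/eqP; rewrite /=; ring.
Qed.

Lemma normcJ z : normc z^* = normc z.
Proof. by case: z => a b /=; rewrite sqrrN. Qed.

End complex_norm.

Section cderiv.
Variable R : realType.
Local Notation C := R[i].
Implicit Types (f g : C -> C) (z w h L : C).

(** The error bound is written without division and in real moduli: [h = 0] needs no exception, and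
    estimates stay in the ordered field [R]. *)
Definition cderiv g z L := forall e : R, 0 < e -> exists2 d : R, 0 < d &
  forall h, normc h < d -> normc (g (z + h) - g z - L * h) <= e * normc h.

Lemma cderiv_unique g z L L' : cderiv g z L -> cderiv g z L' -> L = L'.
Proof.
move=> gL gL'; apply/eqP; rewrite -subr_eq0 -normc_eq0 eq_le normc_ge0 andbT.
apply/ler_addgt0Pr => e e0; rewrite add0r.
have e2 : 0 < e / 2 by rewrite divr_gt0.
have [d' d'0 h2] := gL' _ e2.
have [d1 d10 h1'] := gL _ e2.
pose s := Num.min d1 d' / 2.
have s0 : 0 < s by rewrite divr_gt0// lt_min d10.
have ns : normc s%:C = s by rewrite normc_real gtr0_norm.
have : s < Num.min d1 d' by rewrite ltr_pdivrMr// ltr_pMr ?ltrDl// lt_min d10.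
rewrite lt_min => /andP[sd1 sd'].
have := h1' s%:C; have := h2 s%:C; rewrite ns => /(_ sd') k2 /(_ sd1) k1.
rewrite -(ler_pM2r s0) -[X in _ * X]ns -normcM.
have -> : (L - L') * s%:C = (g (z + s%:C) - g z - L' * s%:C) -
  (g (z + s%:C) - g z - L * s%:C) by ring.
by rewrite (le_trans (normcB _ _))//; lra.
Qed.

Lemma cderiv_near f g z L (d : R) : 0 < d ->
  (forall h, normc h < d -> f (z + h) = g (z + h)) ->
  cderiv f z L -> cderiv g z L.
Proof.
move=> d0 fg fL e e0; have [d' d'0 fd'] := fL e e0.
exists (Num.min d d') => [|h]; first by rewrite lt_min d0.
rewrite lt_min => /andP[hd hd']; have := fd' h hd'.
by rewrite fg// -[in f z](addr0 z) fg ?normc0// addr0.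
Qed.

Lemma cderiv_cont g z L : cderiv g z L ->
  forall e : R, 0 < e -> exists2 d : R, 0 < d &
  forall h, normc h < d -> normc (g (z + h) - g z) < e.
Proof.
move=> gL e e0; have [d d0 dP] := gL 1 ltr01.
have c0 : 0 < 1 + normc L by rewrite ltr_pwDl// normc_ge0.
exists (Num.min d (e / (1 + normc L))) => [|h].
  by rewrite lt_min d0 divr_gt0.
rewrite lt_min => /andP[/dP hd he].
have -> : g (z + h) - g z = (g (z + h) - g z - L * h) + L * h by ring.
apply: le_lt_trans (normcD _ _) _; rewrite normcM.
move: he; rewrite ltr_pdivlMr// => he; rewrite mul1r in hd.
by apply: le_lt_trans he; rewrite mulrDr mulr1 mulrC [normc L * _]mulrC lerD// mulrC.
Qed.

Lemma cderiv_cst (c : C) z : cderiv (fun=> c) z 0.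
Proof.
move=> e e0; exists 1 => // h _; rewrite subrr mul0r subr0 normc0.
by rewrite mulr_ge0 ?normc_ge0 ?ltW.
Qed.

Lemma cderiv_id z : cderiv id z 1.
Proof.
move=> e e0; exists 1 => // h _.
have -> : id (z + h) - id z - 1 * h = 0 by rewrite /id; ring.
rewrite normc0.
by rewrite mulr_ge0 ?normc_ge0 ?ltW.
Qed.

Lemma cderivD f g z L L' : cderiv f z L -> cderiv g z L' ->
  cderiv (fun w => f w + g w) z (L + L').
Proof.
move=> fL gL e e0; have e2 : 0 < e / 2 by rewrite divr_gt0.
have [d d0 dP] := fL _ e2; have [d' d'0 d'P] := gL _ e2.
exists (Num.min d d') => [|h]; first by rewrite lt_min d0.
rewrite lt_min => /andP[/dP hd /d'P hd'].
have -> : f (z + h) + g (z + h) - (f z + g z) - (L + L') * h =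
  (f (z + h) - f z - L * h) + (g (z + h) - g z - L' * h) by ring.
by rewrite (le_trans (normcD _ _))//; lra.
Qed.

Lemma cderivM f g z L L' : cderiv f z L -> cderiv g z L' ->
  cderiv (fun w => f w * g w) z (L * g z + f z * L').
Proof.
move=> fL gL e e0.
(* [B] dominates [normc (f z)], [normc (g z)] and [1 + normc L], so that each of the three error
   terms below costs at most a third of [e * normc h]. *)
pose B := normc (f z) + normc (g z) + normc L + 1.
have nf := normc_ge0 (f z); have ng := normc_ge0 (g z); have nL := normc_ge0 L.
have B0 : 0 < B by rewrite /B; lra.
have e3 : 0 < e / (3 * B) by rewrite divr_gt0// mulr_gt0.
have e3' : 0 < Num.min (e / (3 * B)) 1 by rewrite lt_min e3 ltr01.
have [d d0 dP] := fL _ e3'; have [d' d'0 d'P] := gL _ e3.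
have [d2 d20 d2P] := cderiv_cont gL e3.
exists (Num.min d (Num.min d' d2)) => [|h]; first by rewrite !lt_min d0 d'0.
rewrite !lt_min => /and3P[/dP hd /d'P hd' /d2P hd2].
have -> : f (z + h) * g (z + h) - f z * g z - (L * g z + f z * L') * h =
  (f (z + h) - f z - L * h) * g z + f z * (g (z + h) - g z - L' * h)
  + (f (z + h) - f z - L * h + L * h) * (g (z + h) - g z) by ring.
have nh := normc_ge0 h.
have k1 : normc (f (z + h) - f z - L * h) <= e / (3 * B) * normc h.
  by rewrite (le_trans hd)// ler_wpM2r// ge_min lexx.
have k2 : normc (f (z + h) - f z - L * h) <= normc h.
  by rewrite (le_trans hd)// ler_piMl// ge_min lexx orbT.
have eB : e / (3 * B) * B = e / 3 by field; rewrite gt_eqF.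
have bnd (x y : R) : 0 <= x -> 0 <= y -> x <= e / (3 * B) * normc h -> y <= B ->
    x * y <= e / 3 * normc h.
  move=> x0 y0 xe yB; rewrite (le_trans (ler_pM x0 y0 xe yB))//.
  by rewrite mulrAC eB.
have t1 : normc ((f (z + h) - f z - L * h) * g z) <= e / 3 * normc h.
  by rewrite normcM bnd ?normc_ge0// /B; lra.
have t2 : normc (f z * (g (z + h) - g z - L' * h)) <= e / 3 * normc h.
  by rewrite normcM mulrC bnd ?normc_ge0// /B; lra.
have t3 : normc ((f (z + h) - f z - L * h + L * h) * (g (z + h) - g z)) <= e / 3 * normc h.
  rewrite normcM.
  have -> : e / 3 * normc h = (normc h * B) * (e / (3 * B)).
    by rewrite -eB; ring.
  apply: ler_pM; rewrite ?normc_ge0//; last exact: ltW.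
  rewrite (le_trans (normcD _ _))// normcM /B !mulrDr mulr1 [normc h * normc L]mulrC.
  rewrite (le_trans (lerD k2 (lexx _)))// addrC lerD2r lerDr -mulrDr.
  by rewrite mulr_ge0// addr_ge0.
have := normcD ((f (z + h) - f z - L * h) * g z + f z * (g (z + h) - g z - L' * h))
  ((f (z + h) - f z - L * h + L * h) * (g (z + h) - g z)).
have := normcD ((f (z + h) - f z - L * h) * g z) (f z * (g (z + h) - g z - L' * h)).
clear - t1 t2 t3; lra.
Qed.

Lemma cderivMl (c : C) f z L : cderiv f z L -> cderiv (fun w => c * f w) z (c * L).
Proof. by move=> fL; have := cderivM (cderiv_cst c z) fL; rewrite mul0r add0r. Qed.

Lemma cderivB f g z L L' : cderiv f z L -> cderiv g z L' ->
  cderiv (fun w => f w - g w) z (L - L').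
Proof.
move=> fL gL; have := cderivD fL (cderivMl (-1) gL); rewrite mulN1r.
by apply: cderiv_near ltr01 _ => h _; rewrite mulN1r.
Qed.

Lemma cderiv_comp_affine f a b z L : cderiv f (a + z * b) L ->
  cderiv (fun w => f (a + w * b)) z (L * b).
Proof.
move=> fL e e0; have c0 : 0 < 1 + normc b by rewrite ltr_pwDl// normc_ge0.
have [d d0 dP] := fL _ (divr_gt0 e0 c0).
exists (d / (1 + normc b)) => [|h]; first exact: divr_gt0.
rewrite ltr_pdivlMr// => hd.
have hb : normc (h * b) <= normc h * (1 + normc b).
  by rewrite normcM ler_wpM2l ?normc_ge0// lerDr.
have := dP (h * b) (le_lt_trans hb hd).
have -> : a + (z + h) * b = a + z * b + h * b by ring.
rewrite -mulrA [b * h]mulrC => /le_trans; apply.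
rewrite mulrAC ler_pdivrMr// -mulrA ler_wpM2l// ?ltW//.
Qed.

Lemma cderivV z : z != 0 -> cderiv (fun w => w^-1) z (- z^-1 ^+ 2).
Proof.
move=> z0 e e0; have nz : 0 < normc z by rewrite normc_gt0.
exists (Num.min (normc z / 2) (e * normc z ^+ 3 / 2)) => [|h].
  by rewrite lt_min !divr_gt0// mulr_gt0// exprn_gt0.
rewrite lt_min => /andP[h1 h2].
have zh : normc z / 2 <= normc (z + h).
  have := normcB (z + h) h; rewrite addrK; lra.
have zhn0 : z + h != 0 by rewrite -normc_gt0 (lt_le_trans _ zh)// divr_gt0.
have -> : (z + h)^-1 - z^-1 - - z^-1 ^+ 2 * h = h ^+ 2 / (z ^+ 2 * (z + h)).
  by field; apply/andP; split.
rewrite normcM normcV normcM !normcX.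
have zz : 0 < normc z ^+ 2 by rewrite exprn_gt0.
rewrite ler_pdivrMr ?mulr_gt0 ?normc_gt0// expr2.
have -> : e * normc h * (normc z ^+ 2 * normc (z + h)) =
  normc h * (e * normc z ^+ 2 * normc (z + h)) by ring.
rewrite ler_wpM2l ?normc_ge0// (le_trans (ltW h2))//.
have -> : e * normc z ^+ 3 / 2 = e * normc z ^+ 2 * (normc z / 2) by ring.
by rewrite ler_wpM2l// mulr_ge0// ltW.
Qed.

Lemma cderivX n z : exists L, cderiv (fun w => w ^+ n) z L.
Proof.
elim: n => [|n [L IH]]; first by exists 0; exact: cderiv_cst.
exists (1 * z ^+ n + z * L); have := cderivM (cderiv_id z) IH.
by apply: cderiv_near ltr01 _ => h _; rewrite exprS.
Qed.

End cderiv.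
Section real_derivative.
Variable R : realType.

Lemma is_derive_eps (V : normedModType R) (f : V -> R) p v (l : R) :
  (forall e : R, 0 < e -> exists2 d : R, 0 < d &
    forall h : R, `|h| < d -> `|f (p + h *: v) - f p - h * l| <= e * `|h|) ->
  is_derive p v f l.
Proof.
move=> fl.
suff cl : h^-1 *: (f (h *: v + p) - f p) @[h --> (0 : R)^'] --> l.
  by apply: DeriveDef; [apply/cvg_ex; exists l|exact: cvg_lim].
apply/cvgrPdist_le => e e0; have [d d0 dP] := fl e e0.
near=> h.
have h0 : h != 0 by near: h; exact: nbhs_dnbhs_neq.
have hd : `|h| < d by near: h; exact: dnbhs0_lt.
rewrite distrC -(ler_pM2r (_ : 0 < `|h|)) ?normr_gt0// -normrM.
move: (dP h hd); rewrite [p + _]addrC; congr (`| _ | <= _).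
by rewrite /GRing.scale /=; field.
Unshelve. all: by end_near. Qed.

Lemma is_derive1_eps (f : R -> R) (x l : R) : is_derive x 1 f l ->
  forall e : R, 0 < e -> exists2 d : R, 0 < d &
    forall h : R, `|h| < d -> `|f (x + h) - f x - l * h| <= e * `|h|.
Proof.
move=> [df fl] e e0.
have : h^-1 *: (f (h *: 1 + x) - f x) @[h --> (0 : R)^'] --> l.
  by rewrite -fl; exact: df.
move=> /cvgrPdist_le/(_ e e0); rewrite near_withinE => /nbhs_ballP[d /= d0 dP].
exists d => // h hd; have [->|h0] := eqVneq h 0.
  by rewrite addr0 mulr0 !subrr normr0 mulr0.
have := dP h; rewrite /ball /= sub0r normrN => /(_ hd h0).
rewrite distrC -(ler_pM2r (_ : 0 < `|h|)) ?normr_gt0// -normrM.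
congr (`| _ | <= _); rewrite /GRing.scale /= mulr1 [h + x]addrC.
by field.
Qed.

End real_derivative.

(** * The complex exponential in logarithmic polar coordinates *)

Section complex_exponential.
Variable R : realType.
Local Notation C := R[i].

Definition cexp (s t : R) : C := (expR s * cos t) +i* (expR s * sin t).

Lemma cexpD s t u v : cexp (s + u) (t + v) = cexp s t * cexp u v.
Proof.
rewrite /cexp expRD cosD sinD; apply/eqP; rewrite eq_complex /=.
by apply/andP; split; apply/eqP; ring.
Qed.

Lemma normc_cexp s t : normc (cexp s t) = expR s.
Proof.
by rewrite /= !exprMn -mulrDr cos2Dsin2 mulr1 sqrtr_sqr ger0_norm// expR_ge0.
Qed.

Lemma cexp_neq0 s t : cexp s t != 0.
Proof. by rewrite -normc_gt0 normc_cexp expR_gt0. Qed.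

Lemma cexp_2pi s : cexp s (2 * pi) = cexp s 0.
Proof. by rewrite /cexp mulr_natl cos2pi sin2pi cos0 sin0. Qed.

Lemma cexp_deriv s t (e : R) : 0 < e -> exists2 d : R, 0 < d &
  forall u v, `|u| < d -> `|v| < d ->
  normc (cexp (s + u) (t + v) - cexp s t - cexp s t * (u +i* v))
    <= e * (`|u| + `|v|).
Proof.
move=> e0.
(* [e1] controls the errors of [expR], [sin] and [cos] at [0]. The terms [b1] to [b5] add up to at
   most [5 * e1 * (|u| + |v|)], and [expR s] is the modulus of the common factor [cexp s t]. *)
pose e1 := Num.min (e / (5 * expR s)) 1.
have e10 : 0 < e1 by rewrite lt_min ltr01 andbT divr_gt0// mulr_gt0// expR_gt0.
have e1e : 5 * e1 * expR s <= e.
  have : e1 <= e / (5 * expR s) by rewrite ge_min lexx.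
  rewrite ler_pdivlMr ?mulr_gt0 ?expR_gt0//; lra.
have e11 : e1 <= 1 by rewrite ge_min lexx orbT.
clearbody e1.
have [d1 d10 h1] := is_derive1_eps (is_derive_expR (0 : R)) e10.
have [d2 d20 h2] := is_derive1_eps (is_derive_sin (0 : R)) e10.
have [d3 d30 h3] := is_derive1_eps (is_derive_cos (0 : R)) e10.
exists (Num.min (Num.min d1 e1) (Num.min d2 d3)) => [|u v].
  by rewrite !lt_min d10 d20 d30 e10.
rewrite !lt_min => /andP[/andP[u1 u2] /andP[u3 u4]] /andP[/andP[v1 v2] /andP[v3 v4]].
have := h1 u u1; have := h2 v v3; have := h3 v v4.
rewrite !add0r expR0 sin0 cos0 oppr0 mul0r !subr0 !addr0 !mul1r => c s' x.
rewrite cexpD.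
have -> : cexp s t * cexp u v - cexp s t - cexp s t * (u +i* v) =
  cexp s t * (cexp u v - 1 - (u +i* v)) by ring.
rewrite normcM normc_cexp.
suff H : normc (cexp u v - 1 - (u +i* v)) <= 5 * e1 * (`|u| + `|v|).
  rewrite (le_trans (ler_wpM2l (expR_ge0 s) H))// mulrA ler_wpM2r ?addr_ge0//.
  by rewrite mulrC.
apply: le_trans (normc_leD _) _; rewrite /= subr0.
have u_1 : `|u| <= 1 by rewrite (le_trans (ltW u2)).
have cv : `|cos v| <= 1 by rewrite ler_norml cos_geN1 cos_le1.
have sv : `|sin v| <= 1 by rewrite ler_norml sin_geN1 sin_le1.
have u1' : `|1 + u| <= 2 by rewrite (le_trans (ler_normD _ _))// normr1; lra.
have E1 : expR u * cos v - 1 - u = (expR u - 1 - u) * cos v + (1 + u) * (cos v - 1).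
  by ring.
have E2 : expR u * sin v - v =
    (expR u - 1 - u) * sin v + (1 + u) * (sin v - v) + u * v by ring.
rewrite E1 E2.
have b1 : `|(expR u - 1 - u) * cos v| <= e1 * `|u|.
  by rewrite normrM -[leRHS]mulr1 ler_pM.
have b2 : `|(1 + u) * (cos v - 1)| <= 2 * (e1 * `|v|) by rewrite normrM ler_pM.
have b3 : `|(expR u - 1 - u) * sin v| <= e1 * `|u|.
  by rewrite normrM -[leRHS]mulr1 ler_pM.
have b4 : `|(1 + u) * (sin v - v)| <= 2 * (e1 * `|v|) by rewrite normrM ler_pM.
have b5 : `|u * v| <= e1 * `|v| by rewrite normrM ler_wpM2r// ltW.
have t1 := ler_normD ((expR u - 1 - u) * cos v) ((1 + u) * (cos v - 1)).
have t2 := ler_normD ((expR u - 1 - u) * sin v + (1 + u) * (sin v - v)) (u * v).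
have t3 := ler_normD ((expR u - 1 - u) * sin v) ((1 + u) * (sin v - v)).
have eu : 0 <= e1 * `|u| by rewrite mulr_ge0 // ltW.
clear - b1 b2 b3 b4 b5 t1 t2 t3 eu; lra.
Qed.

(** Chain rule in the variable [s + i t]. That a single complex number [D] multiplies [u + i v]
    encodes the Cauchy-Riemann equations, from which closedness of [Q dw / w] is read off. *)
Lemma cderiv_cexp (Q : C -> C) L s t : cderiv Q (cexp s t) L ->
  exists D : C, forall e : R, 0 < e -> exists2 d : R, 0 < d &
  forall u v, `|u| < d -> `|v| < d ->
  normc (Q (cexp (s + u) (t + v)) - Q (cexp s t) - D * (u +i* v))
    <= e * (`|u| + `|v|).
Proof.
move=> QL; exists (L * cexp s t) => e e0.
pose B := expR s + 1.
have B0 : 0 < B by rewrite ltr_pwDr// expR_ge0.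
have nL : 0 < normc L + 1 by rewrite ltr_pwDr// normc_ge0.
have [d d0 dP] := QL (e / 2 / B) (divr_gt0 (divr_gt0 e0 (ltr0Sn _ _)) B0).
have [d1 d10 d1P] := cexp_deriv s t (divr_gt0 (divr_gt0 e0 (ltr0Sn _ 1)) nL).
have [d2 d20 d2P] := cexp_deriv s t ltr01.
exists (Num.min (Num.min d1 d2) (d / (2 * B))) => [|u v].
  by rewrite !lt_min d10 d20 divr_gt0// mulr_gt0.
rewrite !lt_min => /andP[/andP[u1 u2] u3] /andP[/andP[v1 v2] v3].
set h := cexp (s + u) (t + v) - cexp s t.
have uv0 : 0 <= `|u| + `|v| by rewrite addr_ge0.
have nuv : normc (u +i* v) <= `|u| + `|v| by exact: normc_leD.
have hB : normc h <= B * (`|u| + `|v|).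
  have -> : h = (h - cexp s t * (u +i* v)) + cexp s t * (u +i* v) by ring.
  rewrite (le_trans (normcD _ _))// /B mulrDl addrC lerD//; last exact: d2P.
  by rewrite normcM normc_cexp ler_wpM2l// expR_ge0.
have hd : normc h < d.
  rewrite (le_lt_trans hB)// mulrC -ltr_pdivlMr//.
  have -> : d / B = d / (2 * B) + d / (2 * B) by field; rewrite gt_eqF.
  exact: ltrD.
have -> : cexp (s + u) (t + v) = cexp s t + h by rewrite /h; ring.
have -> : Q (cexp s t + h) - Q (cexp s t) - L * cexp s t * (u +i* v) =
  (Q (cexp s t + h) - Q (cexp s t) - L * h) +
  L * (h - cexp s t * (u +i* v)) by ring.
rewrite (le_trans (normcD _ _))// [e]splitr mulrDl lerD//.
  rewrite (le_trans (dP _ hd))//.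
  have -> : e / 2 * (`|u| + `|v|) = e / 2 / B * (B * (`|u| + `|v|)).
    by field; rewrite gt_eqF.
  by rewrite ler_wpM2l// !divr_ge0// ltW.
rewrite normcM (le_trans (ler_wpM2l (normc_ge0 L) (d1P u v u1 v1)))//.
rewrite mulrA ler_wpM2r// mulrCA ler_piMr ?divr_ge0 ?ltW// ltr_pdivrMr//.
by rewrite mul1r ltrDl.
Qed.

End complex_exponential.
(** * Cauchy's estimate *)

Section cauchy_estimate.
Variable R : realType.
Local Notation C := R[i].
Implicit Types (f g : C -> C) (z w h L a : C) (r M : R).

Definition holo_disc g a r := forall z, normc (z - a) < r -> exists L, cderiv g z L.

(* In logarithmic coordinates [w = exp (s + i t)] the closed form [Q dw / w] is
   2pi-periodic in [t], so its vertical periods do not depend on [s]; the mean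
   value theorem on both vertical sides replaces the integrals by values. *)
Lemma Re_mean_value (Q : C -> C) (S s1 : R) : s1 < S ->
  (forall w, w != 0 -> normc w <= expR S -> exists L, cderiv Q w L) ->
  exists t t' : R, complex.Re (Q (cexp S t)) = complex.Re (Q (cexp s1 t')).
Proof.
move=> s1S holoQ.
(* Truncation at [S] gives a function continuous in each variable on the whole line, as the
   antiderivatives require, although [Q] is controlled only for [normc w <= expR S]. *)
pose h s t := Q (cexp (Num.min S s) t).
have hD s t : exists D : C, forall e : R, 0 < e -> exists2 d : R, 0 < d &
    forall u v, s + u <= S -> s <= S -> `|u| < d -> `|v| < d ->
    normc (h (s + u) (t + v) - h s t - D * (u +i* v)) <= e * (`|u| + `|v|).
  have [sS|sS] := leP s S; last by exists 0 => e e0; exists 1 => // u v _; lra.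
  have [|L QL] := holoQ (cexp s t) (cexp_neq0 s t).
    by rewrite normc_cexp ler_expR.
  have [D DP] := cderiv_cexp QL; exists D => e e0.
  have [d d0 dP] := DP e e0; exists d => // u v suS _ ud vd.
  by rewrite /h !min_r//; exact: dP.
have hcont s t (e : R) : 0 < e -> exists2 d : R, 0 < d &
    forall u v, `|u| < d -> `|v| < d -> normc (h (s + u) (t + v) - h s t) < e.
  move=> e0; set s' := Num.min S s.
  have s'S : s' <= S by rewrite ge_min lexx.
  have [D DP] := hD s' t; have [d d0 dP] := DP 1 ltr01.
  have nD : 0 < normc D + 1 by rewrite ltr_pwDr// normc_ge0.
  exists (Num.min d (e / 2 / (normc D + 1))) => [|u v].
    by rewrite lt_min d0 !divr_gt0.
  rewrite !lt_min => /andP[u1 u2] /andP[v1 v2].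
  set u' := Num.min S (s + u) - s'.
  have uu : `|u'| <= `|u|.
    by have := dist_min_le S (s + u) s; rewrite addrAC subrr add0r.
  have su : s' + u' = Num.min S (s + u) by rewrite /u'; ring.
  have -> : h (s + u) (t + v) = h (s' + u') (t + v).
    by rewrite su /h minA minxx.
  have -> : h s t = h s' t by rewrite /h /s' minA minxx.
  have := dP u' v; rewrite su ge_min lexx => /(_ isT s'S).
  rewrite -su => /(_ (le_lt_trans uu u1) v1); rewrite mul1r => H.
  have -> : h (s' + u') (t + v) - h s' t =
    (h (s' + u') (t + v) - h s' t - D * (u' +i* v)) + D * (u' +i* v) by ring.
  rewrite (le_lt_trans (normcD _ _))// normcM.
  have nuv : normc (u' +i* v) <= `|u'| + `|v| by exact: normc_leD.
  have := ler_wpM2l (normc_ge0 D) nuv => H'.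
  rewrite ltr_pdivlMr// in u2; rewrite ltr_pdivlMr// in v2.
  have k : `|u'| * (normc D + 1) < e / 2.
    by rewrite (le_lt_trans _ u2)// ler_wpM2r// ltW.
  clear - H H' k v2; lra.
pose p s t := complex.Im (h s t); pose q s t := complex.Re (h s t).
have cont_of (k : R -> R) : (forall x (e : R), 0 < e -> exists2 d : R, 0 < d &
    forall u, `|u| < d -> `|k (x + u) - k x| < e) -> continuous k.
  move=> kP x; apply/cvgrPdist_lt => e e0; have [d d0 dP] := kP x e e0.
  apply/nbhs_ballP; exists d => //= y; rewrite /ball /= distrC => xyd.
  by rewrite distrC; have := dP _ xyd; rewrite [x + _]addrC subrK.
have pc t : continuous (p ^~ t).
  apply: cont_of => x e e0; have [d d0 dP] := hcont x t e e0.
  exists d => // u ud; have := dP u 0 ud; rewrite normr0 addr0 => /(_ d0).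
  by apply: le_lt_trans; rewrite /p -Im_sub normc_Im.
have qc s : continuous (q s).
  apply: cont_of => x e e0; have [d d0 dP] := hcont s x e e0.
  exists d => // u ud; have := dP 0 u; rewrite normr0 addr0 => /(_ d0 ud).
  by apply: le_lt_trans; rewrite /q -Re_sub normc_Re.
have pi0 := pi_gt0 R.
(* Antiderivatives are available on open intervals, so the ranges of [s] and [t] are enlarged by [1]
   at both ends. *)
have sS1 : s1 - 1 < S + 1 by lra.
have p01 : -1 < 2 * pi + 1 :> R by lra.
have [PA PAP] := choice (fun k : R -> R => exists_antiderivative k sS1).
have [QA QAP] := choice (fun k : R -> R => exists_antiderivative k p01).
pose P s t := PA (p ^~ t) s; pose Qv s t := QA (q s) t.
have dP s t : s1 <= s <= s1 + (S - s1) -> 0 <= t <= 0 + 2 * pi ->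
    is_derive s 1 (P ^~ t) (p s t).
  by move=> /andP[? ?] _; apply: PAP (pc t) _ _; apply/andP; split; lra.
have dQ s t : s1 <= s <= s1 + (S - s1) -> 0 <= t <= 0 + 2 * pi ->
    is_derive t 1 (Qv s) (q s t).
  by move=> _ /andP[? ?]; apply: QAP (qc s) _ _; apply/andP; split; lra.
have := goursat_closed_form _ _ dP dQ.
rewrite subr_ge0 (ltW s1S) => /(_ isT).
have -> : 0 <= 2 * pi :> R by lra.
move=> /(_ isT) closed.
have {closed} : mixed_diff (fun s t => Qv s t - P s t) s1 0 (S - s1) (2 * pi) = 0.
  apply: closed => s t /andP[ss1 sS] _.
  have [D DP] := hD s t.
  (* These are the coefficients of the imaginary and real parts of [D * (u + i v)]; the shared
     middle one [complex.Re D] expresses that [p ds + q dt] is closed. *)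
  exists (complex.Im D), (complex.Re D), (- complex.Im D) => e e0.
  have [d d0 dP'] := DP e e0; exists d => // x y /andP[xs1 xS] _ xd yd.
  have := dP' (x - s) (y - t).
  have -> : s + (x - s) = x by ring.
  have -> : t + (y - t) = y by ring.
  have xS' : x <= S by clear - xS; lra.
  have sS' : s <= S by clear - sS; lra.
  move=> /(_ xS' sS' xd yd) H.
  split.
    apply: le_trans H; rewrite -[leLHS]/(`|_|).
    apply: le_trans (normc_Im _); rewrite /p !Im_sub; case: (D) => a b /=.
    by rewrite le_eqVlt; apply/orP; left; apply/eqP; congr `| _ |; ring.
  apply: le_trans H.
  apply: le_trans (normc_Re _); rewrite /q !Re_sub; case: (D) => a b /=.
  by rewrite le_eqVlt; apply/orP; left; apply/eqP; congr `| _ |; ring.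
have hper s : h s (2 * pi) = h s 0 by rewrite /h cexp_2pi.
(* The integrands on the two horizontal sides are the same function, so [PA] returns the same
   antiderivative and these sides cancel. *)
have pper : p ^~ (2 * pi) = p ^~ 0 by apply/funext => s; rewrite /p hper.
have sS : s1 + (S - s1) = S by ring.
rewrite /mixed_diff sS add0r /P pper => eqQ.
have mv s : s1 <= s <= S -> exists t, Qv s (2 * pi) - Qv s 0 = q s t * (2 * pi).
  move=> /andP[h1 h2].
  have [|||t _ ->] := @MVT_segment R (Qv s) (q s) 0 (2 * pi).
  - lra.
  - move=> x; rewrite in_itv /= => /andP[? ?]; apply: dQ; apply/andP; split; lra.
  - apply: derivable_within_continuous => x; rewrite in_itv /= => /andP[? ?].
    have [] // : is_derive x 1 (Qv s) (q s x).
    by apply: dQ; apply/andP; split; lra.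
  by exists t; rewrite subr0.
have [|t e1] := mv S; first by rewrite lexx (ltW s1S).
have [|t' e2] := mv s1; first by rewrite lexx (ltW s1S).
exists t, t'.
have : q S t * (2 * pi) = q s1 t' * (2 * pi) by rewrite -e1 -e2; lra.
have p2 : 2 * pi != 0 :> R by rewrite gt_eqF//; lra.
by move=> /(mulIf p2); rewrite /q /h minxx min_r// ltW.
Qed.

(** [Re_mean_value] compares the difference quotient [Q] on two circles about [0]. On the one of
    radius [r / 2] it is at most [2 * M / (r / 2)], whence [4 * M / r]; on a small one it is within
    [e] of [L]. *)
Lemma Re_cauchy_estimate g a L r M : 0 < r -> holo_disc g a r ->
  (forall z, normc (z - a) < r -> normc (g z) <= M) -> cderiv g a L ->
  complex.Re L <= 4 * M / r.
Proof.
move=> r0 hg gM gL.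
(* The product [w * 1] has the form required by [cderiv_comp_affine]. *)
pose Q w := (g (a + w * 1) - g a) * w^-1.
pose S := ln (r / 2).
have eS : expR S = r / 2 by rewrite lnK// posrE divr_gt0.
have holoQ w : w != 0 -> normc w <= expR S -> exists L', cderiv Q w L'.
  rewrite eS => w0 wr; have wr' : normc (a + w * 1 - a) < r.
    have -> : a + w * 1 - a = w by ring.
    by clear - wr r0; lra.
  have [L' gL'] := hg _ wr'.
  have := cderivM (cderivB (cderiv_comp_affine gL') (cderiv_cst (g a) w)) (cderivV w0).
  by move=> ?; eexists; eassumption.
apply/ler_addgt0Pr => e e0.
have [d d0 dP] := gL e e0.
pose s1 := Num.min (S - 1) (ln d - 1).
have s1S : s1 < S by rewrite gt_min gtrBl ltr01.
have s1d : expR s1 < d.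
  by rewrite -[ltRHS](lnK d0) ltr_expR gt_min gtrBl ltr01 orbT.
have [t [t' Qtt]] := Re_mean_value s1S holoQ.
have w0 := cexp_neq0 s1 t'.
have nw : normc (cexp s1 t') < d by rewrite normc_cexp.
have E : Q (cexp s1 t') - L =
    (g (a + cexp s1 t') - g a - L * cexp s1 t') * (cexp s1 t')^-1.
  by rewrite /Q mulr1; field.
have h1 : normc (Q (cexp s1 t') - L) <= e.
  rewrite E normcM normcV ler_pdivrMr ?normc_gt0//; exact: dP.
have h2 : normc (Q (cexp S t)) <= 4 * M / r.
  have -> : 4 * M / r = (M + M) / (r / 2) by field; rewrite gt_eqF.
  have rS : normc (cexp S t) = r / 2 by rewrite normc_cexp.
  rewrite normcM normcV rS.
  apply: ler_wpM2r; first by rewrite invr_ge0 divr_ge0// ltW.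
  rewrite (le_trans (normcB _ _))// lerD// gM//.
    have -> : a + cexp S t * 1 - a = cexp S t by ring.
    by rewrite rS; clear - r0; lra.
  by rewrite subrr normc0.
have h3 := normc_Re (Q (cexp s1 t') - L).
have h4 := normc_Re (Q (cexp S t)); rewrite Qtt in h4; rewrite Re_sub in h3.
have h5 := ler_norm (complex.Re (Q (cexp s1 t'))).
have h6 := lerNnormlW (lexx `|complex.Re (Q (cexp s1 t')) - complex.Re L|).
clear - h1 h2 h3 h4 h5 h6; lra.
Qed.

(** Multiplying [g] by the unimodular number [L^* / |L|] turns [L] into its modulus and leaves the
    bound unchanged. *)
Lemma cauchy_estimate g a L r M : 0 < r -> holo_disc g a r ->
  (forall z, normc (z - a) < r -> normc (g z) <= M) -> cderiv g a L ->
  normc L <= 4 * M / r.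
Proof.
move=> r0 hg gM gL.
have M0 : 0 <= M by rewrite (le_trans (normc_ge0 (g a)))// gM// subrr normc0.
have [->|L0] := eqVneq L 0.
  by rewrite normc0 divr_ge0 ?mulr_ge0// ltW.
pose c := L^* * (normc L)^-1%:C.
have nc : normc c = 1.
  rewrite normcM normcJ normc_real ger0_norm ?invr_ge0 ?normc_ge0//.
  by rewrite mulfV// normc_eq0.
have cL : c * L = (normc L)%:C.
  rewrite /c mulrAC mulc_conj -rmorphM /= expr2 -mulrA mulfV ?normc_eq0//.
  by rewrite mulr1.
have -> : normc L = complex.Re (c * L) by rewrite cL.
apply: (@Re_cauchy_estimate (fun z => c * g z) a) => //; last exact: cderivMl.
  by move=> z /hg[L' gL']; exists (c * L'); exact: cderivMl.
by move=> z /gM; rewrite normcM nc mul1r.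
Qed.

End cauchy_estimate.
(** * Consequences of Cauchy's estimate *)

Section cauchy_consequences.
Variable R : realType.
Local Notation C := R[i].
Implicit Types (f g : C -> C) (z w h L a b : C) (r s M : R).

Definition cder g z : C := xget 0 [set L | cderiv g z L].

Lemma cderP g z : (exists L, cderiv g z L) -> cderiv g z (cder g z).
Proof. by move=> [L gL]; exact: xgetPex (ex_intro _ L gL). Qed.

Lemma cderE g z L : cderiv g z L -> cder g z = L.
Proof. by move=> gL; apply: cderiv_unique (gL); apply: cderP; exists L. Qed.

Lemma is_derive_cderiv (c : C) g z h (t : R) L : cderiv g (z + t%:C * h) L ->
  is_derive t 1 (fun t : R => complex.Re (c * g (z + t%:C * h))) (complex.Re (c * (L * h))).
Proof.
move=> gL; apply: is_derive_eps => e e0.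
have ch : 0 < normc c * normc h + 1 by rewrite ltr_pwDr// mulr_ge0 ?normc_ge0.
have h1 : 0 < normc h + 1 by rewrite ltr_pwDr// normc_ge0.
have [d d0 dP] := gL _ (divr_gt0 e0 ch).
exists (d / (normc h + 1)) => [|u]; first exact: divr_gt0.
rewrite ltr_pdivlMr// => ud.
have nuh : normc (u%:C * h) = `|u| * normc h by rewrite normcM normc_real.
have uhd : `|u| * normc h < d by rewrite (le_lt_trans _ ud)// ler_wpM2l// lerDl.
have := dP (u%:C * h); rewrite nuh => /(_ uhd) H.
rewrite [u *: 1]mulr1 -Re_sub [u * _]mulrC -Re_mul_real -Re_sub.
apply: le_trans (normc_Re _) _.
have -> : c * g (z + (t + u)%:C * h) - c * g (z + t%:C * h) - c * (L * h) * u%:C =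
  c * (g (z + t%:C * h + u%:C * h) - g (z + t%:C * h) - L * (u%:C * h)).
  by rewrite rmorphD /= mulrDl addrA; ring.
rewrite normcM (le_trans (ler_wpM2l (normc_ge0 c) H))//.
have -> : normc c * (e / (normc c * normc h + 1) * (`|u| * normc h)) =
  (e * `|u|) * ((normc c * normc h) / (normc c * normc h + 1)).
  by field; rewrite gt_eqF.
by rewrite ler_piMr ?mulr_ge0 ?(ltW e0)// ler_pdivrMr// mul1r lerDl.
Qed.

Lemma complex_mean_value g z h (B : R) :
  (forall t : R, 0 <= t <= 1 ->
    exists L, cderiv g (z + t%:C * h) L /\ normc L <= B) ->
  normc (g (z + h) - g z) <= B * normc h.
Proof.
move=> gB; set D := g (z + h) - g z.
have [->|D0] := eqVneq D 0.
  rewrite normc0; have [|L [_ LB]] := gB 0; first by rewrite lexx ler01.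
  by rewrite mulr_ge0 ?normc_ge0// (le_trans (normc_ge0 L)).
have nD : 0 < normc D by rewrite normc_gt0.
pose phi (t : R) := complex.Re (D^* * g (z + t%:C * h)).
pose dphi (t : R) := complex.Re (D^* * (cder g (z + t%:C * h) * h)).
have : `|phi 1 - phi 0| <= normc D * (B * normc h) * (1 - 0).
  apply: (@MVT_bound R phi dphi) => //.
    by move=> t /gB[L [gL _]]; apply: is_derive_cderiv; apply: cderP; exists L.
  move=> t /gB[L [gL LB]]; apply: le_trans (normc_Re _) _.
  by rewrite !normcM normcJ (cderE gL) ler_wpM2l ?normc_ge0// ler_wpM2r ?normc_ge0.
have -> : phi 1 - phi 0 = normc D ^+ 2.
  by rewrite /phi -Re_sub -mulrBr mul1r mul0r addr0 -/D mulc_conj.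
rewrite subr0 mulr1 ger0_norm ?exprn_ge0 ?normc_ge0// expr2.
by rewrite ler_pM2l.
Qed.

Definition holo_bd g a r M := forall z, normc (z - a) < r ->
  (exists L, cderiv g z L) /\ normc (g z) <= M.

Lemma holo_bd_ge0 g a r M : 0 < r -> holo_bd g a r M -> 0 <= M.
Proof.
move=> r0 gM; have [|_] := gM a; first by rewrite subrr normc0.
by apply: le_trans; exact: normc_ge0.
Qed.

Lemma sub_holo_bd g a b r s M : normc (b - a) + s <= r ->
  holo_bd g a r M -> holo_bd g b s M.
Proof.
move=> bs gM z zb; apply: gM; have -> : z - a = (z - b) + (b - a) by ring.
by rewrite (le_lt_trans (normcD _ _))// (lt_le_trans _ bs)// addrC ltrD2l.
Qed.

Lemma cauchy_bd g a r M L : 0 < r -> holo_bd g a r M -> cderiv g a L ->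
  normc L <= 4 * M / r.
Proof.
by move=> r0 gM; apply: cauchy_estimate => // z /gM[].
Qed.

Lemma cauchy_half g a r M z L : 0 < r -> holo_bd g a r M ->
  normc (z - a) <= r / 2 -> cderiv g z L -> normc L <= 8 * M / r.
Proof.
move=> r0 gM za gL; have r2 : 0 < r / 2 by rewrite divr_gt0.
have -> : 8 * M / r = 4 * M / (r / 2) by field; rewrite gt_eqF.
apply: cauchy_bd gL => //; apply: sub_holo_bd gM; clear - za r0; lra.
Qed.

Lemma normc_convex (t : R) z h a r : 0 <= t <= 1 -> normc (z - a) <= r ->
  normc (z + h - a) <= r -> normc (z + t%:C * h - a) <= r.
Proof.
move=> /andP[t0 t1] za zha.
have -> : z + t%:C * h - a = (1 - t)%:C * (z - a) + t%:C * (z + h - a).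
  by rewrite rmorphB /= rmorph1; ring.
rewrite (le_trans (normcD _ _))// !normcM !normc_real !ger0_norm ?subr_ge0//.
have t1' : 0 <= 1 - t by rewrite subr_ge0.
have := ler_wpM2l t1' za; have := ler_wpM2l t0 zha; clear; lra.
Qed.

Lemma holo_lipschitz g a r M z w : 0 < r -> holo_bd g a r M ->
  normc (z - a) <= r / 2 -> normc (w - a) <= r / 2 ->
  normc (g w - g z) <= 8 * M / r * normc (w - z).
Proof.
move=> r0 gM za wa; have -> : g w = g (z + (w - z)) by congr g; ring.
apply: complex_mean_value => t t01.
have zt : normc (z + t%:C * (w - z) - a) <= r / 2.
  by apply: normc_convex => //; have -> : z + (w - z) = w by ring.
have [|[L gL] _] := gM (z + t%:C * (w - z)).
  by rewrite (le_lt_trans zt)//; clear - r0; lra.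
by exists L; split=> //; exact: cauchy_half zt gL.
Qed.

(* Cauchy's estimate is applied to [z |-> g (z + h) - g z]. *)
Lemma holo_der_lipschitz g a r M h : 0 < r -> holo_bd g a r M ->
  normc h < r / 4 ->
  normc (cder g (a + h) - cder g a) <= 128 * M / r ^+ 2 * normc h.
Proof.
move=> r0 gM hr; have r4 : 0 < r / 4 by rewrite divr_gt0.
have gder z : normc (z - a) < r / 2 -> cderiv g z (cder g z).
  move=> za; apply: cderP; have [|//] := gM z.
  by rewrite (lt_trans za)//; clear - r0; lra.
have ha z : z + h - a = (z - a) + h by ring.
(* [128 = 4 * 8 * 4]: Cauchy's constant, the Lipschitz constant [8 * M / r] of [g], and the radius
   [r / 4], for which [z] and [z + h] both stay within [r / 2] of [a]. *)
have -> : 128 * M / r ^+ 2 * normc h = 4 * (8 * M / r * normc h) / (r / 4).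
  by field; rewrite gt_eqF.
have D z : normc (z - a) < r / 4 ->
    cderiv (fun z => g (h + z * 1) - g z) z (cder g (h + z * 1) * 1 - cder g z).
  move=> za; apply: cderivB; last by apply: gder; clear - za r0; lra.
  apply: cderiv_comp_affine; apply: gder.
  rewrite mulr1 [h + z]addrC ha (le_lt_trans (normcD _ _))//; clear - za hr; lra.
apply: (@cauchy_bd (fun z => g (h + z * 1) - g z) a) => //; last first.
  have := D a; rewrite subrr normc0 => /(_ r4).
  by rewrite !mulr1 [h + a]addrC.
move=> z za; split; first by exists (cder g (h + z * 1) * 1 - cder g z); exact: D.
rewrite mulr1 [h + z]addrC; have -> : normc h = normc (z + h - z) by congr normc; ring.
apply: holo_lipschitz gM _ _ => //; first by clear - za r0; lra.
by rewrite ha (le_trans (normcD _ _))//; clear - za hr; lra.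
Qed.

(** The derivative of [g z - cder g a * z] is small near [a] by [holo_der_lipschitz]. The mean value
    inequality stands in for integration, at the price of the factor one half. *)
Lemma holo_taylor2 g a r M h : 0 < r -> holo_bd g a r M -> normc h < r / 4 ->
  normc (g (a + h) - g a - cder g a * h) <= 128 * M / r ^+ 2 * normc h ^+ 2.
Proof.
move=> r0 gM hr.
pose k z := g z - cder g a * z.
have -> : g (a + h) - g a - cder g a * h = k (a + h) - k a by rewrite /k; ring.
rewrite expr2 mulrA; apply: complex_mean_value => t /andP[t0 t1].
have nt : normc (t%:C * h) <= normc h.
  by rewrite normcM normc_real ger0_norm// ler_piMl// normc_ge0.
exists (cder g (a + t%:C * h) - cder g a * 1); split.
  apply: cderivB; last exact: cderivMl (cderiv_id _).
  apply: cderP; have [|//] := gM (a + t%:C * h).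
  have -> : a + t%:C * h - a = t%:C * h by ring.
  by rewrite (le_lt_trans nt)// (lt_trans hr)//; clear - r0; lra.
rewrite mulr1 (le_trans (holo_der_lipschitz r0 gM (le_lt_trans nt hr)))//.
apply: ler_wpM2l => //; have M0 := holo_bd_ge0 r0 gM.
by rewrite divr_ge0 ?mulr_ge0 ?exprn_ge0 ?(ltW r0).
Qed.

(** The limit is the supremum of the lower bounds [e h - B * normc h], each of which lies below
    every upper bound [e k + B * normc k]. *)
Lemma real_limit_of_cauchy (e : C -> R) (B r : R) : 0 < r ->
  (forall h k, h != 0 -> k != 0 -> normc h < r -> normc k < r ->
    `|e h - e k| <= B * (normc h + normc k)) ->
  exists l : R, forall h, h != 0 -> normc h < r -> `|e h - l| <= B * normc h.
Proof.
move=> r0 eP.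
pose S := [set e h - B * normc h | h in [set h | h != 0 /\ normc h < r]].
pose k0 : C := (r / 2)%:C.
have nk0 : normc k0 = r / 2 by rewrite normc_real ger0_norm ?divr_ge0// ltW.
have k0r : normc k0 < r by rewrite nk0; clear - r0; lra.
have k00 : k0 != 0 by rewrite -normc_gt0 nk0 divr_gt0.
have ub h : h != 0 -> normc h < r -> ubound S (e h + B * normc h).
  move=> h0 hr _ [k [k_0 kr] <-]; have := eP k h k_0 h0 kr hr.
  by move=> /ler_normlP[_ ]; clear; lra.
exists (sup S) => h h0 hr; rewrite ler_norml; apply/andP; split.
  rewrite lerBrDr; apply: le_trans (_ : sup S - B * normc h <= _); first by rewrite addrC.
  rewrite lerBlDr; apply: ge_sup; last exact: ub.
  by exists (e k0 - B * normc k0), k0.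
rewrite lerBlDr addrC -lerBlDr; apply: ub_le_sup.
  by exists (e k0 + B * normc k0); exact: ub.
by exists h.
Qed.

(* The difference quotients of [mu |-> d F / d lambda (0, mu)] are derivatives
   at [0] of the functions [lambda |-> (F lambda h - F lambda 0) / h], which
   form a uniformly Cauchy family as [h] tends to [0]. *)
Lemma cderiv_partial (F : C -> C -> C) r M : 0 < r ->
  (forall l m, normc l < r -> normc m < r ->
    [/\ exists L, cderiv (F ^~ m) l L, exists L, cderiv (F l) m L
      & normc (F l m) <= M]) ->
  exists L, cderiv (fun m => cder (F ^~ m) 0) 0 L.
Proof.
move=> r0 FP; pose G m := cder (F ^~ m) 0.
suff [L GL] : exists L, cderiv G 0 L by exists L.
have z0 : normc (0 : C) < r by rewrite normc0.
have M0 : 0 <= M by have [_ _] := FP 0 0 z0 z0; apply: le_trans; exact: normc_ge0.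
pose A := 128 * M / r ^+ 2.
have A0 : 0 <= A by rewrite divr_ge0 ?mulr_ge0 ?exprn_ge0 ?(ltW r0).
pose B := 4 * A / r.
have B0 : 0 <= B by apply: divr_ge0; [exact: mulr_ge0|exact: ltW].
have r4 : 0 < r / 4 by rewrite divr_gt0.
pose E h l := h^-1 * (F l h - F l 0).
have EP h l : h != 0 -> normc h < r / 4 -> normc l < r ->
    normc (E h l - cder (F l) 0) <= A * normc h.
  move=> h0 hr lr.
  have Fl : holo_bd (F l) 0 r M.
    by move=> m; rewrite subr0 => mr; have [] := FP l m lr mr.
  have := holo_taylor2 r0 Fl hr; rewrite add0r => H.
  have -> : E h l - cder (F l) 0 = h^-1 * (F l h - F l 0 - cder (F l) 0 * h).
    by rewrite /E; field.
  rewrite normcM normcV mulrC ler_pdivrMr ?normc_gt0//.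
  by rewrite -mulrA -expr2.
have quot h k : h != 0 -> k != 0 -> normc h < r / 4 -> normc k < r / 4 ->
    normc (h^-1 * (G h - G 0) - k^-1 * (G k - G 0)) <= B * (normc h + normc k).
  move=> h0 k0 hr kr.
  have hr' : normc h < r by clear - hr r0; lra.
  have kr' : normc k < r by clear - kr r0; lra.
  have cE l x : normc l < r -> normc x < r -> cderiv (F ^~ x) l (cder (F ^~ x) l).
    by move=> lr xr; apply: cderP; have [] := FP l x lr xr.
  have cEk l x : normc l < r -> normc x < r ->
      cderiv (E x) l (x^-1 * (cder (F ^~ x) l - cder (F ^~ 0) l)).
    by move=> lr xr; apply/cderivMl/cderivB; exact: cE.
  have -> : B * (normc h + normc k) = 4 * (A * (normc h + normc k)) / r.
    by rewrite /B; ring.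
  apply: (@cauchy_bd (fun l => E h l - E k l) 0) => //; last first.
    by apply: cderivB; exact: cEk.
  move=> l; rewrite subr0 => lr; split.
    by eexists; apply: cderivB; exact: cEk.
  have -> : E h l - E k l = (E h l - cder (F l) 0) - (E k l - cder (F l) 0) by ring.
  by rewrite (le_trans (normcB _ _))// mulrDr lerD// EP.
have [|u uP] := @real_limit_of_cauchy
    (fun h => complex.Re (h^-1 * (G h - G 0))) B _ r4.
  move=> h k h0 k0 hr kr; rewrite -Re_sub.
  by apply: le_trans (normc_Re _) _; exact: quot.
have [|v vP] := @real_limit_of_cauchy
    (fun h => complex.Im (h^-1 * (G h - G 0))) B _ r4.
  move=> h k h0 k0 hr kr; rewrite -Im_sub.
  by apply: le_trans (normc_Im _) _; exact: quot.
have lim h : h != 0 -> normc h < r / 4 ->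
    normc (h^-1 * (G h - G 0) - (u +i* v)) <= 2 * B * normc h.
  move=> h0 hr; apply: le_trans (normc_leD _) _; rewrite Re_sub Im_sub.
  by have := uP h h0 hr; have := vP h h0 hr; rewrite /=; clear; lra.
exists (u +i* v) => e e0.
have B1 : 0 < 2 * B + 1 by clear - B0; lra.
exists (Num.min (r / 4) (e / (2 * B + 1))) => [|h].
  by rewrite lt_min r4 divr_gt0.
rewrite lt_min => /andP[hr]; rewrite ltr_pdivlMr// => he.
rewrite add0r; have [->|h0] := eqVneq h 0.
  by rewrite mulr0 !subrr normc0 mulr0.
have -> : G h - G 0 - (u +i* v) * h = h * (h^-1 * (G h - G 0) - (u +i* v)).
  by field.
rewrite normcM mulrC ler_wpM2r ?normc_ge0//.
rewrite (le_trans (lim h h0 hr))//.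
by have := normc_ge0 h; clear - he; lra.
Qed.

(** The function [g (a + m + l)] of two variables has [cder g (a + m)] as its partial derivative in
    [l] at [0], so [cderiv_partial] differentiates [cder g] at [a]. *)
Lemma cderiv_cder g a r M : 0 < r -> holo_bd g a r M ->
  exists L, cderiv (cder g) a L.
Proof.
move=> r0 gM.
have ga z : normc (z - a) < r -> cderiv g z (cder g z).
  by move=> /gM[? _]; exact: cderP.
have FP (l m : C) : normc l < r / 2 -> normc m < r / 2 -> normc (a + m + l * 1 - a) < r.
  move=> lr mr; have -> : a + m + l * 1 - a = m + l by ring.
  by rewrite (le_lt_trans (normcD _ _))//; clear - lr mr; lra.
have r2 : 0 < r / 2 by rewrite divr_gt0.
have FD (l m : C) : normc l < r / 2 -> normc m < r / 2 ->
    cderiv (fun l => g (a + m + l * 1)) l (cder g (a + m + l * 1) * 1).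
  by move=> lr mr; apply: cderiv_comp_affine; apply: ga; exact: FP.
have FD' (l m : C) : normc l < r / 2 -> normc m < r / 2 ->
    cderiv (fun m => g (a + m + l * 1)) m (cder g (a + m + l * 1) * 1).
  move=> lr mr.
  have e x : a + x + l * 1 = a + l + x * 1 by ring.
  have := @cderiv_comp_affine R g (a + l) 1 m (cder g (a + l + m * 1)).
  rewrite -e => /(_ (ga _ (FP l m lr mr))).
  by apply: cderiv_near ltr01 _ => x _; rewrite e.
have [|L] := @cderiv_partial (fun l m => g (a + m + l * 1)) _ M r2.
  move=> l m lr mr; split; [by eexists; exact: FD|by eexists; exact: FD'|].
  by have [] := gM _ (FP l m lr mr).
move=> GL; exists L => e e0; have [d d0 dP] := GL e e0.
exists (Num.min d (r / 2)) => [|h]; first by rewrite lt_min d0.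
rewrite lt_min => /andP[hd hr]; have := dP h hd.
have z0 : normc (0 : C) < r / 2 by rewrite normc0.
rewrite (cderE (FD 0 (0 + h) _ _)) ?add0r// (cderE (FD 0 0 _ _))//.
by rewrite !mul0r !mulr1 !addr0.
Qed.

(** Decay faster than any power along the positive real axis only, which is what nullity provides at
    a fixed real point. *)
Definition flat g := forall q : nat, exists c d : R, 0 < d /\
  forall x : R, 0 < x < d -> normc (g x%:C) <= c * x ^+ q.

Lemma le0_of_vanishing (u c d : R) : 0 < d ->
  (forall x : R, 0 < x < d -> u <= c * x) -> u <= 0.
Proof.
move=> d0 H; apply/ler_addgt0Pr => e e0; rewrite add0r.
have c1 : 0 < `|c| + 1 by rewrite ltr_pwDr.
pose x := Num.min (d / 2) (e / (`|c| + 1)).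
have x0 : 0 < x by rewrite lt_min !divr_gt0.
have xd : x < d by rewrite gt_min ltr_pdivrMr// ltr_pMr// ltr1n.
rewrite (le_trans (H x _)) ?x0//.
apply: le_trans (_ : `|c| * x <= _); first by rewrite ler_wpM2r ?ler_norm ?ltW.
have : x <= e / (`|c| + 1) by rewrite ge_min lexx orbT.
by rewrite ler_pdivlMr//; clear - x0; lra.
Qed.

(** The coefficient of order [q] is compared with flatness of order [q + 1] at a small positive [x].
    The remainder is controlled by the Lipschitz estimate for [q = 0], by [holo_taylor2] for
    [q = 1], and by the differentiability of [cder g] for [q = 2]. *)
Lemma flat_holo_vanish2 g r M : 0 < r -> holo_bd g 0 r M -> flat g ->
  [/\ g 0 = 0, cder g 0 = 0 & cder (cder g) 0 = 0].
Proof.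
move=> r0 gM gf.
have r4 : 0 < r / 4 by rewrite divr_gt0.
pose A := 128 * M / r ^+ 2.
have M0 := holo_bd_ge0 r0 gM.
have A0 : 0 <= A by rewrite divr_ge0 ?mulr_ge0 ?exprn_ge0 ?(ltW r0).
have nx (x : R) : 0 < x -> normc x%:C = x by move=> x0; rewrite normc_real gtr0_norm.
have zr : normc (0 - 0 : C) <= r / 2 by rewrite subr0 normc0 divr_ge0// ltW.
have g0 : g 0 = 0.
  apply/eqP; rewrite -normc_eq0 eq_le normc_ge0 andbT.
  have [c [d [d0 dP]]] := gf 1%N.
  apply: (@le0_of_vanishing _ (c + 8 * M / r) (Num.min d (r / 2))) => [|x].
    by rewrite lt_min d0 divr_gt0.
  rewrite lt_min => /and3P[x0 xd xr].
  have h1 := dP x; rewrite x0 xd expr1 in h1.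
  have := @holo_lipschitz _ _ _ _ 0 x%:C r0 gM zr.
  rewrite !subr0 nx// => /(_ (ltW xr)) h2.
  have := normcB (g x%:C) (g x%:C - g 0); rewrite opprB addrC subrK.
  by have := h1 isT; clear - h2; lra.
have g'0 : cder g 0 = 0.
  apply/eqP; rewrite -normc_eq0 eq_le normc_ge0 andbT.
  have [c [d [d0 dP]]] := gf 2%N.
  apply: (@le0_of_vanishing _ (c + A) (Num.min d (r / 4))) => [|x].
    by rewrite lt_min d0 r4.
  rewrite lt_min => /and3P[x0 xd xr].
  have h1 := dP x; rewrite x0 xd in h1; have {}h1 := h1 isT.
  have := @holo_taylor2 g 0 r M x%:C r0 gM; rewrite nx// add0r g0 subr0 -/A.
  move=> /(_ xr) h2.
  rewrite -(ler_pM2r x0) -{1}(nx x x0) -normcM.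
  have -> : cder g 0 * x%:C = g x%:C - (g x%:C - cder g 0 * x%:C) by ring.
  rewrite (le_trans (normcB _ _))//.
  have -> : (c + A) * x * x = c * x ^+ 2 + A * x ^+ 2 by ring.
  exact: lerD.
split=> //.
have [L2 gL2] := cderiv_cder r0 gM.
rewrite (cderE gL2).
apply/eqP; rewrite -normc_eq0 eq_le normc_ge0 andbT.
apply/ler_addgt0Pr => e e0; rewrite add0r.
have e2 : 0 < e / 2 by rewrite divr_gt0.
have [d1 d10 d1P] := gL2 _ e2.
have [c [d [d0 dP]]] := gf 3%N.
have : normc L2 / 2 - e / 2 <= 0.
  apply: (@le0_of_vanishing _ c (Num.min d (Num.min d1 r))) => [|x].
    by rewrite !lt_min d0 d10 r0.
  rewrite !lt_min => /and4P[x0 xd xd1 xr].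
  have h1 := dP x; rewrite x0 xd in h1; have {}h1 := h1 isT.
  (* In place of a third-order remainder: the derivative of [k] is [cder g z - L2 * z], which is at
     most [e / 2 * normc z] near [0] because [cder g 0 = 0]. *)
  pose k z := g z - L2 * (2^-1 * (z * z)).
  have h2 : normc (k (0 + x%:C) - k 0) <= (e / 2 * x) * normc x%:C.
    apply: complex_mean_value => t /andP[t0 t1].
    have nt : normc (t%:C * x%:C) <= x.
      by rewrite normcM !normc_real (ger0_norm t0) gtr0_norm// ler_piMl// ltW.
    exists (cder g (0 + t%:C * x%:C) - L2 * (0 + t%:C * x%:C)); split.
      apply: cderivB.
        apply: cderP; have [|//] := gM (0 + t%:C * x%:C).
        by rewrite subr0 add0r (le_lt_trans nt).
      set z := 0 + _; have -> : L2 * z = L2 * (2^-1 * (1 * z + z * 1)) by field.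
      by do 2!apply: cderivMl; apply: cderivM; exact: cderiv_id.
    have := d1P (t%:C * x%:C) (le_lt_trans nt xd1).
    rewrite g'0 subr0 add0r => /le_trans; apply.
    by rewrite ler_wpM2l// ltW.
  rewrite add0r /k g0 !mulr0 !subr0 nx// in h2.
  have h3 : normc (L2 * (2^-1 * (x%:C * x%:C))) = normc L2 / 2 * x ^+ 2.
    rewrite !normcM nx// normcV; have -> : (2 : C) = (2 : R)%:C by rewrite rmorph_nat.
    by rewrite normc_real ger0_norm//; ring.
  have h4 : normc L2 / 2 * x ^+ 2 <= c * x ^+ 3 + e / 2 * x * x.
    rewrite -h3; apply: le_trans (lerD h1 h2).
    have := normcB (g x%:C) (g x%:C - L2 * (2^-1 * (x%:C * x%:C))).
    by congr (normc _ <= _); ring.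
  have x2 : 0 < x ^+ 2 by rewrite exprn_gt0.
  rewrite -(ler_pM2r x2); move: h4; rewrite [x ^+ 3]exprS expr2; clear; lra.
by clear; lra.
Qed.

(* At [0] the quotient has the junk value [g 0 * 0^-1 = 0], which is the right
   one because [g] vanishes to second order. *)
Lemma flat_div g r M : 0 < r -> holo_bd g 0 r M -> flat g ->
  holo_bd (fun z => g z * z^-1) 0 r (8 * M / r) /\ flat (fun z => g z * z^-1).
Proof.
move=> r0 gM gf; have M0 := holo_bd_ge0 r0 gM.
have [g0 g'0 g''0] := flat_holo_vanish2 r0 gM gf.
split; last first.
  move=> q; have [c [d [d0 dP]]] := gf q.+1; exists c, d; split=> // x /andP[x0 xd].
  rewrite normcM normcV normc_real gtr0_norm// ler_pdivrMr//.
  have := dP x; rewrite x0 xd => /(_ isT)/le_trans; apply.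
  by rewrite exprSr mulrA.
move=> z; rewrite subr0 => zr; split; last first.
  rewrite normcM normcV; have [->|z0] := eqVneq z 0.
    by rewrite g0 normc0 mul0r divr_ge0 ?mulr_ge0 ?(ltW r0).
  rewrite ler_pdivrMr ?normc_gt0//.
  have [zr2|zr2] := leP (normc z) (r / 2).
    have := @holo_lipschitz g 0 r M 0 z r0 gM.
    by rewrite g0 !subr0 normc0; apply=> //; rewrite divr_ge0// ltW.
  have [|_ gz] := gM z; first by rewrite subr0.
  apply: le_trans gz _; rewrite mulrAC ler_pdivlMr//.
  have := ler_wpM2l M0 (ltW zr2); rewrite mulrA.
  by have := mulr_ge0 M0 (ltW r0); clear; lra.
have [->|z0] := eqVneq z 0; last first.
  have [|[L gL] _] := gM z; first by rewrite subr0.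
  by eexists; exact: cderivM gL (cderivV z0).
exists 0 => e e0.
have [L2 gL2] := cderiv_cder r0 gM.
move: g''0; rewrite (cderE gL2) => L20; rewrite L20 in gL2.
have [d d0 dP] := gL2 e e0.
exists (Num.min d r) => [|h]; first by rewrite lt_min d0.
rewrite lt_min => /andP[hd hr].
rewrite add0r g0 !mul0r !subr0; have [->|h0] := eqVneq h 0.
  by rewrite g0 mul0r normc0 mulr0.
rewrite normcM normcV ler_pdivrMr ?normc_gt0//.
have : normc (g (0 + h) - g 0) <= (e * normc h) * normc h.
  apply: complex_mean_value => t /andP[t0 t1].
  have nt : normc (t%:C * h) <= normc h.
    by rewrite normcM normc_real ger0_norm// ler_piMl// normc_ge0.
  exists (cder g (0 + t%:C * h)); split.
    apply: cderP; have [|//] := gM (0 + t%:C * h).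
    by rewrite subr0 add0r (le_lt_trans nt).
  have := dP (t%:C * h) (le_lt_trans nt hd).
  rewrite g'0 mul0r !subr0 => /le_trans; apply.
  by rewrite ler_wpM2l// ltW.
by rewrite add0r g0 subr0.
Qed.

(* Dividing by [z] preserves the hypotheses and multiplies the bound by
   [8 / r], so that [normc (g z) <= M * (8 * normc z / r) ^+ n] for all [n]. *)
Lemma flat_holo_eq0 g r M z : 0 < r -> holo_bd g 0 r M -> flat g ->
  normc z < r / 8 -> g z = 0.
Proof.
move=> r0 gM gf zr8.
have zr : normc (z - 0) < r by rewrite subr0; have := normc_ge0 z; clear - zr8; lra.
have key n : forall f N, holo_bd f 0 r N -> flat f ->
    normc (f z) <= N * (8 * normc z / r) ^+ n.
  elim: n => [|n IH] f N fN ff; first by rewrite expr0 mulr1; have [] := fN z zr.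
  have [h1 h2] := flat_div r0 fN ff; have := IH _ _ h1 h2.
  have [->|z0] := eqVneq z 0.
    have [f0 _ _] := flat_holo_vanish2 r0 fN ff.
    by move=> _; rewrite f0 normc0 mulr0 mul0r expr0n/= mulr0.
  rewrite normcM normcV ler_pdivrMr ?normc_gt0// => /le_trans; apply.
  by rewrite exprS le_eqVlt; apply/orP; left; apply/eqP; ring.
apply/eqP; rewrite -normc_eq0 eq_le normc_ge0 andbT.
pose x := 8 * normc z / r.
have x0 : 0 <= x by rewrite divr_ge0 ?mulr_ge0 ?normc_ge0 ?(ltW r0).
have x1 : x < 1 by rewrite ltr_pdivrMr// mul1r; clear - zr8; lra.
have cx : M * x ^+ n @[n --> \oo] --> 0.
  rewrite -(mulr0 M); apply: cvgMr; apply: cvg_expr; rewrite ger0_norm//.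
rewrite -(cvg_lim _ cx)//; apply: limr_ge; first by apply/cvg_ex; exists 0.
by apply: nearW => n; exact: key.
Qed.

End cauchy_consequences.
(** * Holomorphic functions on normed spaces *)

Section normed_space.
Variables (R : realType) (V : normedModType R[i]).
Implicit Types (u v w p q : V) (l : R[i]) (r : R).

(* The norm of a complex normed space has values in [R[i]]. *)
Definition pn v : R := complex.Re `|v|.

Lemma normE_pn v : `|v| = (pn v)%:C.
Proof. by rewrite /pn RRe_real// realE normr_ge0. Qed.

Lemma pn_ge0 v : 0 <= pn v.
Proof. by rewrite -lecR -normE_pn normr_ge0. Qed.

Lemma pnS_gt0 v : 0 < pn v + 1.
Proof. by rewrite ltr_pwDr// pn_ge0. Qed.

Lemma pn_lt v r : (pn v < r) = (`|v| < r%:C).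
Proof. by rewrite normE_pn ltcR. Qed.

Lemma pn0 : pn 0 = 0.
Proof. by rewrite /pn normr0. Qed.

Lemma pnD u v : pn (u + v) <= pn u + pn v.
Proof. by rewrite -lecR rmorphD /= -!normE_pn ler_normD. Qed.

Lemma pnN v : pn (- v) = pn v.
Proof. by rewrite /pn normrN. Qed.

Lemma pnZ l v : pn (l *: v) = normc l * pn v.
Proof. by apply: complexI; rewrite rmorphM /= -!normE_pn normrZ. Qed.

Lemma pn_eq0 v : (pn v == 0) = (v == 0).
Proof.
by rewrite -[RHS]normr_eq0 normE_pn -[LHS](inj_eq (@complexI R)).
Qed.

Lemma pn_gt0 v : (0 < pn v) = (v != 0).
Proof. by rewrite lt_neqAle pn_ge0 andbT eq_sym pn_eq0. Qed.

Lemma nbhs_pn p (P : set V) : nbhs p P ->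
  exists2 r : R, 0 < r & forall q, pn (q - p) < r -> P q.
Proof.
move=> /nbhs_ballP[e /= e0 eP].
have eE : e = (complex.Re e)%:C by rewrite RRe_real// realE ltW.
exists (complex.Re e) => [|q]; first by rewrite -ltcR -eE.
by rewrite pn_lt -eE => qe; apply: eP; rewrite -ball_normE /= distrC.
Qed.

End normed_space.

Section line_holomorphic.
Variables (R : realType) (V : normedModType R[i]).
Local Notation C := R[i].
Implicit Types (u v w p q : V) (f g : V -> C) (W : set V).

Definition dd v f p := cder (fun l : C => f (p + l *: v)) 0.

(* Holomorphy in the sense of Gateaux together with local boundedness; unlike
   Frechet differentiability it passes easily to directional derivatives. *)
Definition gholo W f := forall p, W p ->
  (exists r M : R, 0 < r /\ forall q, pn (q - p) < r -> W q /\ normc (f q) <= M) /\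
  forall v, exists L, cderiv (fun l : C => f (p + l *: v)) 0 L.

Lemma gholo_dd W f v p : gholo W f -> W p ->
  cderiv (fun l : C => f (p + l *: v)) 0 (dd v f p).
Proof. by move=> fW Wp; apply: cderP; have [_] := fW p Wp. Qed.

Lemma cderiv_shift (g : C -> C) z L :
  cderiv (fun h => g (z + h)) 0 L -> cderiv g z L.
Proof.
by move=> gL e /gL[d d0 dP]; exists d => // h /dP; rewrite add0r addr0.
Qed.

Lemma gholo_line W f p v l : gholo W f -> W (p + l *: v) ->
  cderiv (fun l : C => f (p + l *: v)) l (dd v f (p + l *: v)).
Proof.
move=> fW Wp; apply: cderiv_shift.
apply: cderiv_near ltr01 _ (gholo_dd v fW Wp) => h _.
by rewrite add0r scalerDl addrA.
Qed.

Lemma gholo_holo_bd W f p v (r s M : R) : gholo W f -> s * pn v <= r -> 0 < r ->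
  (forall q, pn (q - p) < r -> W q /\ normc (f q) <= M) ->
  holo_bd (fun l : C => f (p + l *: v)) 0 s M.
Proof.
move=> fW svr r0 rM l; rewrite subr0 => ls.
have lr : pn (p + l *: v - p) < r.
  rewrite addrAC subrr add0r pnZ.
  have [->|v0] := eqVneq v 0; first by rewrite pn0 mulr0.
  by rewrite (lt_le_trans _ svr)// ltr_pM2r// pn_gt0.
have [Wq fq] := rM _ lr; split=> //.
by eexists; exact: gholo_line Wq.
Qed.

(** Near [p] the derivative is bounded by Cauchy's estimate on complex lines in direction [v], with
    discs of one common radius. It is differentiable in a second direction [w] by [cderiv_partial],
    applied to [f] on the complex plane through [p] spanned by [v] and [w]. *)
Lemma gholo_derivative W f v : gholo W f -> gholo W (dd v f).
Proof.
move=> fW p Wp; have [[r [M [r0 rM]]] _] := fW p Wp.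
have M0 : 0 <= M.
  by have [|_] := rM p; rewrite ?subrr ?pn0//; apply: le_trans; exact: normc_ge0.
have lineE q (u : V) (l : C) : q + l *: u - p = (q - p) + l *: u by rewrite addrAC.
split.
  have pv1 : 0 < pn v + 1 by rewrite ltr_pwDr// pn_ge0.
  pose s := r / 2 / (pn v + 1).
  have r2 : 0 < r / 2 by rewrite divr_gt0.
  have s0 : 0 < s by rewrite divr_gt0.
  exists (r / 2), (4 * M / s); split=> // q qp.
  have rM' q' : pn (q' - q) < r / 2 -> W q' /\ normc (f q') <= M.
    move=> qq'; apply: rM; have -> : q' - p = (q' - q) + (q - p).
      by rewrite addrA subrK.
    by rewrite (le_lt_trans (pnD _ _))//; clear - qp qq'; lra.
  have [|Wq _] := rM' q; first by rewrite subrr pn0.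
  split=> //; apply: (cauchy_bd s0 _ (gholo_dd v fW Wq)).
  apply: (gholo_holo_bd fW _ r2 rM').
  by rewrite /s mulrAC ler_pdivrMr// ler_wpM2l ?lerDl// ltW.
move=> w.
pose B := pn v + pn w + 1.
have B0 : 0 < B by rewrite ltr_pwDr// addr_ge0 ?pn_ge0.
apply: (@cderiv_partial _ (fun l m => f (p + m *: w + l *: v)) (r / B) M).
  exact: divr_gt0.
move=> l m; rewrite !ltr_pdivlMr// => lr mr.
have [Wlm flm] : W (p + m *: w + l *: v) /\ normc (f (p + m *: w + l *: v)) <= M.
  apply: rM; rewrite lineE [p + _]addrC addrK (le_lt_trans (pnD _ _))// !pnZ.
  have := pn_ge0 v; have := pn_ge0 w; have := normc_ge0 l; have := normc_ge0 m.
  rewrite /B in lr mr.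
  have [lm|ml] := leP (normc l) (normc m); move=> m0 l0 w0 v0.
    have := ler_wpM2r v0 lm; clear - mr m0; lra.
  have := ler_wpM2r w0 (ltW ml); clear - lr l0; lra.
split=> //; first by eexists; exact: gholo_line Wlm.
have e x : p + x *: w + l *: v = p + l *: v + x *: w by rewrite addrAC.
rewrite e in Wlm; eexists.
by apply: cderiv_near ltr01 _ (gholo_line fW Wlm) => x _; rewrite e.
Qed.

(** The point [q] has parameter [1] on the complex line from [p] through [q], and [f] is bounded
    there on the disc of radius [r / pn (q - p)]. This radius is at least [2] when [q] is near, so
    the one-variable Lipschitz estimate reaches [q]; continuity of [f] follows. *)
Lemma gholo_lip W f p : gholo W f -> W p -> exists r K : R, 0 < r /\
  forall q, pn (q - p) < r -> normc (f q - f p) <= K * pn (q - p).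
Proof.
move=> fW Wp; have [[r [M [r0 rM]]] _] := fW p Wp.
exists (r / 2), (8 * M / r); split=> [|q qr]; first by rewrite divr_gt0.
have [->|qp] := eqVneq q p; first by rewrite !subrr pn0 normc0 mulr0.
have v0 : 0 < pn (q - p) by rewrite pn_gt0 subr_eq0.
pose s := r / pn (q - p).
have s0 : 0 < s by rewrite divr_gt0.
have := @gholo_holo_bd W f p (q - p) r s M fW; rewrite /s divfK ?gt_eqF// -/s.
move=> /(_ (lexx _) r0 rM) fb.
have s2 : 1 <= s / 2 by rewrite /s ler_pdivlMr// ler_pdivlMr//; clear - qr; lra.
have := holo_lipschitz s0 fb (z := 0) (w := 1).
rewrite !subr0 normc0 normc1 mulr1 scale0r scale1r addr0 [p + _]addrC subrK.
have -> : 8 * M / s = 8 * M / r * pn (q - p) by rewrite /s; field; rewrite !gt_eqF.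
by apply=> //; rewrite divr_ge0// ltW.
Qed.

Lemma gholoB W f g : gholo W f -> gholo W g -> gholo W (fun p => f p - g p).
Proof.
move=> fW gW p Wp; have [[r [M [r0 rM]]] fl] := fW p Wp.
have [[r' [M' [r'0 rM']]] gl] := gW p Wp; split.
  exists (Num.min r r'), (M + M'); split; first by rewrite lt_min r0.
  move=> q; rewrite lt_min => /andP[/rM[? ?] /rM'[? ?]]; split=> //.
  by rewrite (le_trans (normcB _ _))// lerD.
move=> v; have [L fL] := fl v; have [L' gL'] := gl v.
by exists (L - L'); exact: cderivB.
Qed.

Lemma gholo_sub W W' f : gholo W f -> W' `<=` W ->
  (forall p, W' p -> exists2 r : R, 0 < r & forall q, pn (q - p) < r -> W' q) ->
  gholo W' f.
Proof.
move=> fW sub W'o p W'p; have [[r [M [r0 rM]]] fl] := fW p (sub _ W'p).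
split=> //; have [s s0 sW] := W'o p W'p.
exists (Num.min r s), M; split; first by rewrite lt_min r0.
by move=> q; rewrite lt_min => /andP[/rM[_ ?] /sW].
Qed.

Lemma differentiable_gholo W f :
  (forall p, W p -> exists2 r : R, 0 < r & forall q, pn (q - p) < r -> W q) ->
  (forall p, W p -> differentiable f p) -> gholo W f.
Proof.
move=> Wo df p Wp; have dfp := df p Wp; split.
  have [r r0 rW] := Wo p Wp.
  have /cvgrPdist_lt/(_ 1 ltr01)/nbhs_pn[s s0 sP] := differentiable_continuous dfp.
  exists (Num.min r s), (normc (f p) + 1); split; first by rewrite lt_min r0.
  move=> q; rewrite lt_min => /andP[/rW Wq /sP fpq]; split=> //.
  have -> : f q = f p - (f p - f q) by ring.
  rewrite (le_trans (normcB _ _))// lerD2l -lecR; exact: ltW.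
move=> v; have : derivable f p v by exact: diff_derivable.
move=> /cvg_ex[/= L fL]; exists L => e e0.
have e0' : 0 < e%:C by rewrite ltcR.
have := fL => /cvgrPdist_le/(_ _ e0'); rewrite near_withinE.
move=> /nbhs_pn[d d0 dP]; exists d => // h hd; rewrite add0r scale0r addr0.
have [->|h0] := eqVneq h 0.
  by rewrite scale0r addr0 subrr mulr0 subr0 normc0 mulr0.
have := dP h; rewrite subr0 => /(_ hd h0).
rewrite -[(`|_| <= _)]/((normc _)%:C <= _) lecR => H.
have -> : f (p + h *: v) - f p - L * h =
    - (L - h^-1 * (f (h *: v + p) - f p)) * h.
  by rewrite [h *: v + p]addrC; field.
by rewrite normcM normcN ler_wpM2r ?normc_ge0.
Qed.

End line_holomorphic.

(** * The identity theorem *)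

Section identity_theorem.
Variables (R : realType) (V : normedModType R[i]).
Local Notation C := R[i].
Implicit Types (u v w p q : V) (f g : V -> C) (W : set V).

Lemma holo_bd_line_eq0 f p v (s M d : R) l : 0 < s -> 0 < d ->
  holo_bd (fun l : C => f (p + l *: v)) 0 s M ->
  (forall x : R, 0 < x < d -> f (p + x%:C *: v) = 0) ->
  normc l < s / 8 -> f (p + l *: v) = 0.
Proof.
move=> s0 d0 fM f0 ls; apply: (flat_holo_eq0 s0 fM _ ls) => q.
by exists 0, d; split=> // x /f0 ->; rewrite normc0 mul0r.
Qed.

Definition locally_zero f p := exists2 r : R, 0 < r & forall q, pn (q - p) < r -> f q = 0.

Lemma locally_zero_eq0 f p : locally_zero f p -> f p = 0.
Proof. by move=> [r r0]; apply; rewrite subrr pn0. Qed.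

(** Every [p'] near [p] is [q + v] with [v] short, where [f] vanishes around [q], and the points
    [q + l *: v] with [|l| < 9] stay in the region where [f] is bounded. Vanishing for small
    positive [l] then gives vanishing for [|l| < 9 / 8], in particular at [l = 1]. *)
Lemma locally_zero_closed W f p : gholo W f -> W p ->
  (forall r : R, 0 < r -> exists2 q, pn (q - p) < r & locally_zero f q) ->
  locally_zero f p.
Proof.
move=> fW Wp near0; have [[r [M [r0 rM]]] _] := fW p Wp.
have r40 : 0 < r / 40 by rewrite divr_gt0.
have [q qp [d d0 fq0]] := near0 _ r40.
exists (r / 40) => // p' p'p.
pose v := p' - q.
have vr : pn v < r / 20.
  have -> : v = (p' - p) - (q - p) by rewrite opprB addrA subrK.
  by rewrite (le_lt_trans (pnD _ _))// pnN; clear - p'p qp; lra.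
have -> : p' = q + 1 *: v by rewrite scale1r /v addrCA subrr addr0.
have v1 := pnS_gt0 v.
have r2 : 0 < r / 2 by rewrite divr_gt0.
apply: (@holo_bd_line_eq0 f q v 9 M (d / (pn v + 1))) => //.
- exact: divr_gt0.
- apply: (@gholo_holo_bd _ _ W f q v (r / 2)) => //; first by clear - vr r0; lra.
  move=> q' q'q; apply: rM; have -> : q' - p = (q' - q) + (q - p).
    by rewrite addrA subrK.
  by rewrite (le_lt_trans (pnD _ _))//; clear - q'q qp r0; lra.
- move=> x /andP[x0]; rewrite ltr_pdivlMr// => xd; apply: fq0.
  rewrite addrAC subrr add0r pnZ normc_real gtr0_norm// (le_lt_trans _ xd)//.
  by rewrite ler_wpM2l ?lerDl// ltW.
- by rewrite normc1; clear; lra.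
Qed.

(** The parameters [t] such that [f] vanishes near [gam t] form a relatively open and closed subset
    of [D]. The parameter space is left general: it is an interval for segments, and [Om] itself for
    the slice at a fixed [zeta]. *)
Lemma locally_zero_connected (T : topologicalType) (D : set T) (gam : T -> V) W f :
  gholo W f -> connected D -> (forall t, D t -> W (gam t)) ->
  (forall t, D t -> forall r : R, 0 < r -> \forall s \near t, pn (gam s - gam t) < r) ->
  (exists2 t, D t & locally_zero f (gam t)) ->
  forall t, D t -> locally_zero f (gam t).
Proof.
move=> fW cD DW gam_cont [t0 Dt0 Zt0].
pose Z := [set t | locally_zero f (gam t)].
suff <- : D `&` Z = D by move=> t [].
apply: cD; first by exists t0.
  exists (interior Z); first exact: open_interior.
  apply/seteqP; split=> t [Dt Zt]; split=> //; last exact: interior_subset.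
  have [r r0 fr] := Zt; have r2 : 0 < r / 2 by rewrite divr_gt0.
  apply: filterS (gam_cont t Dt _ r2) => s st; exists (r / 2) => // q qs.
  apply: fr; have -> : q - gam t = (q - gam s) + (gam s - gam t).
    by rewrite addrA subrK.
  by rewrite (le_lt_trans (pnD _ _))//; clear - st qs; lra.
exists (closure (D `&` Z)); first exact: closed_closure.
apply/seteqP; split=> t [Dt Zt]; split=> //; first exact: subset_closure.
apply: (locally_zero_closed fW (DW t Dt)) => r r0.
have [s [[Ds Zs] sr]] := Zt _ (gam_cont t Dt _ r0).
by exists (gam s).
Qed.

Lemma locally_zero_segment W f p q : gholo W f ->
  (forall t : R, 0 <= t <= 1 -> W (p + t%:C *: (q - p))) ->
  locally_zero f p -> locally_zero f q.
Proof.
move=> fW pqW fp; set v := q - p.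
have <- : p + 1%:C *: v = q by rewrite scale1r addrCA subrr addr0.
apply: (@locally_zero_connected R `[0, 1]%classic (fun t : R => p + t%:C *: v) W).
- exact: fW.
- exact: segment_connected.
- by move=> t; rewrite /= in_itv /= => /pqW.
- move=> t _ r r0.
  have v1 := pnS_gt0 v.
  apply/nbhs_ballP; exists (r / (pn v + 1)); first exact: divr_gt0.
  move=> s; rewrite /ball /= distrC ltr_pdivlMr// => st.
  have -> : p + s%:C *: v - (p + t%:C *: v) = (s - t)%:C *: v.
    by rewrite opprD addrACA subrr add0r rmorphB scalerBl.
  rewrite pnZ normc_real (le_lt_trans _ st)// ler_wpM2l// lerDl//.
- exists 0; first by rewrite /= in_itv /= lexx ler01.
  by rewrite scale0r addr0.
- by rewrite /= in_itv /= lexx ler01.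
Qed.

End identity_theorem.
(** * The domains V_n *)

Section complexification.
Variables (R : realType) (k : nat).
Local Notation C := R[i].
Local Notation P := ('rV[C]_k * C)%type.
Implicit Types (p q : P) (x y : 'rV[R]_k) (z : 'rV[C]_k) (r : R).

Lemma row_norm_lt x r : 0 < r -> (forall i, `|x 0 i| < r) -> `|x| < r.
Proof.
move=> r0 xr; have : ball (0 : 'rV[R]_k) r x.
  by split=> // i j; rewrite -ball_normE /= (ord1 i) mxE sub0r normrN.
by rewrite -ball_normE /= sub0r normrN.
Qed.

Lemma row_norm_le x i : `|x 0 i| <= `|x|.
Proof.
apply/ler_addgt0Pr => e e0.
have : ball (0 : 'rV[R]_k) (`|x| + e) x by rewrite -ball_normE /= sub0r normrN ltrDl.
by move=> [_ /(_ 0 i)]; rewrite -ball_normE /= mxE sub0r normrN => /ltW.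
Qed.

Lemma pn_row_lt z r : 0 < r -> (forall i, normc (z 0 i) < r) -> pn z < r.
Proof.
move=> r0 zr; rewrite pn_lt; have : ball (0 : 'rV[C]_k) r%:C z.
  split=> [|i j]; first by rewrite ltcR.
  by rewrite -ball_normE /= (ord1 i) mxE sub0r normrN -[`|_|]/((normc _)%:C) ltcR.
by rewrite -ball_normE /= sub0r normrN.
Qed.

Lemma pn_row_le z i : normc (z 0 i) <= pn z.
Proof.
apply/ler_addgt0Pr => e e0.
have : ball (0 : 'rV[C]_k) (pn z + e)%:C z.
  by rewrite -ball_normE /= sub0r normrN -pn_lt ltrDl.
move=> [_ /(_ 0 i)]; rewrite -ball_normE /= mxE sub0r normrN.
by rewrite -[`|_|]/((normc _)%:C) ltcR => /ltW.
Qed.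

Lemma pn_pair_lt p r : pn p.1 < r -> normc p.2 < r -> pn p < r.
Proof.
move=> p1 p2; rewrite pn_lt; have : ball (0 : P) r%:C p.
  split; rewrite -ball_normE /= sub0r normrN; first by rewrite -pn_lt.
  by rewrite -[`|_|]/((normc _)%:C) ltcR.
by rewrite -ball_normE /= sub0r normrN.
Qed.

Lemma pn_fst p : pn p.1 <= pn p.
Proof.
apply/ler_addgt0Pr => e e0.
have : ball (0 : P) (pn p + e)%:C p.
  by rewrite -ball_normE /= sub0r normrN -pn_lt ltrDl.
by move=> [+ _]; rewrite -ball_normE /= sub0r normrN -pn_lt => /ltW.
Qed.

Lemma pn_snd p : normc p.2 <= pn p.
Proof.
apply/ler_addgt0Pr => e e0.
have : ball (0 : P) (pn p + e)%:C p.
  by rewrite -ball_normE /= sub0r normrN -pn_lt ltrDl.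
move=> [_]; rewrite -ball_normE /= sub0r normrN.
by rewrite -[`|_|]/((normc _)%:C) ltcR => /ltW.
Qed.

Definition RtoC x : 'rV[C]_k := map_mx (real_complex R) x.

Lemma ReV_RtoC x : ReV (RtoC x) = x.
Proof. by apply/rowP => i; rewrite !mxE. Qed.

Lemma ImV_RtoC x : ImV (RtoC x) = 0.
Proof. by apply/rowP => i; rewrite !mxE. Qed.

Lemma ReV_ImV z : z = RtoC (ReV z) + 'i%C *: RtoC (ImV z).
Proof.
apply/rowP => i; rewrite !mxE; case: (z 0 i) => a b.
by apply/eqP; rewrite eq_complex /=; apply/andP; split; apply/eqP; ring.
Qed.

Lemma ReVB z (w : 'rV[C]_k) : ReV (z - w) = ReV z - ReV w.
Proof. by apply/rowP => i; rewrite !mxE Re_sub. Qed.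

Lemma ImVB z (w : 'rV[C]_k) : ImV (z - w) = ImV z - ImV w.
Proof. by apply/rowP => i; rewrite !mxE Im_sub. Qed.

Lemma ReV_le z : `|ReV z| <= pn z.
Proof.
apply/ler_addgt0Pr => e e0; apply/ltW/row_norm_lt.
  by rewrite ltr_pwDr// pn_ge0.
move=> i; rewrite mxE (le_lt_trans (normc_Re _))// (le_lt_trans (pn_row_le _ _))//.
by rewrite ltrDl.
Qed.

Lemma ImV_le z : `|ImV z| <= pn z.
Proof.
apply/ler_addgt0Pr => e e0; apply/ltW/row_norm_lt.
  by rewrite ltr_pwDr// pn_ge0.
move=> i; rewrite mxE (le_lt_trans (normc_Im _))// (le_lt_trans (pn_row_le _ _))//.
by rewrite ltrDl.
Qed.

Lemma pn_RtoC x : pn (RtoC x) = `|x|.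
Proof.
apply/eqP; rewrite eq_le; apply/andP; split; last by have := ReV_le (RtoC x); rewrite ReV_RtoC.
apply/ler_addgt0Pr => e e0; apply/ltW/pn_row_lt; first by rewrite ltr_pwDr.
by move=> i; rewrite mxE normc_real (le_lt_trans (row_norm_le _ _))// ltrDl.
Qed.

Lemma dist_fst p q : `|ReV q.1 - ReV p.1| <= pn (q - p).
Proof. by rewrite -ReVB (le_trans (ReV_le _))//; exact: (pn_fst (q - p)). Qed.

Lemma dist_ImV p q : `|ImV q.1 - ImV p.1| <= pn (q - p).
Proof. by rewrite -ImVB (le_trans (ImV_le _))//; exact: (pn_fst (q - p)). Qed.

Lemma dist_snd p q : normc (q.2 - p.2) <= pn (q - p).
Proof. exact: (pn_snd (q - p)). Qed.

End complexification.

(** [|carg z|] is the arc cosine of the normalised real part, and the cosine decreases on [[0, pi]].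
    Both sides of the new inequality are continuous in [z], which suits arguments by openness and by
    convexity. *)
Lemma carg_lt (R : realType) (z : R[i]) (a : R) : z != 0 -> 0 <= a <= pi ->
  (`|carg z| < a) = (cos a * normc z < complex.Re z).
Proof.
move=> z0 a0pi; have nz : 0 < normc z by rewrite normc_gt0.
set x := complex.Re z / normc z.
have x1 : -1 <= x <= 1.
  by rewrite -ler_norml /x normrM normfV (gtr0_norm nz) ler_pdivrMr// mul1r normc_Re.
have -> : `|carg z| = acos x.
  by rewrite /carg; case: ifP => _; rewrite ?normrN ger0_norm// acos_ge0.
rewrite -ltr_pdivlMr// -/x -[in RHS](acosK (x := x)) ?in_itv//.
by rewrite ltr_cos ?in_itv//= acos_ge0// acos_lepi.
Qed.

Section domain.
Variables (R : realType) (k : nat) (Om : set 'rV[R]_k) (O : nat -> set 'rV[R]_k).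
Local Notation C := R[i].
Local Notation P := ('rV[C]_k * C)%type.
Implicit Types (p q : P) (x y : 'rV[R]_k) (r : R) (n : nat).
Hypotheses (oOm : open Om) (adm : admissible Om O).

Lemma open_row (A : set 'rV[R]_k) x : open A -> A x ->
  exists2 r : R, 0 < r & forall y, `|y - x| < r -> A y.
Proof.
move=> oA Ax; have /nbhs_ballP[r /= r0 rA] : nbhs x A by exact: open_nbhs_nbhs.
by exists r => // y yx; apply: rA; rewrite -ball_normE /= distrC.
Qed.

Lemma invn_le1 n : (0 < n)%N -> 0 < (n%:R^-1 : R) <= 1.
Proof. by move=> n0; rewrite invr_gt0 ltr0n n0/= invf_le1 ?ltr0n// ler1n. Qed.

Lemma O_sub n : (0 < n)%N -> O n `<=` Om.
Proof. by move=> /adm[]. Qed.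

Lemma O_decr n : (0 < n)%N -> O n.+1 `<=` O n.
Proof. by move=> /adm[]. Qed.

(* The part [A_set] of the domain with its constraint on the argument in
   polynomial form, and without the constraint [x \notin O n.+1], which has no
   effect on the union with [B_set]. *)
Lemma V_setP n p : (0 < n)%N -> V_set Om O n p <->
  [/\ Om (ReV p.1), 0 < normc p.2 < n%:R^-1,
    cos n%:R^-1 * normc p.2 < complex.Re p.2 & `|ImV p.1| < n%:R^-1 * normc p.2]
  \/ [/\ O n (ReV p.1), 0 < normc p.2 < n%:R^-1 & `|ImV p.1| < n%:R^-1].
Proof.
move=> n0; have /andP[i0 i1] := invn_le1 n0.
have npi : 0 <= (n%:R^-1 : R) <= pi.
  by rewrite (ltW i0) (le_trans i1)// (le_trans _ (pi_ge2 R))// ler1n.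
split=> [[[Op On cp np ip]|[Op np ip]]|].
- have p20 : p.2 != 0 by rewrite -normc_gt0; case/andP: np.
  left; split=> //; first by rewrite -carg_lt.
  by apply: row_norm_lt => //; rewrite mulr_gt0// normc_gt0.
- by right; split=> //; apply: row_norm_lt.
move=> [[Op np cp ip]|[Op np ip]]; last first.
  by right; split=> // i; rewrite (le_lt_trans (row_norm_le _ _)).
have p20 : p.2 != 0 by rewrite -normc_gt0; case/andP: np.
(* A point of the sector over [O n.+1] lies in [B_set] instead: [O n.+1] is contained in [O n], and
   [|zeta| < 1] makes the bound on the imaginary part stronger than the one required there. *)
have [On|On] := pselect (O n.+1 (ReV p.1)); [right|left]; split=> //.
- exact: O_decr.
- move=> i; rewrite (le_lt_trans (row_norm_le _ _))// (lt_le_trans ip)//.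
  by rewrite ler_piMr ?ltW//; case/andP: np => _ /lt_le_trans; apply.
- by rewrite carg_lt.
- by move=> i; rewrite (le_lt_trans (row_norm_le _ _)).
Qed.

Lemma V_set_open n p : (0 < n)%N -> V_set Om O n p ->
  exists2 r : R, 0 < r & forall q, pn (q - p) < r -> V_set Om O n q.
Proof.
move=> n0; have /andP[i0 i1] := invn_le1 n0.
have c1 := cos_le1 (n%:R^-1 : R); have c2 := cos_geN1 (n%:R^-1 : R).
move=> /(V_setP _ n0)[[Op /andP[np1 np2] cp ip]|[Op /andP[np1 np2] ip]].
  have [r r0 rO] := open_row oOm Op.
  (* The least slack in the strict inequalities; half of it is used because both sides of the last
     two can move with [q]. *)
  pose m := Num.min (Num.min (normc p.2) (n%:R^-1 - normc p.2))
   (Num.min (complex.Re p.2 - cos n%:R^-1 * normc p.2) (n%:R^-1 * normc p.2 - `|ImV p.1|)).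
  have m0 : 0 < m by rewrite !lt_min np1 !subr_gt0 np2 cp ip.
  exists (Num.min r (m / 2)) => [|q]; first by rewrite lt_min r0 divr_gt0.
  rewrite lt_min => /andP[qr qm].
  have : m <= m by [].
  rewrite {2}/m !le_min => /andP[/andP[m1 m2] /andP[m3 m4]].
  apply/(V_setP _ n0); left; have d1 := dist_fst p q.
  have d2 := le_lt_trans (dist_ImV p q) qm; have d3 := le_lt_trans (dist_snd p q) qm.
  have e1 : normc q.2 <= normc p.2 + normc (q.2 - p.2).
    by have := normcD p.2 (q.2 - p.2); rewrite [p.2 + _]addrC subrK.
  have e2 : normc p.2 <= normc q.2 + normc (q.2 - p.2).
    by have := normcB q.2 (q.2 - p.2); rewrite opprB [q.2 + _]addrC subrK.
  have e3 := normc_Re (q.2 - p.2); rewrite Re_sub ler_norml in e3.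
  have e5 : `|ImV q.1| <= `|ImV p.1| + `|ImV q.1 - ImV p.1|.
    by have := ler_normD (ImV p.1) (ImV q.1 - ImV p.1); rewrite [ImV p.1 + _]addrC subrK.
  case/andP: e3 => e3 _.
  split.
  - by apply: rO; rewrite (le_lt_trans d1).
  - by apply/andP; split; clear - e1 e2 d3 m1 m2 m0; lra.
  - have f1 : cos n%:R^-1 * (normc q.2 - normc p.2) <= normc (q.2 - p.2).
      rewrite (le_trans (ler_norm _))// normrM.
      have : `|cos (n%:R^-1 : R)| <= 1 by rewrite ler_norml c1 c2.
      move=> h; rewrite -[leRHS]mul1r; apply: ler_pM => //.
      by rewrite ler_norml; apply/andP; split; clear - e1 e2; lra.
    by clear - f1 e3 d3 m3; lra.
  - have f1 : n%:R^-1 * (normc p.2 - normc q.2) <= normc (q.2 - p.2).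
      rewrite (le_trans (ler_norm _))// normrM (gtr0_norm i0) -[leRHS]mul1r.
      apply: ler_pM => //.
      by rewrite ler_norml; apply/andP; split; clear - e1 e2; lra.
    by clear - f1 e5 d2 d3 m4; lra.
have [oOn _ _ _ _] := adm n0.
have [r r0 rO] := open_row oOn Op.
pose m := Num.min (Num.min (normc p.2) (n%:R^-1 - normc p.2)) (n%:R^-1 - `|ImV p.1|).
have m0 : 0 < m by rewrite !lt_min np1 !subr_gt0 np2 ip.
exists (Num.min r (m / 2)) => [|q]; first by rewrite lt_min r0 divr_gt0.
rewrite lt_min => /andP[qr qm].
have : m <= m by [].
rewrite {2}/m !le_min => /andP[/andP[m1 m2] m4].
apply/(V_setP _ n0); right; have d1 := dist_fst p q.
have d2 := le_lt_trans (dist_ImV p q) qm; have d3 := le_lt_trans (dist_snd p q) qm.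
have e1 : normc q.2 <= normc p.2 + normc (q.2 - p.2).
  by have := normcD p.2 (q.2 - p.2); rewrite [p.2 + _]addrC subrK.
have e2 : normc p.2 <= normc q.2 + normc (q.2 - p.2).
  by have := normcB q.2 (q.2 - p.2); rewrite opprB [q.2 + _]addrC subrK.
have e5 : `|ImV q.1| <= `|ImV p.1| + `|ImV q.1 - ImV p.1|.
  by have := ler_normD (ImV p.1) (ImV q.1 - ImV p.1); rewrite [ImV p.1 + _]addrC subrK.
split.
- by apply: rO; rewrite (le_lt_trans d1).
- by apply/andP; split; clear - e1 e2 d3 m1 m2 m0; lra.
- by clear - d2 e5 m4 m0; lra.
Qed.

(** The condition that [x] lies outside [O n.+1] weakens as [n] grows, so the sets [A_set] by
    themselves need not decrease. In the description [V_setP] every condition is monotone. *)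
Lemma V_set_decr n m : (0 < n)%N -> (n <= m)%N -> V_set Om O m `<=` V_set Om O n.
Proof.
move=> n0; elim: m => [|m IH]; first by rewrite leqn0 => /eqP ->.
rewrite leq_eqVlt => /predU1P[->|nm]; first exact: subset_refl.
move=> p Vp; apply: (IH nm).
have m0 : (0 < m)%N by exact: (leq_trans n0 (nm : (n <= m)%N)).
have /andP[i0 i1] := invn_le1 m0; have /andP[j0 j1] := invn_le1 (ltn0Sn m).
have ij : m.+1%:R^-1 <= m%:R^-1 :> R by rewrite lef_pV2 ?posrE ?ltr0n// ler_nat.
have pi2 := pi_ge2 R.
apply/(V_setP _ m0); move: Vp => /(V_setP _ (ltn0Sn m))[[Op /andP[np1 np2] cp ip]|[Op /andP[np1 np2] ip]].
  left; split=> //; first by rewrite np1 (lt_le_trans np2).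
    apply: le_lt_trans cp; rewrite ler_pM2r// leNgt ltr_cos ?in_itv/= -?leNgt//.
      by rewrite (ltW i0) (le_trans i1)// (le_trans _ pi2)// ler1n.
    by rewrite (ltW j0) (le_trans j1)// (le_trans _ pi2)// ler1n.
  by rewrite (lt_le_trans ip)// ler_pM2r.
right; split; last 2 first.
- by rewrite np1 (lt_le_trans np2).
- exact: lt_le_trans ip _.
exact: O_decr.
Qed.

(** This is the room available around real points over the whole of [Om], inside [O n] or not. It
    shrinks linearly with [xi], which fixes the radii in the moderate estimates. *)
Lemma V_set_thin n p (xi : R) : (0 < n)%N -> Om (ReV p.1) -> p.2 = xi%:C ->
  0 < xi < n%:R^-1 -> `|ImV p.1| < n%:R^-1 * xi -> V_set Om O n p.
Proof.
move=> n0 Op p2 /andP[x0 x1] ip; have /andP[i0 i1] := invn_le1 n0.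
apply/(V_setP _ n0); left; rewrite p2 normc_real gtr0_norm// x0; split=> //.
rewrite gtr_pMl// -[ltRHS](@cos0 R) ltr_cos ?in_itv//=.
  by rewrite lexx pi_ge0.
by rewrite (ltW i0) (le_trans i1)// (le_trans _ (pi_ge2 R))// ler1n.
Qed.

Lemma V_set_real n x (xi : R) : (0 < n)%N -> Om x -> 0 < xi < n%:R^-1 ->
  V_set Om O n (RtoC x, xi%:C).
Proof.
move=> n0 Ox xin; apply: (@V_set_thin n (RtoC x, xi%:C) xi) => //; first by rewrite ReV_RtoC.
have /andP[i0 _] := invn_le1 n0.
by rewrite ImV_RtoC normr0 mulr_gt0//; case/andP: xin.
Qed.

End domain.

(** * Vanishing of flat holomorphic functions on V_n *)

Lemma V_set_B (R : realType) (k : nat) (Om : set 'rV[R]_k)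
    (O : nat -> set 'rV[R]_k) (m : nat) x (z : R[i]) :
  admissible Om O -> (0 < m)%N ->
  O m x -> 0 < normc z < m%:R^-1 -> V_set Om O m (RtoC x, z).
Proof.
move=> adm m0 Ox zm; apply/(V_setP adm _ m0); right; rewrite /= ReV_RtoC ImV_RtoC normr0.
by split=> //; have /andP[] := @invn_le1 R m m0.
Qed.

(** The properties retained of the difference of two elements of the inductive limit with the same
    image: holomorphy, growth of order at most [m] in [1 / zeta], and flatness over each real
    point. *)
Definition flat_on (R : realType) (k : nat) (Om : set 'rV[R]_k)
    (O : nat -> set 'rV[R]_k) (m : nat) (f : 'rV[R[i]]_k * R[i] -> R[i]) :=
  [/\ gholo (V_set Om O m) f,
      exists Phi : 'rV[R]_k -> R, forall p, V_set Om O m p ->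
        normc (f p) <= Phi (ReV p.1) / normc p.2 ^+ m &
      forall x, Om x -> flat (fun z => f (RtoC x, z))].

(* The pole of [f (x, .)] at [0] has order at most [m], so multiplying by
   [z ^+ m.+2] makes it differentiable there. *)
Lemma flat_on_real (R : realType) (k : nat) (Om : set 'rV[R]_k)
    (O : nat -> set 'rV[R]_k) (m : nat)
    f x (z : R[i]) :
  admissible Om O -> (0 < m)%N -> flat_on Om O m f ->
  O m x -> 0 < normc z < m%:R^-1 / 8 ->
  f (RtoC x, z) = 0.
Proof.
move=> adm m0 [fV [Phi f_le] f_flat] Ox /andP[z0 zm].
have /andP[i0 i1] := @invn_le1 R m m0.
pose G (w : R[i]) := w ^+ m.+2 * f (RtoC x, w).
have G_le w : normc w < m%:R^-1 -> normc (G w) <= `|Phi x| * normc w ^+ 2.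
  move=> wm; rewrite /G normcM normcX; have [->|w0] := eqVneq w 0.
    by rewrite normc0 !expr0n/= mul0r mulr0.
  have nw : 0 < normc w by rewrite normc_gt0.
  have := f_le _ (V_set_B (z := w) adm m0 Ox _); rewrite nw wm => /(_ isT).
  rewrite /= ReV_RtoC ler_pdivlMr ?exprn_gt0// => H.
  rewrite -addn2 exprD mulrAC ler_wpM2r ?exprn_ge0 ?normc_ge0// mulrC.
  by rewrite (le_trans H)// ler_norm.
have line (w : R[i]) : (RtoC x, 0) + w *: (0, 1) = (RtoC x, w) :> 'rV[R[i]]_k * R[i].
  by congr pair; rewrite /= ?scaler0 ?addr0// add0r [w *: 1]mulr1.
have GM : holo_bd G 0 m%:R^-1 `|Phi x|.
  move=> w; rewrite subr0 => wm; split; last first.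
    apply: le_trans (G_le w wm) _; rewrite ler_piMr//.
    by rewrite exprn_ile1 ?normc_ge0// (le_trans (ltW wm)).
  have [->|w0] := eqVneq w 0.
    exists 0 => e e0; have c1 : 0 < `|Phi x| + 1 by rewrite ltr_pwDr.
    exists (Num.min m%:R^-1 (e / (`|Phi x| + 1))) => [|h].
      by rewrite lt_min i0 divr_gt0.
    rewrite lt_min ltr_pdivlMr// => /andP[hm he].
    rewrite add0r {2}/G exprS !mul0r !subr0 (le_trans (G_le h hm))//.
    rewrite expr2 mulrA ler_wpM2r ?normc_ge0// mulrC (le_trans _ (ltW he))//.
    by rewrite ler_wpM2l ?normc_ge0// lerDl.
  have [L wL] := cderivX m.+2 w.
  have Vw : V_set Om O m ((RtoC x, 0) + w *: (0, 1)).
    by rewrite line; apply: V_set_B => //; rewrite normc_gt0 w0.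
  eexists; apply: cderivM wL _.
  apply: cderiv_near ltr01 _ (gholo_line fV Vw) => h _; rewrite /= line//.
have Gf : flat G.
  have Omx : Om x by apply: (O_sub adm m0).
  move=> q; have [c [d [d0 dP]]] := f_flat _ Omx q.
  exists c, (Num.min d 1); split; first by rewrite lt_min d0 ltr01.
  move=> t; rewrite lt_min => /and3P[t0 td t1].
  have := dP t; rewrite t0 td => /(_ isT); apply: le_trans.
  rewrite /G normcM ler_piMl ?normc_ge0// normcX normc_real gtr0_norm//.
  by rewrite exprn_ile1// ltW.
have /eqP := flat_holo_eq0 i0 GM Gf zm.
by rewrite mulf_eq0 expf_eq0 /= -normc_eq0 gt_eqF//= => /eqP.
Qed.

(* [f] vanishes at [b + c *: v] for small real [c], with [b] and [v] the real
   and imaginary parts, hence also at [b + 'i *: v]. *)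
Lemma flat_on_locally_zero (R : realType) (k : nat) (Om : set 'rV[R]_k)
    (O : nat -> set 'rV[R]_k) (m : nat)
    f x (z : R[i]) :
  open Om -> admissible Om O -> (0 < m)%N -> flat_on Om O m f ->
  O m x -> 0 < normc z < m%:R^-1 / 8 ->
  locally_zero f (RtoC x, z).
Proof.
move=> oOm adm m0 fflat Ox zm; set p := (RtoC x, z).
have [fV _ _] := fflat.
have /andP[i0 i1] := @invn_le1 R m m0.
have Vp : V_set Om O m p.
  apply: (V_set_B adm) => //; case/andP: zm => -> /lt_trans; apply.
  by clear - i0; lra.
have [[r [M [r0 rM]]] _] := fV _ Vp.
have [oOn _ _ _ _] := adm m m0.
have [s s0 sO] := open_row oOn Ox.
case/andP: zm => z1 z2.
(* [r / 40] keeps the points [b + l *: v] with [|l| < 9] in the region where [f] is bounded, [s / 2]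
   keeps the real points [ReV q.1 + c *: ImV q.1] in [O m], and the last two terms keep [q.2] in the
   punctured disc of radius [m^-1 / 8]. *)
pose t := Num.min (Num.min (r / 40) (s / 2)) (Num.min (normc z) (m%:R^-1 / 8 - normc z)).
have t0 : 0 < t by rewrite !lt_min !divr_gt0// z1 subr_gt0 z2.
exists t => // q; rewrite !lt_min => /andP[/andP[qr qs] /andP[qz1 qz2]].
pose b : 'rV[R[i]]_k * R[i] := (RtoC (ReV q.1), q.2); pose v : 'rV[R[i]]_k * R[i] := (RtoC (ImV q.1), 0).
have bv (l : R[i]) : b + l *: v = (RtoC (ReV q.1) + l *: RtoC (ImV q.1), q.2).
  by congr pair; rewrite /= scaler0 addr0.
have qE : q = b + 'i%C *: v by rewrite bv -ReV_ImV; case: (q).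
have d1 := dist_fst p q; have d2 := dist_ImV p q; have d3 := dist_snd p q.
rewrite /= ReV_RtoC in d1; rewrite /= ImV_RtoC subr0 in d2.
have pv : pn v <= pn (q - p).
  apply: le_trans d2; rewrite -pn_RtoC; apply/ler_addgt0Pr => e e0.
  apply/ltW/pn_pair_lt; first by rewrite ltrDl.
  by rewrite -[v.2]/(0 : R[i]) normc0 ltr_pwDr// pn_ge0.
have pb : pn (b - p) <= pn (q - p).
  apply/ler_addgt0Pr => e e0; apply/ltW/pn_pair_lt.
    have -> : (b - p).1 = RtoC (ReV q.1 - x) by apply/rowP => i; rewrite !mxE rmorphB.
    by rewrite pn_RtoC (le_lt_trans d1)// ltrDl.
  by rewrite (le_lt_trans d3)// ltrDl.
have r2 : 0 < r / 2 by rewrite divr_gt0.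
have v1 := pnS_gt0 v.
have q2b : 0 < normc q.2 < m%:R^-1 / 8.
  have e1 : normc q.2 <= normc z + normc (q.2 - z).
    by have := normcD z (q.2 - z); have -> : z + (q.2 - z) = q.2 by ring.
  have e2 : normc z <= normc q.2 + normc (q.2 - z).
    by have := normcB q.2 (q.2 - z); have -> : q.2 - (q.2 - z) = z by ring.
  by rewrite /= in d3; apply/andP; split; clear - e1 e2 d3 qz1 qz2; lra.
rewrite qE.
apply: (@holo_bd_line_eq0 R _ f b v 9 M (s / 2 / (pn v + 1))) => //.
- by rewrite !divr_gt0.
- apply: (gholo_holo_bd fV _ r2); first by clear - pv qr r0; lra.
  move=> q' q'b; apply: rM; have -> : q' - p = (q' - b) + (b - p).
    by rewrite addrA subrK.
  by rewrite (le_lt_trans (pnD _ _))//; clear - q'b pb qr r0; lra.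
- move=> c /andP[c0]; rewrite ltr_pdivlMr// => cs.
  rewrite bv; have -> : RtoC (ReV q.1) + c%:C *: RtoC (ImV q.1) =
      RtoC (ReV q.1 + c *: ImV q.1).
    by apply/rowP => i; rewrite !mxE rmorphD rmorphM.
  apply: (flat_on_real adm m0 fflat) => //; apply: sO.
  rewrite addrAC (le_lt_trans (ler_normD _ _))// normrZ gtr0_norm//.
  have cv : c * `|ImV q.1| <= c * (pn v + 1).
    apply: ler_wpM2l; first exact: ltW.
    by rewrite -pn_RtoC (le_trans (pn_fst v))// lerDl.
  by clear - cv cs d1 qs s0; lra.
- have -> : normc ('i%C : R[i]) = 1 by rewrite /= expr0n expr1n add0r sqrtr1.
  by clear; lra.
Qed.

Lemma pair_segment (R : realType) (k : nat) (z z' : 'rV[R[i]]_k) (w w' t : R[i]) :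
  (z, w) + t *: ((z', w') - (z, w)) = (z + t *: (z' - z), w + t * (w' - w)).
Proof. by []. Qed.

(** Local vanishing travels in three kinds of moves: over [Om] at the fixed height [zeta = xi], by
    connectedness; in [zeta] over a fixed real point; and in the imaginary part of [z], along a
    segment that stays in the domain because shrinking [ImV] preserves its conditions. *)
Lemma V_set_uniqueness (R : realType) (k : nat) (Om : set 'rV[R]_k)
    (O : nat -> set 'rV[R]_k) (m : nat) f p :
  open Om -> connected Om -> admissible Om O -> (0 < m)%N -> flat_on Om O m f ->
  V_set Om O m p -> f p = 0.
Proof.
move=> oOm cOm adm m0 fflat.
have [fV _ _] := fflat; have /andP[i0 i1] := @invn_le1 R m m0.
pose xi : R := m%:R^-1 / 16.
have xi0 : 0 < xi by rewrite divr_gt0.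
have xi_m : 0 < xi < m%:R^-1 by rewrite xi0 /xi; clear - i0; lra.
have xi_8 : 0 < normc xi%:C < m%:R^-1 / 8.
  by rewrite normc_real gtr0_norm// xi0 /xi; clear - i0; lra.
have dRtoC x y (z : R[i]) : pn ((RtoC x, z) - (RtoC y, z) : 'rV[R[i]]_k * R[i]) <= `|x - y|.
  apply/ler_addgt0Pr => e e0; apply/ltW/pn_pair_lt.
    have -> : ((RtoC x, z) - (RtoC y, z) : 'rV[R[i]]_k * R[i]).1 = RtoC (x - y).
      by apply/rowP => i; rewrite !mxE rmorphB.
    by rewrite pn_RtoC ltrDl.
  have -> : ((RtoC x, z) - (RtoC y, z) : 'rV[R[i]]_k * R[i]).2 = 0 by exact: subrr.
  by rewrite normc0 ltr_pwDr.
have Om0 x : Om x -> locally_zero f (RtoC x, xi%:C).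
  apply: (locally_zero_connected (gam := fun x => (RtoC x, xi%:C)) fV cOm).
  - by move=> y Oy; exact: (V_set_real adm).
  - move=> y _ r r0; apply/nbhs_ballP; exists r => // y'.
    rewrite -ball_normE /= distrC; apply: le_lt_trans; exact: dRtoC.
  - have [_ [x0 Ox0] _ _ _] := adm m m0; exists x0; first exact: (O_sub adm m0).
    exact: (flat_on_locally_zero oOm adm m0 fflat).
move=> Vp; apply: locally_zero_eq0.
suff base : locally_zero f (RtoC (ReV p.1), p.2).
  apply: (locally_zero_segment fV _ base) => t /andP[t0 t1].
  have -> : (RtoC (ReV p.1), p.2) + t%:C *: (p - (RtoC (ReV p.1), p.2)) =
      (RtoC (ReV p.1) + 'i%C *: RtoC (t *: ImV p.1), p.2).
    rewrite [X in X - _]surjective_pairing pair_segment subrr mulr0 addr0.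
    apply/eqP; rewrite xpair_eqE eqxx andbT; apply/eqP.
    rewrite {2}(ReV_ImV p.1) [X in _ *: (X - _)]addrC addrK.
    by congr (_ + _); apply/rowP => i; rewrite !mxE rmorphM mulrCA.
  have rE : ReV (RtoC (ReV p.1) + 'i%C *: RtoC (t *: ImV p.1)) = ReV p.1.
    by apply/rowP => i; rewrite !mxE /=; ring.
  have iE : ImV (RtoC (ReV p.1) + 'i%C *: RtoC (t *: ImV p.1)) = t *: ImV p.1.
    by apply/rowP => i; rewrite !mxE /=; ring.
  have tle : `|t *: ImV p.1| <= `|ImV p.1|.
    by rewrite normrZ ger0_norm// ler_piMl.
  apply/(V_setP adm _ m0); rewrite /= rE iE.
  move: Vp => /(V_setP adm _ m0)[[? ? ? ?]|[? ? ?]]; [left|right]; split=> //.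
    exact: le_lt_trans tle _.
  exact: le_lt_trans tle _.
have cP (t : R) : 0 <= t -> t < 1 -> normc (t%:C) = t.
  by move=> t0 _; rewrite normc_real ger0_norm.
move: Vp => /(V_setP adm _ m0)[[Op /andP[np1 np2] cp ip]|[Op /andP[np1 np2] ip]].
  apply: (locally_zero_segment fV _ (Om0 _ Op)) => t /andP[t0 t1].
  pose w : R[i] := (1 - t)%:C * xi%:C + t%:C * p.2.
  have -> : (RtoC (ReV p.1), xi%:C) + t%:C *: ((RtoC (ReV p.1), p.2) - (RtoC (ReV p.1), xi%:C)) =
      (RtoC (ReV p.1), w).
    rewrite pair_segment subrr scaler0 addr0; congr pair.
    by rewrite /w rmorphB /=; ring.
  have t1' : 0 <= 1 - t by rewrite subr_ge0.
  have nw : normc w <= (1 - t) * xi + t * normc p.2.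
    rewrite (le_trans (normcD _ _))// !normcM !normc_real.
    by rewrite !ger0_norm// ltW.
  have Rw : complex.Re w = (1 - t) * xi + t * complex.Re p.2.
    by rewrite /w Re_add; case: (p.2) => a b /=; ring.
  have c1 : cos (m%:R^-1 : R) < 1.
    rewrite -[ltRHS](@cos0 R) ltr_cos ?in_itv//=; first by rewrite lexx pi_ge0.
    by rewrite (ltW i0) (le_trans i1)// (le_trans _ (pi_ge2 R))// ler1n.
  (* Nonnegativity of this cosine makes the sector convex; it holds because
     [m^-1 <= 1 <= pi / 2]. *)
  have c0 : 0 <= cos (m%:R^-1 : R).
    apply: cos_ge0_pihalf; have H := pi_ge2 R.
    by apply/andP; split; clear - i0 i1 H; lra.
  have [xi1 xi2] := andP xi_m.
  have cw : cos m%:R^-1 * normc w < complex.Re w.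
    rewrite Rw (le_lt_trans (ler_wpM2l c0 nw))// mulrDr.
    have h1 : cos m%:R^-1 * ((1 - t) * xi) <= (1 - t) * xi.
      by apply: ler_piMl; [apply: mulr_ge0 => //; exact: ltW|exact: ltW].
    have [->|tn0] := eqVneq t 0.
      by rewrite subr0 !mul0r mulr0 !addr0 mul1r gtr_pMl.
    have tp : 0 < t by rewrite lt_neqAle eq_sym tn0.
    by rewrite ler_ltD// mulrCA ltr_pM2l.
  have w0 : 0 < normc w.
    apply: lt_le_trans (le_trans (ler_norm _) (normc_Re w)).
    by apply: le_lt_trans cw; apply: mulr_ge0 => //; exact: normc_ge0.
  apply/(V_setP adm _ m0); left; rewrite /= ReV_RtoC ImV_RtoC normr0; split=> //.
    rewrite w0 (le_lt_trans nw)//.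
    have [->|tn0] := eqVneq t 0; first by rewrite subr0 mul0r addr0 mul1r.
    have tp : 0 < t by rewrite lt_neqAle eq_sym tn0.
    have := ler_wpM2l t1' (ltW xi2); have : t * normc p.2 < t * m%:R^-1 by rewrite ltr_pM2l.
    by clear; lra.
  by rewrite mulr_gt0.
(* Over [O m] a segment from [xi] to [zeta] might meet [0]. The base point is [zeta / 16] instead,
   on the same ray and within [m^-1 / 8] of [0]. *)
have Vb : locally_zero f (RtoC (ReV p.1), (16^-1)%:C * p.2).
  apply: (flat_on_locally_zero oOm adm m0 fflat) => //; rewrite normcM normc_real gtr0_norm//.
  by apply/andP; split; clear - np1 np2; lra.
apply: (locally_zero_segment fV _ Vb) => t /andP[t0 t1].
have -> : (RtoC (ReV p.1), (16^-1)%:C * p.2) +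
    t%:C *: ((RtoC (ReV p.1), p.2) - (RtoC (ReV p.1), (16^-1)%:C * p.2)) =
    (RtoC (ReV p.1), (16^-1 + t * (1 - 16^-1))%:C * p.2).
  rewrite pair_segment subrr scaler0 addr0; congr pair.
  by rewrite rmorphD rmorphM rmorphB rmorph1; ring.
apply: V_set_B => //; rewrite normcM normc_real.
have s0 : 0 < 16^-1 + t * (1 - 16^-1) :> R by clear - t0; lra.
have s1 : 16^-1 + t * (1 - 16^-1) <= 1 :> R by clear - t1; lra.
by rewrite gtr0_norm// mulr_gt0//= (le_lt_trans _ np2)// ler_piMl// normc_ge0.
Qed.

(** * Smooth functions and cutoffs *)

Section Cn.
Variables (R : realType) (k : nat).
Local Notation X := ('rV[R]_k * R)%type.
Implicit Types (g h : X -> R) (W : set X) (p : X) (m : nat).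

Lemma Cn_subset m W W' g : W' `<=` W -> Cn_on m W g -> Cn_on m W' g.
Proof.
move=> W'W; elim: m g => [|m IH] g [gc gd]; split=> //; try by move=> p /W'W/gc.
by move=> o; have [d c] := gd o; split; [move=> p /W'W/d|exact: IH].
Qed.

Lemma Cn_le m W g : Cn_on m.+1 W g -> Cn_on m W g.
Proof.
elim: m g => [|m IH] g [gc gd]; split=> // o.
by have [d c] := gd o; split=> //; exact: IH.
Qed.

Lemma Cn_setU m W W' g : Cn_on m W g -> Cn_on m W' g -> Cn_on m (W `|` W') g.
Proof.
elim: m g => [|m IH] g [gc gd] [gc' gd'].
  by split=> // p [/gc|/gc'].
split=> [p [/gc|/gc']//|o]; have [d c] := gd o; have [d' c'] := gd' o.
by split; [move=> p [/d|/d']|exact: IH].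
Qed.

Lemma Cn_eq m W g h : open W -> (forall p, W p -> g p = h p) ->
  Cn_on m W g -> Cn_on m W h.
Proof.
move=> oW; elim: m g h => [|m IH] g h gh [gc gd].
all: have near_gh p : W p -> \forall q \near p, g q = h q
  by move=> Wp; apply: filterS gh _; exact: open_nbhs_nbhs.
all: have hc p : W p -> {for p, continuous h}
  by move=> Wp; change (h q @[q --> p] --> h p); rewrite -(gh p Wp); apply: cvg_trans (gc p Wp);
     apply: near_eq_cvg; exact: near_gh.
  by [].
split=> // o; have [d c] := gd o; split.
  by move=> p Wp; apply: near_eq_derivable (d p Wp); exact: near_gh.
by apply: IH c => p Wp; apply: near_eq_derive; exact: near_gh.
Qed.

Lemma Cn_cst m W (c : R) : Cn_on m W (fun=> c).
Proof.
elim: m c => [|m IH] c; (split; first by move=> p _; exact: cvg_cst) => // o.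
split=> [p _|]; first exact: derivable_cst.
suff -> : (fun p => 'D_(basis_vec R o) (fun=> c) p) = (fun=> 0 : R).
  exact: IH.
by apply/funext => p; exact: derive_cst.
Qed.

Lemma Cn_add m W g h : open W -> Cn_on m W g -> Cn_on m W h ->
  Cn_on m W (fun p => g p + h p).
Proof.
move=> oW; elim: m g h => [|m IH] g h [gc gd] [hc hd].
all: have c p : W p -> {for p, continuous (fun p => g p + h p)}
  by move=> Wp; apply: continuousD; [exact: gc|exact: hc].
  by [].
split=> // o; have [d1 c1] := gd o; have [d2 c2] := hd o; split.
  by move=> p Wp; apply: derivableD; [exact: d1|exact: d2].
apply: (Cn_eq oW _ (IH _ _ c1 c2)) => p Wp.
by rewrite -deriveD//; [exact: d1|exact: d2].
Qed.

Lemma Cn_mul m W g h : open W -> Cn_on m W g -> Cn_on m W h ->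
  Cn_on m W (fun p => g p * h p).
Proof.
move=> oW; elim: m g h => [|m IH] g h gC hC.
  split=> // p Wp; apply: continuousM; [exact: gC.1|exact: hC.1].
have [gc gd] := gC; have [hc hd] := hC.
split=> [p Wp|o]; first by apply: continuousM; [exact: gc|exact: hc].
have [d1 c1] := gd o; have [d2 c2] := hd o; split.
  by move=> p Wp; apply: derivableM; [exact: d1|exact: d2].
have c := Cn_add oW (IH _ _ (Cn_le gC) c2) (IH _ _ (Cn_le hC) c1).
apply: (Cn_eq oW _ c) => p Wp.
by rewrite deriveM//; [exact: d1|exact: d2].
Qed.

Lemma Cn_opp m W g : open W -> Cn_on m W g -> Cn_on m W (fun p => - g p).
Proof.
move=> oW gC; apply: (Cn_eq oW _ (Cn_mul oW (Cn_cst m W (-1)) gC)) => p _.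
by rewrite mulN1r.
Qed.

Lemma Cn_inv m W g : open W -> (forall p, W p -> g p != 0) -> Cn_on m W g ->
  Cn_on m W (fun p => (g p)^-1).
Proof.
move=> oW g0; elim: m => [|m IH] gC.
  by split=> // p Wp; apply: continuousV; [exact: g0|exact: gC.1].
have [gc gd] := gC.
split=> [p Wp|o]; first by apply: continuousV; [exact: g0|exact: gc].
have [d c] := gd o; split.
  by move=> p Wp; apply: derivableV; [exact: g0|exact: d].
have iC := IH (Cn_le gC).
apply: (Cn_eq oW _ (Cn_mul oW (Cn_opp oW (Cn_mul oW iC iC)) c)) => p Wp.
rewrite deriveV ?g0//; last exact: d.
by rewrite /GRing.scale /= -invfM expr2.
Qed.

Lemma is_derive_snd (u : R -> R) (l : R) p o : is_derive p.2 1 u l ->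
  is_derive p (basis_vec R o) (fun q : X => u q.2) (l * (basis_vec R o).2).
Proof.
move=> ul; apply: is_derive_eps => e e0.
have [d d0 dP] := is_derive1_eps ul e0; exists d => // h hd.
case: o => [i|] /=.
  by rewrite [h *: 0]mulr0 addr0 mulr0 mulr0 !subrr normr0 mulr_ge0// ltW.
by rewrite [h *: 1]mulr1 mulr1 [h * l]mulrC; exact: dP.
Qed.

(** Regularity is proved for a whole family at once: if the derivatives [du i] are as regular as the
    family [u], every member gains one order at each step of the induction. *)
Lemma Cn_snd (I : Type) (u du : I -> R -> R) :
  (forall i (x : R), is_derive x 1 (u i) (du i x)) ->
  (forall m, (forall i, Cn_on m setT (fun p : X => u i p.2)) ->
    forall i, Cn_on m setT (fun p : X => du i p.2)) ->
  forall m i, Cn_on m setT (fun p : X => u i p.2).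
Proof.
move=> ud duC.
have uc i p : {for p, continuous (fun p : X => u i p.2)}.
  apply: (@continuous_comp _ _ _ snd (u i)); first exact: cvg_snd.
  by apply/differentiable_continuous/derivable1_diffP; have [] := ud i p.2.
elim=> [|m IH] i; first by split=> // p _; exact: uc.
split=> [p _|o]; first exact: uc.
have D p := @is_derive_snd (u i) (du i p.2) p o (ud i p.2).
split; first by move=> p _; have [] := D p.
have c := Cn_mul openT (duC m IH i) (Cn_cst m setT (basis_vec R o).2).
by apply: (Cn_eq openT _ c) => p _; have [_ ->] := D p.
Qed.

End Cn.

(** * Smooth cutoff functions *)

Section cutoff.
Variable R : realType.
Implicit Types (x : R) (j n : nat).

(** The index [j] records the powers of [1 / x] that appear when [exp (- 1 / x)] is differentiated;
    linear combinations of this family are stable under differentiation. *)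
Definition flat_exp j x : R := if 0 < x then x ^- j * expR (- x^-1) else 0.

Lemma flat_exp_ge0 j x : 0 <= flat_exp j x.
Proof.
by rewrite /flat_exp; case: ifPn => // x0; rewrite mulr_ge0 ?expR_ge0 ?invr_ge0 ?exprn_ge0 ?ltW.
Qed.

Lemma flat_exp_gt0 j x : 0 < x -> 0 < flat_exp j x.
Proof.
by move=> x0; rewrite /flat_exp x0 mulr_gt0 ?expR_gt0 ?invr_gt0 ?exprn_gt0.
Qed.

Lemma flat_exp_le0 j x : x <= 0 -> flat_exp j x = 0.
Proof. by move=> x0; rewrite /flat_exp ltNge x0. Qed.

(** For positive [x] this comes from [y ^+ n / n! <= expR y] at [y = x^-1] with [n = j + 2]. The
    square on the right makes the derivative at [0] vanish. *)
Lemma flat_exp_le j x : flat_exp j x <= (j.+2)`!%:R * x ^+ 2.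
Proof.
rewrite /flat_exp; case: ifPn => [x0|_]; last first.
  by rewrite mulr_ge0 ?sqr_ge0.
have y0 : 0 < x^-1 by rewrite invr_gt0.
have f0 : 0 < (j.+2)`!%:R :> R by rewrite ltr0n fact_gt0.
have e1 : x^-1 ^+ j.+2 / (j.+2)`!%:R <= expR x^-1.
  by apply: le_trans (expR_ge1Dxn j.+1 (ltW y0)); rewrite lerDr.
rewrite expRN ler_pdivrMr ?expR_gt0//.
have -> : x ^- j = (j.+2)`!%:R * x ^+ 2 * (x^-1 ^+ j.+2 / (j.+2)`!%:R).
  have -> : x^-1 ^+ j.+2 = (x ^+ j)^-1 * (x ^+ 2)^-1.
    by rewrite -invfM -exprD addn2 exprVn.
  by field; rewrite !gt_eqF ?exprn_gt0.
apply: ler_wpM2l => //; apply: mulr_ge0; [exact: ltW|exact: sqr_ge0].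
Qed.

Lemma is_derive_flat_exp j x :
  is_derive x 1 (flat_exp j) (flat_exp j.+2 x - j%:R * flat_exp j.+1 x).
Proof.
have [x0|x0|->] := ltgtP x 0.
- rewrite !flat_exp_le0 ?ltW// mulr0 subr0.
  apply: near_eq_is_derive (is_derive_cst (0 : R) x 1).
  near=> y; rewrite flat_exp_le0// ltW//; near: y; exact: lt_nbhsl.
- have xn0 : x != 0 by rewrite gt_eqF.
  have dV : is_derive x 1 (fun y : R => y^-1) (- x ^- 2).
    have did : derivable (fun y : R => y) x 1 by exact: (@derivable_id R R x 1).
    apply: DeriveDef; first exact: derivableV.
    by rewrite deriveV// derive_id /GRing.scale /= mulr1.
  pose w (u : R) := u ^+ j * expR (- u).
  have dw (u : R) : is_derive u 1 w ((j%:R * u ^+ j.-1 - u ^+ j) * expR (- u)).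
    have dX : is_derive u 1 (fun u : R => u ^+ j) (j%:R * u ^+ j.-1).
      apply: DeriveDef; first exact: exprn_derivable.
      by rewrite exp_derive /GRing.scale /= mulr1.
    by apply: is_derive_eq; rewrite /GRing.scale /=; ring.
  have := @is_derive1_comp R w (fun y : R => y^-1) x _ _ (dw _) dV.
  move=> dc; apply: near_eq_is_derive.
    near=> y.
    have y0 : 0 < y by near: y; exact: lt_nbhsr.
    rewrite /flat_exp y0 -exprVn; reflexivity.
  apply: is_derive_eq dc _; rewrite /flat_exp x0 /GRing.scale /=.
  case: (j) => [|j']; first by rewrite !expr0 /=; field.
  by rewrite [j'.+1.-1]/= -!exprVn !exprS expr0; ring.
- rewrite !flat_exp_le0// mulr0 subr0.
  apply: is_derive_eps => e e0.
  have c0 : 0 < (j.+2)`!%:R :> R by rewrite ltr0n fact_gt0.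
  exists (e / (j.+2)`!%:R) => [|h]; first exact: divr_gt0.
  rewrite ltr_pdivlMr// => he; rewrite add0r [h *: 1]mulr1 mulr0 subr0.
  rewrite (flat_exp_le0 j (lexx 0)) subr0 ger0_norm ?flat_exp_ge0//.
  rewrite (le_trans (flat_exp_le _ _))// -real_normK ?num_real// expr2 mulrA.
  by rewrite ler_wpM2r// mulrC ltW.
Unshelve. all: by end_near. Qed.

Lemma Cn_flat_exp (k m j : nat) (a b : R) :
  Cn_on m setT (fun p : 'rV[R]_k * R => flat_exp j (a + b * p.2)).
Proof.
pose u j x := flat_exp j (a + b * x).
pose du j x := b * (u j.+2 x - j%:R * u j.+1 x).
apply: (@Cn_snd R k nat u du).
  move=> i x; have dl : is_derive x 1 (fun x : R => a + b * x) b.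
    by apply: is_derive_eq; rewrite /GRing.scale /=; ring.
  have := @is_derive1_comp R (flat_exp i) _ x _ _ (is_derive_flat_exp i (a + b * x)) dl.
  by move=> H; apply: is_derive_eq H _; rewrite /du /u mulrC.
move=> n uC i; rewrite /du.
have c1 := Cn_mul openT (Cn_cst n setT (- i%:R)) (uC i.+1).
apply: (Cn_eq openT _ (Cn_mul openT (Cn_cst n setT b) (Cn_add openT (uC i.+2) c1))).
by move=> p _; rewrite mulNr.
Qed.

Definition cutoff (b c x : R) : R :=
  flat_exp 0 (c - x) / (flat_exp 0 (c - x) + flat_exp 0 (x - b)).

Lemma cutoff_denom b c x : b < c -> 0 < flat_exp 0 (c - x) + flat_exp 0 (x - b).
Proof.
move=> bc; have [cx|xc] := leP c x; last first.
  by rewrite ltr_pwDl ?flat_exp_ge0// flat_exp_gt0// subr_gt0.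
by rewrite ltr_pwDr ?flat_exp_ge0// flat_exp_gt0// subr_gt0 (lt_le_trans bc).
Qed.

Lemma cutoff_eq1 b c x : b < c -> x <= b -> cutoff b c x = 1.
Proof.
move=> bc xb; have := cutoff_denom x bc; rewrite /cutoff.
rewrite (@flat_exp_le0 0 (x - b)) ?subr_le0// addr0 => d0.
by rewrite divff// gt_eqF.
Qed.

Lemma cutoff_eq0 b c x : c <= x -> cutoff b c x = 0.
Proof. by move=> cx; rewrite /cutoff flat_exp_le0 ?mul0r// subr_le0. Qed.

Lemma Cn_cutoff (k m : nat) b c : b < c ->
  Cn_on m setT (fun p : 'rV[R]_k * R => cutoff b c p.2).
Proof.
move=> bc.
have e1 : Cn_on m setT (fun p : 'rV[R]_k * R => flat_exp 0 (c - p.2)).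
  apply: (Cn_eq openT _ (Cn_flat_exp k m 0 c (-1))) => p _.
  by rewrite mulN1r.
have e2 : Cn_on m setT (fun p : 'rV[R]_k * R => flat_exp 0 (p.2 - b)).
  apply: (Cn_eq openT _ (Cn_flat_exp k m 0 (- b) 1)) => p _.
  by rewrite mul1r addrC.
apply: (Cn_mul openT e1); apply: (Cn_inv openT _ (Cn_add openT e1 e2)) => p _.
by rewrite gt_eqF// cutoff_denom.
Qed.

End cutoff.
(** * Restriction to the real variables *)

Section real_restriction.
Variables (R : realType) (k : nat).
Local Notation C := R[i].
Local Notation P := ('rV[C]_k * C)%type.
Local Notation X := ('rV[R]_k * R)%type.
Implicit Types (f : P -> C) (W : set P) (p q v : X) (x y : 'rV[R]_k) (c : C).

Definition emb p : P := (RtoC p.1, p.2%:C).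

Lemma emb_line p v (h : R) : emb (p + h *: v) = emb p + h%:C *: emb v.
Proof.
apply/eqP; rewrite xpair_eqE; apply/andP; split; apply/eqP.
  by apply/rowP => i; rewrite !mxE rmorphD rmorphM.
by rewrite /= rmorphD rmorphM.
Qed.

Lemma pn_emb v : pn (emb v) <= `|v|.
Proof.
apply/ler_addgt0Pr => e e0; apply/ltW/pn_pair_lt.
  by rewrite pn_RtoC prod_normE ltr_pwDr// le_max lexx.
by rewrite normc_real prod_normE ltr_pwDr// le_max lexx orbT.
Qed.

(** The values [1] and [- 'i] of [c] give the real and the imaginary part of [f]. The derivative has
    the same shape with [dd] in place of [f], so the statement can be iterated. *)
Lemma is_derive_restriction W f c p v : gholo W f -> W (emb p) ->
  is_derive p v (fun q => complex.Re (c * f (emb q)))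
    (complex.Re (c * dd (emb v) f (emb p))).
Proof.
move=> fW Wp; apply: is_derive_eps => e e0.
have c0 : 0 < normc c + 1 by rewrite ltr_pwDr// normc_ge0.
have [d d0 dP] := gholo_dd (emb v) fW Wp (divr_gt0 e0 c0).
exists d => // h hd; rewrite emb_line -Re_sub [h * _]mulrC -Re_mul_real -Re_sub.
apply: le_trans (normc_Re _) _.
have := dP h%:C; rewrite normc_real add0r scale0r addr0 => /(_ hd) H.
have -> : c * f (emb p + h%:C *: emb v) - c * f (emb p) - c * dd (emb v) f (emb p) * h%:C =
  c * (f (emb p + h%:C *: emb v) - f (emb p) - dd (emb v) f (emb p) * h%:C) by ring.
rewrite normcM (le_trans (ler_wpM2l (normc_ge0 c) H))//.
have -> : normc c * (e / (normc c + 1) * `|h|) = (e * `|h|) * (normc c / (normc c + 1)).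
  by field; rewrite gt_eqF.
rewrite ler_piMr ?mulr_ge0 ?(ltW e0)// ler_pdivrMr// mul1r lerDl//.
Qed.

Lemma continuous_restriction W f c p : gholo W f -> W (emb p) ->
  {for p, continuous (fun q => complex.Re (c * f (emb q)))}.
Proof.
move=> fW Wp; have [r [K [r0 rK]]] := gholo_lip fW Wp.
apply/cvgrPdist_lt => e e0.
have K0 : 0 < normc c * `|K| + 1 by rewrite ltr_pwDr// mulr_ge0// normc_ge0.
apply/(@nbhs_ballP R X); exists (Num.min r (e / (normc c * `|K| + 1))) => /=.
  by rewrite lt_min r0 divr_gt0.
move=> q; rewrite -ball_normE /= lt_min ltr_pdivlMr// distrC => /andP[qr qe].
have pq : pn (emb q - emb p) <= `|q - p|.
  have -> : emb q - emb p = emb (q - p).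
    by have := emb_line q p (-1); rewrite scaleN1r rmorphN scaleN1r.
  exact: pn_emb.
have H := rK _ (le_lt_trans pq qr).
have H' : K * pn (emb q - emb p) <= `|K| * `|q - p|.
  apply: le_trans (ler_norm _) _; rewrite normrM [`|pn _|]ger0_norm ?pn_ge0//.
  exact: ler_wpM2l.
rewrite distrC -Re_sub -mulrBr (le_lt_trans (normc_Re _))// normcM.
apply: le_lt_trans qe; rewrite mulrDr mulr1 ler_wpDr//.
rewrite [leRHS]mulrC -mulrA; apply: ler_wpM2l; first exact: normc_ge0.
exact: le_trans H H'.
Qed.

(** A partial derivative of the restriction is the restriction of a directional derivative, which is
    holomorphic again by [gholo_derivative]; hence an induction over all [f]. *)
Lemma Cn_restriction W (D : set X) c m f : gholo W f -> open D ->
  (forall p, D p -> W (emb p)) ->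
  Cn_on m D (fun p => complex.Re (c * f (emb p))).
Proof.
move=> + oD DW; elim: m f => [|m IH] f fW.
  by split=> // p /DW; exact: continuous_restriction.
split=> [p /DW|o]; first exact: continuous_restriction.
have der p : D p -> is_derive p (basis_vec R o) (fun q => complex.Re (c * f (emb q)))
    (complex.Re (c * dd (emb (basis_vec R o)) f (emb p))).
  by move=> /DW; exact: is_derive_restriction.
split; first by move=> p /der[].
apply: (Cn_eq oD _ (IH _ (gholo_derivative (emb (basis_vec R o)) fW))) => p /der.
by move=> [_ ->].
Qed.

Lemma is_derive_slice (g : X -> R) x y (xi l : R) :
  is_derive (x, xi) ((y, 0) : X) g l -> is_derive x y (fun z => g (z, xi)) l.
Proof.
move=> [dg gl].
have E h : h *: ((y, 0) : X) + (x, xi) = (h *: y + x, xi).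
  by apply/eqP; rewrite xpair_eqE /= eqxx scaler0 add0r eqxx.
have e : (fun h : R => h^-1 *: (g (h *: ((y, 0) : X) + (x, xi)) - g (x, xi))) =
    (fun h : R => h^-1 *: (g (h *: y + x, xi) - g (x, xi))).
  by apply/funext => h; rewrite E.
by apply: DeriveDef; [move: dg|move: gl]; rewrite /derivable /derive e.
Qed.

End real_restriction.

(** * Iterated partial derivatives *)

Section multi_index.
Variables (R : realType) (k : nat).
Local Notation X := ('rV[R]_k * R)%type.
Implicit Types (u v : 'rV[R]_k -> R) (a : 'I_k -> nat) (s : seq 'I_k).

Definition Dword s u := foldr (fun i v x => 'D_(delta_mx 0 i) v x) u s.

(** A multi-index is unfolded into a list of single directions, so that inductions treat one
    derivative at a time. *)
Definition word a : seq 'I_k := flatten [seq nseq (a i) i | i <- enum 'I_k].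

Lemma mderiveE a u : mderive a u = Dword (word a) u.
Proof.
rewrite /mderive /word /Dword; elim: (enum _) => //= i s ->.
by rewrite foldr_cat; elim: (a i) => //= n ->.
Qed.

Variables (Om : set 'rV[R]_k).
Hypothesis oOm : open Om.

Lemma Dword_eq s u v : (forall x, Om x -> u x = v x) ->
  forall x, Om x -> Dword s u x = Dword s v x.
Proof.
move=> uv; elim: s => //= i s IH x Ox.
by apply: near_eq_derive; apply: filterS IH _; exact: open_nbhs_nbhs.
Qed.

(** An iterated derivative of a slice is again the slice of a smooth function of both variables,
    from which the next derivative is obtained. *)
Lemma Dword_Cn s (D : set X) (h : X -> R) xi : (forall m, Cn_on m D h) ->
  (forall x, Om x -> D (x, xi)) ->
  exists g : X -> R, (forall m, Cn_on m D g) /\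
    forall x, Om x -> Dword s (fun y => h (y, xi)) x = g (x, xi).
Proof.
move=> hC OD; elim: s => [|i s [g [gC gE]]]; first by exists h.
exists (fun p => 'D_(basis_vec R (Some i)) g p); split=> [m|x Ox].
  by have [_ gd] := gC m.+1; have [] := gd (Some i).
rewrite /= (@near_eq_derive _ _ _ _ (fun y => g (y, xi))); last first.
  by apply: filterS gE _; exact: open_nbhs_nbhs.
have [_ gd] := gC 1%N; have [/(_ _ (OD x Ox)) dg _] := gd (Some i).
by have [_ ->] := is_derive_slice (derivableP dg).
Qed.

Lemma DwordB s (D D' : set X) (h h' : X -> R) xi :
  (forall m, Cn_on m D h) -> (forall m, Cn_on m D' h') ->
  (forall x, Om x -> D (x, xi)) -> (forall x, Om x -> D' (x, xi)) ->
  forall x, Om x -> Dword s (fun y => h (y, xi) - h' (y, xi)) x =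
    Dword s (fun y => h (y, xi)) x - Dword s (fun y => h' (y, xi)) x.
Proof.
move=> hC hC' OD OD'; elim: s => //= i s IH x Ox.
rewrite (@near_eq_derive _ _ _ _
   (fun x => Dword s (fun y => h (y, xi)) x - Dword s (fun y => h' (y, xi)) x));
   last by apply: filterS IH _; exact: open_nbhs_nbhs.
have derivable_word (E : set X) (e : X -> R) : (forall m, Cn_on m E e) ->
    (forall x, Om x -> E (x, xi)) ->
    derivable (Dword s (fun y => e (y, xi))) x (delta_mx 0 i).
  move=> eC OE; have [g [gC gE]] := Dword_Cn s eC OE.
  apply: near_eq_derivable.
    near=> y; apply/esym/gE; near: y; exact: open_nbhs_nbhs.
  have [_ gd] := gC 1%N; have [/(_ _ (OE x Ox)) dg _] := gd (Some i).
  by have [] := is_derive_slice (derivableP dg).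
by rewrite deriveB//; [exact: derivable_word hC OD|exact: derivable_word hC' OD'].
Unshelve. all: by end_near. Qed.

End multi_index.

(** * Moderate growth of all derivatives *)

Section moderate.
Variables (R : realType) (k : nat) (Om : set 'rV[R]_k) (O : nat -> set 'rV[R]_k).
Local Notation C := R[i].
Local Notation P := ('rV[C]_k * C)%type.
Implicit Types (f : P -> C) (p q : P) (x y : 'rV[R]_k) (xi : R) (n : nat).

Definition ddword (s : seq 'I_k) f :=
  foldr (fun i g => dd (emb (delta_mx 0 i, 0 : R)) g) f s.

Lemma gholo_ddword W s f : gholo W f -> gholo W (ddword s f).
Proof. by move=> fW; elim: s => //= i s; exact: gholo_derivative. Qed.

Lemma Dword_restriction W s f c xi : open Om -> gholo W f ->
  (forall x, Om x -> W (emb (x, xi))) -> forall x, Om x ->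
  Dword s (fun y => complex.Re (c * f (emb (y, xi)))) x =
  complex.Re (c * ddword s f (emb (x, xi))).
Proof.
move=> oOm fW OW; elim: s => //= i s IH x Ox.
rewrite (@near_eq_derive _ _ _ _
   (fun x => complex.Re (c * ddword s f (emb (x, xi))))); last first.
  by apply: filterS IH _; exact: open_nbhs_nbhs.
by have [_ ->] := is_derive_slice (is_derive_restriction c
  ((delta_mx 0 i, 0) : 'rV[R]_k * R) (gholo_ddword s fW) (OW x Ox)).
Qed.

(* The constant and the exponent are the same natural number [N] so that the
   estimate is monotone in a single parameter. *)
Definition locally_moderate n f := forall x0, Om x0 ->
  exists (N : nat) (d : R), 0 < d <= 1 /\ forall p xi,
    `|ReV p.1 - x0| < d -> p.2 = xi%:C -> 0 < xi < d -> `|ImV p.1| < d * xi ->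
    V_set Om O n p /\ normc (f p) <= N%:R * xi ^- N.

End moderate.
(** A complex disc of radius [d * xi / 2] in the [i]-th coordinate stays where [f] is bounded by
    [N * xi ^- N], since [zeta] does not move. Cauchy's estimate on it costs a factor
    [8 / (d * xi)]: the exponent rises by one, and the neighbourhood of [x0] is halved. *)
Lemma moderate_dd (R : realType) (k : nat) (Om : set 'rV[R]_k)
    (O : nat -> set 'rV[R]_k) (n : nat) (i : 'I_k) f :
  gholo (V_set Om O n) f -> locally_moderate Om O n f ->
  locally_moderate Om O n (dd (emb (delta_mx 0 i, 0 : R)) f).
Proof.
move=> fV fm x0 Ox0; have [N [d [/andP[d0 d1] fN]]] := fm x0 Ox0.
have d2 : 0 < d / 2 by rewrite divr_gt0.
set v := emb _.
have v1 : pn v <= 1.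
  apply: le_trans (pn_emb _) _; rewrite prod_normE ge_max normr0 ler01 andbT.
  apply/ler_addgt0Pr => e e0; apply/ltW/row_norm_lt; first by rewrite ltr_pwDr.
  by move=> j; rewrite mxE; case: (_ && _); rewrite ?normr1 ?normr0 ?ltrDl// ltr_pwDr.
(* [N'] exceeds the new constant [8 * N / d] and is at least the new exponent [N + 1]. *)
pose N' := maxn (Num.truncn (8 * N%:R / d)).+1 N.+1.
exists N', (d / 2); split; first by apply/andP; split; [|clear - d0 d1; lra].
move=> p xi pd p2 /andP[xi0 xid] ip.
have near_p q : pn (q - p) < d * xi / 2 -> q.2 = xi%:C ->
    V_set Om O n q /\ normc (f q) <= N%:R * xi ^- N.
  move=> qp q2; have dx : d * xi / 2 <= d / 2.
    by rewrite ler_pM2r ?invr_gt0// ler_piMr ?(ltW d0)//; clear - xid d1 d0; lra.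
  apply: fN => //.
  - have e := ler_normD (ReV q.1 - ReV p.1) (ReV p.1 - x0).
    rewrite addrA subrK in e; have e' := dist_fst p q.
    by clear - e e' qp dx pd; lra.
  - by rewrite xi0; clear - xid d0; lra.
  - have e := ler_normD (ImV q.1 - ImV p.1) (ImV p.1).
    rewrite subrK in e; have e' := dist_ImV p q.
    by clear - e e' qp ip; lra.
have dx0 : 0 < d * xi / 2 by rewrite divr_gt0// mulr_gt0.
have [|Vp _] := near_p p _ p2; first by rewrite subrr pn0.
split=> //.
have hb : holo_bd (fun l : R[i] => f (p + l *: v)) 0 (d * xi / 2) (N%:R * xi ^- N).
  move=> l; rewrite subr0 => ld.
  have [||Vl fl] := near_p (p + l *: v).
  - rewrite addrAC subrr add0r pnZ (le_lt_trans _ ld)//.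
    by rewrite ler_piMr// normc_ge0.
  - by rewrite /= [l *: _]mulr0 addr0.
  by split=> //; eexists; exact: gholo_line fV Vl.
apply: le_trans (cauchy_bd dx0 hb (gholo_dd v fV Vp)) _.
have xi1 : xi <= 1 by clear - xid d1 d0; lra.
have -> : 4 * (N%:R * xi ^- N) / (d * xi / 2) = 8 * N%:R / d * xi ^- N.+1.
  by rewrite [xi ^+ N.+1]exprS; field; rewrite !gt_eqF ?exprn_gt0.
have i0 : 0 <= xi ^- N.+1 by rewrite invr_ge0 exprn_ge0// ltW.
apply: ler_pM => //; first by rewrite divr_ge0 ?mulr_ge0// ltW.
  apply: le_trans (ltW (truncnS_gt _)) _.
  by rewrite ler_nat leq_maxl.
rewrite lef_pV2 ?posrE ?exprn_gt0//; apply: ler_wiXn2l => //; first exact: ltW.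
exact: leq_maxr.
Qed.

(** Continuity bounds [phi] by [phi x0 + 1] near [x0], and taking [d] at most [n^-1] places the
    points considered in the domain by [V_set_thin]. *)
Lemma Hspace_moderate (R : realType) (k : nat) (Om : set 'rV[R]_k)
    (O : nat -> set 'rV[R]_k) (n : nat) phi f :
  open Om -> admissible Om O -> (0 < n)%N -> weight Om phi -> Hspace Om O n phi f ->
  locally_moderate Om O n f.
Proof.
move=> oOm adm n0 [phic phi0] [_ [c c0 fc]] x0 Ox0.
have /andP[i0 i1] := @invn_le1 R n n0.
have [r r0 rO] := open_row oOm Ox0.
have [s s0 sphi] : exists2 s : R, 0 < s & forall x, `|x - x0| < s -> phi x <= phi x0 + 1.
  move: phic; rewrite continuous_open_subspace// => /(_ x0).
  rewrite inE => /(_ Ox0)/cvgrPdist_lt/(_ 1 ltr01)/nbhs_ballP[s /= s0 sP].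
  exists s => // x xx0; have := sP x; rewrite -ball_normE /= distrC => /(_ xx0).
  by rewrite ltr_norml => /andP[h1 h2]; clear - h1 h2; lra.
pose B := c * (phi x0 + 1).
have B0 : 0 <= B by rewrite mulr_ge0 ?addr_ge0// ltW// phi0.
exists (maxn (Num.truncn B).+1 n), (Num.min (Num.min r s) n%:R^-1).
split; first by rewrite !lt_min r0 s0 i0 /= ge_min i1 orbT.
move=> p xi; rewrite !lt_min => /andP[/andP[pr ps] _] p2 /and3P[xi0 /andP[_ _] xin] ip.
have nxi : normc xi%:C = xi by rewrite normc_real gtr0_norm.
have xi1 : xi <= 1 by rewrite (le_trans (ltW xin)).
have dn : Num.min (Num.min r s) n%:R^-1 <= n%:R^-1 :> R by rewrite ge_min lexx orbT.
have Vp : V_set Om O n p.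
  apply: (V_set_thin adm n0 (rO _ pr) p2); first by rewrite xi0.
  by apply: lt_le_trans ip _; rewrite ler_wpM2r// ltW.
split=> //; apply: le_trans (fc p Vp) _; rewrite p2 nxi.
have i : 0 <= xi ^- n by rewrite invr_ge0 exprn_ge0// ltW.
have Ox := rO _ pr.
apply: ler_pM => //; first by rewrite mulr_ge0// ltW// phi0.
  apply: le_trans (_ : B <= _); first by rewrite ler_wpM2l ?sphi// ltW.
  by apply: le_trans (ltW (truncnS_gt _)) _; rewrite ler_nat leq_maxl.
rewrite lef_pV2 ?posrE ?exprn_gt0//; apply: ler_wiXn2l => //; first exact: ltW.
exact: leq_maxr.
Qed.

Lemma moderate_ddword (R : realType) (k : nat) (Om : set 'rV[R]_k)
    (O : nat -> set 'rV[R]_k) (n : nat) (s : seq 'I_k) f :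
  gholo (V_set Om O n) f -> locally_moderate Om O n f ->
  locally_moderate Om O n (ddword s f).
Proof.
move=> fV fm; elim: s => //= i s; apply: moderate_dd; exact: gholo_ddword.
Qed.

(** Compactness is used in its near-covering form, with the filter of large [N] in place of a finite
    subcover. This works because the estimate passes to larger [N]: constant and exponent increase
    while [xi] is restricted to [xi < N.+1^-1 <= 1]. *)
Lemma moderate_compact (R : realType) (k : nat) (Om : set 'rV[R]_k)
    (O : nat -> set 'rV[R]_k) (n : nat) f (K : set 'rV[R]_k) :
  locally_moderate Om O n f -> compact K -> K `<=` Om ->
  exists N : nat, forall x (xi : R), K x -> 0 < xi < N.+1%:R^-1 ->
    normc (f (emb (x, xi))) <= N%:R * xi ^- N.
Proof.
move=> fm /compact_near_coveringP cK KOm.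
pose Q (N : nat) x := forall xi : R, 0 < xi < N.+1%:R^-1 ->
  normc (f (emb (x, xi))) <= N%:R * xi ^- N.
suff [N _ NQ] : \forall N \near \oo, K `<=` Q N.
  by exists N => x xi Kx; apply: (NQ N) => //=.
apply: cK => x0 Kx0; have [N [d [/andP[d0 d1] fN]]] := fm x0 (KOm _ Kx0).
(* [M] above the truncation of [d^-1] ensures [M.+1^-1 <= d], so the local estimate applies to every
   [xi < M.+1^-1]. *)
exists ([set y | `|y - x0| < d], [set M | (maxn N (Num.truncn d^-1).+1 <= M)%N]).
  split; last by exists (maxn N (Num.truncn d^-1).+1).
  apply/nbhs_ballP; exists d => // y; rewrite -ball_normE /= distrC.
  exact.
move=> [y M] /= [yx]; rewrite geq_max => /andP[NM dM] xi /andP[xi0 xiM].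
have M0 : 0 < M.+1%:R :> R by rewrite ltr0n.
have xi1 : xi <= 1 by rewrite (le_trans (ltW xiM))// invf_le1// ler1n.
have xid : xi < d.
  rewrite (lt_le_trans xiM)// -[leRHS]invrK lef_pV2 ?posrE ?invr_gt0//.
  by rewrite (le_trans (ltW (truncnS_gt _)))// ler_nat (leq_trans dM).
have [|||| _ H] := fN (emb (y, xi)) xi.
- by rewrite /= ReV_RtoC.
- by [].
- by rewrite xi0.
- by rewrite /= ImV_RtoC normr0 mulr_gt0.
apply: le_trans H _; apply: ler_pM => //.
- by rewrite invr_ge0 exprn_ge0// ltW.
- by rewrite ler_nat.
by rewrite lef_pV2 ?posrE ?exprn_gt0//; apply: ler_wiXn2l => //; exact: ltW.
Qed.

Lemma Im_Re_i (R : realType) (z : R[i]) : complex.Im z = complex.Re (- 'i%C * z).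
Proof. by case: z => a b /=; ring. Qed.

(** * Extension of restrictions to the interval ]0, 1] *)

Section extension.
Variables (R : realType) (k : nat) (Om : set 'rV[R]_k) (O : nat -> set 'rV[R]_k).
Local Notation X := ('rV[R]_k * R)%type.

Lemma open_setX (A : set 'rV[R]_k) (B : set R) : open A -> open B -> open (A `*` B : set X).
Proof.
rewrite !openE => oA oB [x xi] /= [Ax Bx]; exists (A, B) => //=.
by split; [exact: oA|exact: oB].
Qed.

(** Elements of [Emod] live on []0, 1]], whereas the restriction is known only for [xi < n^-1]; from
    [c] on, the unspecified values of [f] are multiplied by [0]. *)
Definition extend (b c : R) (f : 'rV[R[i]]_k * R[i] -> R[i]) (p : X) : R[i] :=
  (cutoff b c p.2)%:C * f (emb p).

(** Two open sets cover the product of [Om] and []0, 1]]: one with [xi < n^-1], where [f] is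
    holomorphic, and one with [c < xi], where the cutoff vanishes identically. They overlap because
    [c < n^-1]. *)
Lemma extend_smooth n f b c : open Om -> admissible Om O -> (0 < n)%N ->
  gholo (V_set Om O n) f -> b < c -> c < n%:R^-1 ->
  smooth Om (extend b c f).
Proof.
move=> oOm adm n0 fV bc cn.
have sm (w : R[i]) : smooth_real Om (fun p => cutoff b c p.2 * complex.Re (w * f (emb p))).
  pose D1 : set X := Om `*` [set xi | 0 < xi < n%:R^-1].
  pose D2 : set X := Om `*` [set xi | c < xi].
  have oD1 : open D1.
    apply: open_setX => //.
    have -> : [set xi : R | 0 < xi < n%:R^-1] = [set` `]0, n%:R^-1[].
      by apply/seteqP; split => xi /=; rewrite in_itv.
    exact: itv_open.
  have oD2 : open D2 by apply: open_setX => //; exact: open_gt.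
  exists (D1 `|` D2), (fun p => cutoff b c p.2 * complex.Re (w * f (emb p))); split=> //.
  - exact: openU.
  - move=> [x xi] [/= Ox]; rewrite in_itv /= => /andP[xi0 xi1].
    have [xc|cx] := leP xi c; [left|right]; split=> //=.
    by rewrite xi0 (le_lt_trans xc).
  move=> m; apply: Cn_setU.
    apply: Cn_mul => //; first exact: Cn_subset (Cn_cutoff _ _ bc).
    apply: (Cn_restriction w m fV oD1) => -[x xi] [/= Ox xin].
    exact: (V_set_real adm).
  apply: (Cn_eq oD2 _ (Cn_cst m D2 0)) => -[x xi] [/= _ cx].
  by rewrite cutoff_eq0 ?mul0r// ltW.
split.
  have := sm 1; congr smooth_real; apply/funext => p.
  by rewrite mul1r /extend [_%:C * _]mulrC Re_mul_real mulrC.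
have := sm (- 'i%C); congr smooth_real; apply/funext => p.
by rewrite -Im_Re_i /extend [_%:C * _]mulrC Im_mul_real mulrC.
Qed.

Lemma extend_represents b c f : 0 < b -> b < c -> represents Om (extend b c f) f.
Proof.
move=> b0 bc; near=> xi.
have xib : xi <= b by near: xi; exact: nbhs_right_le.
by move=> x Ox; rewrite /extend cutoff_eq1 ?mul1r.
Unshelve. all: by end_near. Qed.

Lemma xderive_eq (a : 'I_k -> nat) (F G : X -> R[i]) x xi : open Om -> Om x ->
  (forall y, Om y -> F (y, xi) = G (y, xi)) -> xderive a F x xi = xderive a G x xi.
Proof.
move=> oOm Ox FG; rewrite /xderive !mderiveE.
by congr (_ +i* _); apply: (Dword_eq oOm) => // y /FG ->.
Qed.

Lemma extend_Emod n f b c : open Om -> admissible Om O -> (0 < n)%N ->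
  gholo (V_set Om O n) f -> locally_moderate Om O n f ->
  0 < b -> b < c -> c < n%:R^-1 ->
  Emod Om (extend b c f).
Proof.
move=> oOm adm n0 fV fm b0 bc cn; split; first exact: extend_smooth cn.
move=> a K cK KOm.
have [N NP] := moderate_compact (moderate_ddword (word a) fV fm) cK KOm.
exists N, N%:R; near=> xi.
have xi0 : 0 < xi by near: xi; exact: nbhs_right_gt.
have xib : xi <= b by near: xi; exact: nbhs_right_le.
have xiN : xi < N.+1%:R^-1 by near: xi; apply: nbhs_right_lt; rewrite invr_gt0 ltr0n.
move=> x Kx; have Vx y : Om y -> V_set Om O n (emb (y, xi)).
  move=> Oy; apply: (V_set_real adm) => //; rewrite xi0/=.
  by rewrite (le_lt_trans xib)// (lt_trans bc).
rewrite (@xderive_eq a _ (fun p => f (emb p)) x xi oOm (KOm _ Kx)); last first.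
  by move=> y _; rewrite /extend cutoff_eq1// mul1r.
suff -> : xderive a (fun p => f (emb p)) x xi = ddword (word a) f (emb (x, xi)).
  by apply: NP => //; rewrite xi0.
have Ox := KOm _ Kx.
rewrite /xderive !mderiveE.
have -> : (fun y => complex.Re (f (emb (y, xi)))) =
    (fun y => complex.Re (1 * f (emb (y, xi)))).
  by apply/funext => y; rewrite mul1r.
have -> : (fun y => complex.Im (f (emb (y, xi)))) =
    (fun y => complex.Re (- 'i%C * f (emb (y, xi)))).
  by apply/funext => y; exact: Im_Re_i.
rewrite !(Dword_restriction _ _ oOm fV Vx Ox) mul1r -Im_Re_i.
by case: (ddword _ _ _).
Unshelve. all: by end_near. Qed.

End extension.

(** * The algebras of generalized functions *)

Section colombeau_algebra.
Variables (R : realType) (k : nat) (Om : set 'rV[R]_k).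
Hypothesis oOm : open Om.
Local Notation X := ('rV[R]_k * R)%type.
Implicit Types (F G H : X -> R[i]) (g h : X -> R).

Lemma smooth_realB g h : smooth_real Om g -> smooth_real Om h ->
  smooth_real Om (fun p => g p - h p).
Proof.
move=> [W [g' [oW OW gC gg']]] [W' [h' [oW' OW' hC hh']]].
exists (W `&` W'), (fun p => g' p - h' p); split.
- exact: openI.
- by move=> p Op; split; [exact: OW|exact: OW'].
- move=> m; have oWW' := openI oW oW'.
  apply: Cn_add => //; first by apply: Cn_subset (gC m) => p [].
  by apply: Cn_opp => //; apply: Cn_subset (hC m) => p [].
- by move=> p Op; rewrite gg'// hh'.
Qed.

(** Smoothness on []0, 1]] is that of an extension, so the derivatives are computed on the
    extensions [g'] and [h'], whose slices agree with those of [g] and [h] over the open set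
    [Om]. *)
Lemma mderive_smoothB a g h x xi : smooth_real Om g -> smooth_real Om h ->
  Om x -> 0 < xi <= 1 ->
  mderive a (fun y => g (y, xi) - h (y, xi)) x =
  mderive a (fun y => g (y, xi)) x - mderive a (fun y => h (y, xi)) x.
Proof.
move=> [W [g' [oW OW gC gg']]] [W' [h' [oW' OW' hC hh']]] Ox xi01.
have Oxi y : Om y -> (Om `*` `]0, 1]%classic) (y, xi) by move=> Oy; split; rewrite //= in_itv.
have WO y : Om y -> W (y, xi) by move=> /Oxi/OW.
have WO' y : Om y -> W' (y, xi) by move=> /Oxi/OW'.
rewrite !mderiveE.
rewrite (@Dword_eq _ _ Om oOm _ (fun y => g (y, xi)) (fun y => g' (y, xi)))//; last first.
  by move=> y /Oxi/gg'.
rewrite (@Dword_eq _ _ Om oOm _ (fun y => h (y, xi)) (fun y => h' (y, xi)))//; last first.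
  by move=> y /Oxi/hh'.
rewrite (@Dword_eq _ _ Om oOm _ _ (fun y => g' (y, xi) - h' (y, xi)))//; last first.
  by move=> y Oy; rewrite gg' ?hh'//; exact: Oxi.
exact: (DwordB oOm (word a) gC hC WO WO').
Qed.

Lemma xderiveB a F G x xi : smooth Om F -> smooth Om G -> Om x -> 0 < xi <= 1 ->
  xderive a (F \- G) x xi = xderive a F x xi - xderive a G x xi.
Proof.
move=> [F1 F2] [G1 G2] Ox xi01.
apply/eqP; rewrite eq_complex /xderive /=; apply/andP; split; apply/eqP.
  rewrite -(mderive_smoothB a F1 G1 Ox xi01); congr (mderive _ _ _).
  by apply/funext => y; rewrite Re_sub.
rewrite -(mderive_smoothB a F2 G2 Ox xi01); congr (mderive _ _ _).
by apply/funext => y; rewrite Im_sub.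
Qed.

Lemma smoothB F G : smooth Om F -> smooth Om G -> smooth Om (F \- G).
Proof.
move=> [F1 F2] [G1 G2]; split.
  have := smooth_realB F1 G1; congr smooth_real; apply/funext => p.
  by rewrite /= Re_sub.
have := smooth_realB F2 G2; congr smooth_real; apply/funext => p.
by rewrite /= Im_sub.
Qed.

Lemma EmodB F G : Emod Om F -> Emod Om G -> Emod Om (F \- G).
Proof.
move=> [Fs Fm] [Gs Gm]; split=> [|a K cK KO]; first exact: smoothB.
have [N [c Nc]] := Fm a K cK KO; have [N' [c' Nc']] := Gm a K cK KO.
exists (maxn N N'), (`|c| + `|c'|); near=> xi.
have xi0 : 0 < xi by near: xi; exact: nbhs_right_gt.
have xi1 : xi <= 1 by near: xi; exact: nbhs_right_le.
have FN : forall x, K x -> normc (xderive a F x xi) <= c * xi ^- N by near: xi.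
have GN : forall x, K x -> normc (xderive a G x xi) <= c' * xi ^- N' by near: xi.
have le_max (d : R) m M : (m <= M)%N -> d * xi ^- m <= `|d| * xi ^- M.
  move=> mM; apply: le_trans (_ : `|d| * xi ^- m <= _).
    by rewrite ler_wpM2r ?ler_norm// invr_ge0 exprn_ge0// ltW.
  rewrite ler_wpM2l// lef_pV2 ?posrE ?exprn_gt0//.
  by apply: ler_wiXn2l => //; exact: ltW.
move=> x Kx; rewrite xderiveB ?xi0//; last exact: KO.
rewrite (le_trans (normcB _ _))// mulrDl lerD//.
  by rewrite (le_trans (FN x Kx))// le_max// leq_maxl.
by rewrite (le_trans (GN x Kx))// le_max// leq_maxr.
Unshelve. all: by end_near. Qed.

Lemma xderive0 a x xi : xderive a ((fun=> 0) : X -> R[i]) x xi = 0.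
Proof.
have D0 s : Dword s (fun=> 0 : R) = (fun=> 0) :> ('rV[R]_k -> R).
  elim: s => //= i s ->; apply/funext => y; exact: derive_cst.
by rewrite /xderive !mderiveE /= !D0.
Qed.

Lemma Nnull_near0 F : Emod Om F ->
  (\forall xi \near 0^'+, forall x, Om x -> F (x, xi) = 0) -> Nnull Om F.
Proof.
move=> FE F0; split=> // a K q cK KO; exists 1 => //; near=> xi.
have xi0 : 0 < xi by near: xi; exact: nbhs_right_gt.
have Fxi : forall x, Om x -> F (x, xi) = 0 by near: xi.
move=> x Kx; rewrite (@xderive_eq _ _ _ a F (fun=> 0) x xi oOm (KO _ Kx) Fxi).
by rewrite xderive0 normc0 mul1r exprn_ge0// ltW.
Unshelve. all: by end_near. Qed.

Lemma Nnull_near_eq F G : Emod Om G -> Nnull Om F ->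
  (\forall xi \near 0^'+, forall x, Om x -> F (x, xi) = G (x, xi)) -> Nnull Om G.
Proof.
move=> GE [FE Fn] FG; split=> // a K q cK KO.
have [c c0 Fc] := Fn a K q cK KO; exists c => //; near=> xi.
have Fxi : forall x, Om x -> F (x, xi) = G (x, xi) by near: xi.
have Fcxi : forall x, K x -> normc (xderive a F x xi) <= c * xi ^+ q by near: xi.
by move=> x Kx; rewrite -(xderive_eq a oOm (KO _ Kx) Fxi) Fcxi.
Unshelve. all: by end_near. Qed.

Lemma coset_self F : Emod Om F -> coset Om F F.
Proof.
move=> FE; split=> //; apply: Nnull_near0; first exact: EmodB.
by near=> xi => x _; rewrite /= subrr.
Unshelve. all: by end_near. Qed.

Lemma coset_near_eq F G H : Emod Om F -> Emod Om G -> coset Om F H ->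
  (\forall xi \near 0^'+, forall x, Om x -> F (x, xi) = G (x, xi)) -> coset Om G H.
Proof.
move=> FE GE [HE HF] FG; split=> //.
apply: Nnull_near_eq HF _; first exact: EmodB.
by apply: filterS FG => xi FG x Ox; rewrite /= FG.
Qed.

End colombeau_algebra.

(** * The inductive limit and injectivity *)

Section inductive_limit.
Variables (R : realType) (k : nat) (Om : set 'rV[R]_k) (O : nat -> set 'rV[R]_k).
Hypotheses (oOm : open Om) (adm : admissible Om O).
Implicit Types (s t u : Helt R k) (phi psi : 'rV[R]_k -> R).

(** The sum serves as a common majorant whenever two elements have to be compared in one space. *)
Lemma weightD phi psi : weight Om phi -> weight Om psi ->
  weight Om (fun x => phi x + psi x).
Proof.
move=> [phic phi0] [psic psi0]; split; last by move=> x Ox; rewrite addr_gt0 ?phi0 ?psi0.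
by move=> x; apply: cvgD; [exact: phic|exact: psic].
Qed.

Lemma Hsim_refl s : weight Om (Hweight s) -> Hsim Om O s s.
Proof. by move=> ws; exists (Hidx s), (Hweight s); split. Qed.

Lemma Hsim_sym s t : Hsim Om O s t -> Hsim Om O t s.
Proof.
move=> [m [psi [[sm tm] w hs ht st]]]; exists m, psi; split=> // p /st //.
Qed.

Lemma Hsim_trans s t u : (0 < Hidx t)%N ->
  Hsim Om O s t -> Hsim Om O t u -> Hsim Om O s u.
Proof.
move=> t0 [m [psi [[sm tm] w hs ht st]]] [m' [psi' [[tm' um'] w' ht' hu' tu]]].
exists (maxn m m'), (fun x => psi x + psi' x); split.
- by rewrite (leq_trans sm) ?leq_maxl// (leq_trans um')// leq_maxr.
- exact: weightD.
- by move=> x Ox; rewrite ler_wpDr ?hs// ltW// w'.2.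
- by move=> x Ox; rewrite ler_wpDl ?hu'// ltW// w.2.
- move=> p Vp; rewrite st ?tu//.
    by apply: (V_set_decr adm _ _ Vp); rewrite ?leq_maxr// (leq_trans t0).
  by apply: (V_set_decr adm _ _ Vp); rewrite ?leq_maxl// (leq_trans t0).
Qed.

Lemma Hclass_eq s t : Hunion Om O s -> Hunion Om O t -> Hsim Om O s t ->
  Hclass Om O s = Hclass Om O t.
Proof.
move=> [s0 _ _] [t0 _ _] st; apply/seteqP; split=> u [Hu su]; split=> //.
  by apply: Hsim_trans su => //; exact: Hsim_sym.
exact: Hsim_trans st su.
Qed.

Lemma Hunion_gholo s : Hunion Om O s -> gholo (V_set Om O (Hidx s)) (Hfun s).
Proof.
move=> [s0 _ [hs _]]; apply: differentiable_gholo hs => p.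
exact: V_set_open.
Qed.

Lemma exists_representative s : Hunion Om O s ->
  exists F, Emod Om F /\ represents Om F (Hfun s).
Proof.
move=> Hs; have [s0 ws fs] := Hs.
set n := Hidx s in s0 *; have /andP[i0 _] := @invn_le1 R n s0.
have b0 : 0 < (n%:R^-1 / 3 : R) by rewrite divr_gt0.
have bc : n%:R^-1 / 3 < n%:R^-1 / 2 :> R by lra.
exists (extend (n%:R^-1 / 3) (n%:R^-1 / 2) (Hfun s)); split.
  apply: (extend_Emod oOm adm s0) => //; last by lra.
    exact: Hunion_gholo.
  exact: Hspace_moderate fs.
exact: extend_represents.
Qed.

(** The union defining [imap] collapses to one coset: two elements of a class coincide on some
    [V_set Om O m], which contains [(x, xi)] for all [x] in [Om] once [xi < m^-1], and functions
    that agree for small [xi] have the same coset. *)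
Lemma imap_Hclass s F : Hunion Om O s -> Emod Om F -> represents Om F (Hfun s) ->
  imap Om (Hclass Om O s) = coset Om F.
Proof.
move=> Hs FE Fs; apply/seteqP; split=> [H [t [G [[Ht st] GE Gt GH]]]|H FH].
  apply: (coset_near_eq oOm GE FE GH).
  have [m [psi [[sm tm] _ _ _ fE]]] := st.
  have m0 : (0 < m)%N by have [s0 _ _] := Hs; exact: leq_trans sm.
  have /andP[i0 _] := @invn_le1 R m m0.
  near=> xi.
  have xi0 : 0 < xi by near: xi; exact: nbhs_right_gt.
  have xim : xi < m%:R^-1 by near: xi; exact: nbhs_right_lt.
  have Fxi : forall x, Om x -> F (x, xi) = real_restriction (Hfun s) (x, xi) by near: xi.
  have Gxi : forall x, Om x -> G (x, xi) = real_restriction (Hfun t) (x, xi) by near: xi.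
  move=> x Ox; rewrite Fxi// Gxi//; symmetry; apply: fE.
  by apply: (V_set_real adm) => //; rewrite xi0.
exists s, F; split=> //; split=> //; apply: Hsim_refl.
by have [_ ] := Hs.
Unshelve. all: by end_near. Qed.

Lemma xderive_nil (F : 'rV[R]_k * R -> R[i]) x xi : xderive (fun=> 0%N) F x xi = F (x, xi).
Proof.
have m0 (u : 'rV[R]_k -> R) : mderive (fun=> 0%N) u = u.
  by rewrite /mderive; elim: (enum _) => //= i r ->.
by rewrite /xderive !m0; case: (F (x, xi)).
Qed.

(** Equality of the cosets makes the difference of two representatives null, so the difference [f]
    of the holomorphic functions is flat at every real point. Its vanishing on [V_set Om O m] is
    exactly the identification required by [Hsim]. *)
Lemma imap_inj s t : connected Om -> Hunion Om O s -> Hunion Om O t ->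
  imap Om (Hclass Om O s) = imap Om (Hclass Om O t) -> Hsim Om O s t.
Proof.
move=> cOm Hs Ht.
have [F [FE Fs]] := exists_representative Hs.
have [G [GE Gt]] := exists_representative Ht.
rewrite (imap_Hclass Hs FE Fs) (imap_Hclass Ht GE Gt) => FG.
have [_ [_ FGn]] : coset Om G F by rewrite -FG; exact: coset_self.
have [s0 ws [_ [c c0 fsc]]] := Hs; have [t0 wt [_ [c' c'0 ftc]]] := Ht.
set m := maxn (Hidx s) (Hidx t).
have m0 : (0 < m)%N by rewrite leq_max s0.
have /andP[i0 i1] := @invn_le1 R m m0.
have Vs : V_set Om O m `<=` V_set Om O (Hidx s) by apply: V_set_decr; rewrite ?leq_maxl.
have Vt : V_set Om O m `<=` V_set Om O (Hidx t) by apply: V_set_decr; rewrite ?leq_maxr.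
pose f p := Hfun s p - Hfun t p.
have Vo p : V_set Om O m p ->
    exists2 r : R, 0 < r & forall q, pn (q - p) < r -> V_set Om O m q.
  exact: V_set_open.
have fflat : flat_on Om O m f.
  split.
  - by apply: gholoB; [apply: gholo_sub Vs Vo|apply: gholo_sub Vt Vo];
      exact: Hunion_gholo.
  - exists (fun x => c * Hweight s x + c' * Hweight t x) => p Vp.
    have [Op np] : Om (ReV p.1) /\ 0 < normc p.2 <= 1.
      move: Vp => /(V_setP adm _ m0)[[Op /andP[-> /ltW n1] _ _]|[Op /andP[-> /ltW n1] _]].
        by rewrite (le_trans n1).
      by rewrite (le_trans n1)//; split=> //; exact: (O_sub adm m0).
    case/andP: np => np0 np1.
    have le_pow (n : nat) (w : R) : 0 <= w -> (n <= m)%N -> w / normc p.2 ^+ n <= w / normc p.2 ^+ m.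
      move=> w0 nm; apply: ler_wpM2l => //; rewrite lef_pV2 ?posrE ?exprn_gt0//.
      by apply: ler_wiXn2l => //; exact: ltW.
    rewrite /f (le_trans (normcB _ _))// mulrDl lerD//.
      rewrite (le_trans (fsc _ (Vs _ Vp)))// le_pow ?leq_maxl//.
      by rewrite mulr_ge0// ltW// ws.2.
    rewrite (le_trans (ftc _ (Vt _ Vp)))// le_pow ?leq_maxr//.
    by rewrite mulr_ge0// ltW// wt.2.
  - move=> x Ox q.
    have x_Om : [set x] `<=` Om by move=> _ ->.
    (* The zero multi-index and the compact set [{x}] turn nullity into flatness of [f] over [x]. *)
    have [d d0 near0] := FGn (fun=> 0%N) [set x] q (@compact_set1 _ x) x_Om.
    have : \forall xi \near 0^'+, normc (f (RtoC x, xi%:C)) <= d * xi ^+ q.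
      near=> xi.
      have Fxi : forall x, Om x -> F (x, xi) = real_restriction (Hfun s) (x, xi) by near: xi.
      have Gxi : forall x, Om x -> G (x, xi) = real_restriction (Hfun t) (x, xi) by near: xi.
      have Nxi : forall y, [set x] y ->
          normc (xderive (fun=> 0%N) (F \- G) y xi) <= d * xi ^+ q by near: xi.
      by have := Nxi x erefl; rewrite xderive_nil /= Fxi// Gxi.
    rewrite near_withinE => /nbhs_ballP[e /= e0 eP]; exists d, e; split=> // xi.
    move=> /andP[xi0 xie]; apply: (eP xi) => //.
    by rewrite -ball_normE /= sub0r normrN gtr0_norm.
have f0 := V_set_uniqueness oOm cOm adm m0 fflat.
exists m, (fun x => Hweight s x + Hweight t x); split.
- by rewrite leq_maxl leq_maxr.
- exact: weightD.
- by move=> x Ox; rewrite lerDl ltW// wt.2.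
- by move=> x Ox; rewrite lerDr ltW// ws.2.
- by move=> p /f0/eqP; rewrite subr_eq0 => /eqP.
Unshelve. all: by end_near. Qed.

End inductive_limit.

Theorem theorem1 (R : realType) (k : nat) (Om : set 'rV[R]_k)
    (O : nat -> set 'rV[R]_k) :
  open Om -> connected Om -> admissible Om O ->
  set_fun (Ga Om O) (Gcol Om) (imap Om) /\ set_inj (Ga Om O) (imap Om).
Proof.
move=> oOm cOm adm; split.
  move=> _ [s Hs <-]; have [F [FE Fs]] := exists_representative oOm adm Hs.
  by exists F => //; rewrite (imap_Hclass oOm adm Hs FE Fs).
move=> u v; rewrite !inE => -[s Hs <-] [t Ht <-] st.
exact: (Hclass_eq adm Hs Ht (imap_inj oOm adm cOm Hs Ht st)).
Qed.
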